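(* Let $0<\alpha<n$, $1<p<n/\alpha$, $1/q=1/p-\alpha/n$, $\omega,\lambda\in A_{p,q}$, $\mu=\omega/\lambda$, and $b\in L^1_{loc}(\mathbb{R}^n)$. Let $\Omega\in C(\mathbb{S}^{n-1})$ be nonzero and homogeneous of degree $0$, with associated integral operator $T_\alpha$. Then $$b\in BMO_\mu\iff[b,T_\alpha]\text{ is bounded from }L^p(\omega^p)\text{ to }L^q(\lambda^q).$$
   Context: $T_\alpha f(x)=\int_{\mathbb{R}^n}\frac{\Omega(x-y)}{|x-y|^{n-\alpha}}f(y)\,dy$; $[b,T_\alpha]f=bT_\alpha f-T_\alpha(bf)$. For the weight $\mu$, $\mu(Q)=\int_Q\mu$ and $b\in BMO_\mu$ if $\sup_Q\frac1{\mu(Q)}\int_Q|b(x)-b_Q|\,dx<\infty$ (supremum over cubes with sides parallel to the axes, $b_Q=|Q|^{-1}\int_Qb$). A weight $v$ is in $A_{p,q}$ if $\sup_Q\left(\frac1{|Q|}\int_Qv^q\right)^{1/q}\left(\frac1{|Q|}\int_Qv^{-p'}\right)^{1/p'}<\infty$, $1/p+1/p'=1$. $\|f\|_{L^p(v)}=(\int|f|^pv)^{1/p}$. *)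

(* Defs.v *)
From HB Require Import structures.
From mathcomp Require Import all_boot all_order all_algebra.
From mathcomp Require Import all_classical all_reals all_analysis.

Set Implicit Arguments.
Unset Strict Implicit.
Unset Printing Implicit Defensive.
Import Order.TTheory GRing.Theory Num.Theory.
Import numFieldNormedType.Exports.

Local Open Scope classical_set_scope.
Local Open Scope ring_scope.

(* The library has a product sigma-algebra on n.-tuple T but none on row
   vectors; this is the same construction. *)
Definition measure_rV_display : measure_display -> measure_display.
Proof. exact. Qed.

Section measurable_rV.
Context {d : measure_display} {T : measurableType d}.
Variable n : nat.

Let coors : 'I_n -> 'rV[T]_n -> T := fun i x => x ord0 i.

Let rV_set0 : g_sigma_preimage coors set0.
Proof. exact: sigma_algebra0. Qed.

Let rV_setC A : g_sigma_preimage coors A -> g_sigma_preimage coors (~` A).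
Proof. exact: sigma_algebraC. Qed.

Let rV_bigcup (F : _^nat) : (forall i, g_sigma_preimage coors (F i)) ->
  g_sigma_preimage coors (\bigcup_i (F i)).
Proof. exact: sigma_algebra_bigcup. Qed.

HB.instance Definition _ := @isMeasurable.Build (measure_rV_display d)
  'rV[T]_n (g_sigma_preimage coors) rV_set0 rV_setC rV_bigcup.

End measurable_rV.

Lemma measurable_coord d (T : measurableType d) n (i : 'I_n) :
  measurable_fun [set: 'rV[T]_n] (fun x => x ord0 i).
Proof.
move=> _ Y mY; rewrite setTI; apply: sub_sigma_algebra => /=.
rewrite -bigcup_seq/=; exists i => /=; first by rewrite mem_index_enum.
by exists Y => //; rewrite setTI.
Qed.

Lemma measurable_fun_rVP d d' (S : measurableType d) (T : measurableType d') n
    (f : S -> 'rV[T]_n) :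
  measurable_fun [set: S] f <->
  forall i, measurable_fun [set: S] (fun s => f s ord0 i).
Proof.
split=> [mf i|mf].
  by have /= := measurableT_comp (@measurable_coord _ T n i) mf.
apply: (measurability (\big[setU/set0]_(i < n)
  preimage_set_system [set: 'rV[T]_n] (fun x => x ord0 i) measurable)) => //.
move=> _ [B + <-]; rewrite setTI -bigcup_seq/= => -[i _ [A mA <-]].
by rewrite setTI -[X in measurable X]setTI; exact: mf.
Qed.

Section lebesgue_rV.
Context {R : realType}.

Definition rV_cons n (x : measurableTypeR R * 'rV[R]_n) : 'rV[R]_n.+1 :=
  \row_(i < n.+1) oapp (x.2 ord0) x.1 (unlift ord0 i).

Lemma measurable_rV_cons n : measurable_fun setT (@rV_cons n).
Proof.
apply/measurable_fun_rVP => i; rewrite /rV_cons.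
have -> : (fun s : measurableTypeR R * 'rV[R]_n => (\row_k oapp (s.2 ord0) s.1
    (unlift ord0 k)) ord0 i) = fun s => oapp (s.2 ord0) s.1 (unlift ord0 i).
  by apply/funext => s; rewrite mxE.
case: (unliftP ord0 i) => [j _|_] /=; last exact: measurable_fst.
by have /= := measurableT_comp (@measurable_coord _ R n j)
  (@measurable_snd _ _ (measurableTypeR R) 'rV[R]_n).
Qed.

Definition rV_uncons n (x : 'rV[R]_n.+1) : measurableTypeR R * 'rV[R]_n :=
  (x ord0 ord0, \row_(i < n) x ord0 (lift ord0 i)).

Lemma rV_consK n : cancel (@rV_cons n) (@rV_uncons n).
Proof.
move=> [x y]; rewrite /rV_uncons mxE unlift_none /=; congr pair.
by apply/rowP => i; rewrite !mxE liftK.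
Qed.

Lemma measurable_rV_uncons n : measurable_fun setT (@rV_uncons n).
Proof.
apply/measurable_fun_pairP; split => /=.
  exact: (@measurable_coord _ R n.+1 ord0).
apply/measurable_fun_rVP => i.
have -> : (fun s : 'rV[R]_n.+1 => (snd \o @rV_uncons n) s ord0 i) =
    fun s => s ord0 (lift ord0 i) by apply/funext => s; rewrite /= mxE.
exact: (@measurable_coord _ R n.+1 (lift ord0 i)).
Qed.

Section lebesgue_cons.
Variables (n : nat) (m : {sigma_finite_measure set 'rV[R]_n -> \bar R}).

Definition lebesgue_cons : set 'rV[R]_n.+1 -> \bar R :=
  pushforward (lebesgue_measure \x m)%E (@rV_cons n).

Let lebesgue_cons0 : lebesgue_cons set0 = 0%E.
Proof. by rewrite /lebesgue_cons /pushforward preimage_set0 measure0. Qed.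

Let lebesgue_cons_ge0 A : (0 <= lebesgue_cons A)%E.
Proof. by rewrite /lebesgue_cons /pushforward measure_ge0. Qed.

Let lebesgue_cons_sigma_additive : semi_sigma_additive lebesgue_cons.
Proof.
have mc A : measurable A -> measurable (@rV_cons n @^-1` A).
  by move=> mA; rewrite -[X in measurable X]setTI; exact: measurable_rV_cons.
move=> F mF tF mUF; rewrite /lebesgue_cons /pushforward preimage_bigcup.
apply: measure_semi_sigma_additive.
- by move=> k; exact: mc.
- apply/trivIsetP => /= i j _ _ ij; rewrite -preimage_setI.
  by move/trivIsetP : tF => /(_ _ _ _ _ ij) ->//; rewrite preimage_set0.
- by rewrite -preimage_bigcup; exact: mc.
Qed.

HB.instance Definition _ := isMeasure.Build _ _ _ lebesgue_cons
  lebesgue_cons0 lebesgue_cons_ge0 lebesgue_cons_sigma_additive.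

Let lebesgue_cons_sigma_finite : sigma_finite setT lebesgue_cons.
Proof.
have /sigma_finiteP[F [TF ndF Foo]] := sigma_finiteT (@lebesgue_measure R).
have /sigma_finiteP[G [TG ndG Goo]] := sigma_finiteT m.
exists (fun k => @rV_uncons n @^-1` (F k `*` G k)).
  rewrite -preimage_bigcup (_ : \bigcup_k _ = setT) ?preimage_setT//.
  apply/seteqP; split=> // -[x y] _.
  have [i _ Fix] : (\bigcup_i F i) x by rewrite -TF.
  have [j _ Gjy] : (\bigcup_i G i) y by rewrite -TG.
  exists (maxn i j) => //; split => /=.
    by move: x Fix; exact/subsetPset/ndF/leq_maxl.
  by move: y Gjy; exact/subsetPset/ndG/leq_maxr.
move=> k; have [mFk Fkoo] := Foo k; have [mGk Gkoo] := Goo k; split.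
  rewrite -[X in measurable X]setTI; apply: measurable_rV_uncons => //.
  exact: measurableX.
rewrite /lebesgue_cons /pushforward -comp_preimage.
rewrite (_ : _ \o _ = id); last by rewrite funeqE; exact: rV_consK.
by rewrite preimage_id product_measure1E// lte_mul_pinfty// ge0_fin_numE.
Qed.

HB.instance Definition _ := Measure_isSigmaFinite.Build _ _ _ lebesgue_cons
  lebesgue_cons_sigma_finite.

End lebesgue_cons.

(* Lebesgue measure on R^n, as the n-fold product of the one on R;
   [lebesgue_rV_box] gives its value on boxes. *)
Fixpoint lebesgue_rV n : {sigma_finite_measure set 'rV[R]_n -> \bar R} :=
  if n is k.+1 then lebesgue_cons (lebesgue_rV k) else \d_(0 : 'rV[R]_0).

Lemma lebesgue_rV_box n (I : 'I_n -> set R) :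
  (forall i, measurable (I i)) ->
  lebesgue_rV n [set x | forall i, I i (x ord0 i)] =
    (\prod_(i < n) lebesgue_measure (I i))%E.
Proof.
elim: n I => [|n IHn] I mI /=.
  by rewrite big_ord0 diracE mem_set// => -[].
rewrite big_ord_recl -(IHn (fun i => I (lift ord0 i)))//.
rewrite -product_measure1E; first last.
- rewrite (_ : (fun _ => _) = \bigcap_(i in [set: 'I_n])
    ((fun x : 'rV[R]_n => x ord0 i) @^-1` I (lift ord0 i))).
    apply: fin_bigcap_measurable => // i _.
    rewrite -[X in measurable X]setTI.
    by apply: (@measurable_coord _ R n i) => //; exact: mI.
  by apply/seteqP; split=> [x Ix i _|x Ix i] /=; [exact: Ix|exact: (Ix i)].
- exact: mI.
rewrite /lebesgue_cons /pushforward; congr (_ _).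
apply/seteqP; split=> -[x y] /=.
  move=> Ixy; split => [|i]; first by have := Ixy ord0; rewrite mxE unlift_none.
  by have := Ixy (lift ord0 i); rewrite mxE liftK.
by move=> [Ix Iy] i; rewrite mxE; case: (unliftP ord0 i) => [k ->|->] /=.
Qed.

End lebesgue_rV.

Section definitions.
Context {R : realType} {n : nat}.
Implicit Types (x y a : 'rV[R]_n) (Q K : set 'rV[R]_n).
Implicit Types (b f v w mu Omega : 'rV[R]_n -> R) (p q alpha l : R).

Local Notation leb := (@lebesgue_rV R n).

(* The library's norm on row vectors is the sup norm. *)
Definition enorm x : R := Num.sqrt (\sum_(i < n) x ord0 i ^+ 2).

Definition unit_sphere : set 'rV[R]_n := [set x | enorm x = 1].

Definition cube a l : set 'rV[R]_n :=
  [set x | forall i, a ord0 i <= x ord0 i <= a ord0 i + l].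

Definition cubes : set (set 'rV[R]_n) :=
  [set Q | exists a l, 0 < l /\ Q = cube a l].

Definition mean f Q : R :=
  (fine (leb Q))^-1 * \int[leb]_(x in Q) f x.

(* [locally_integrable] of the library is restricted to functions on R. *)
Definition L1loc f : Prop :=
  measurable_fun setT f /\
  forall K, compact K -> (\int[leb]_(x in K) `|f x|%:E < +oo)%E.

Definition weight v : Prop := L1loc v /\ {ae leb, forall x, 0 < v x}.

Definition conj_exponent p : R := (1 - p^-1)^-1.

Definition Apq_const p q v Q : \bar R :=
  let p' := conj_exponent p in
  (((leb Q)^-1 * \int[leb]_(x in Q) (v x `^ q)%:E) `^ q^-1 *
   ((leb Q)^-1 * \int[leb]_(x in Q) (v x `^ (- p'))%:E) `^ p'^-1)%E.

Definition Apq p q v : Prop :=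
  weight v /\ (ereal_sup [set Apq_const p q v Q | Q in cubes] < +oo)%E.

Definition weighted_oscillation mu b Q : \bar R :=
  ((\int[leb]_(x in Q) (mu x)%:E)^-1 *
   \int[leb]_(x in Q) `|b x - mean b Q|%:E)%E.

Definition BMO mu b : Prop :=
  (ereal_sup [set weighted_oscillation mu b Q | Q in cubes] < +oo)%E.

Definition Lp_norm p v f : \bar R :=
  ((\int[leb]_x (`|f x| `^ p * v x)%:E) `^ p^-1)%E.

Definition in_Lp p v f : Prop :=
  measurable_fun setT f /\ (Lp_norm p v f < +oo)%E.

Definition homogeneous0 Omega : Prop :=
  forall (t : R) x, 0 < t -> x != 0 -> Omega (t *: x) = Omega x.

Definition fractional_kernel Omega alpha x y : R :=
  Omega (x - y) / enorm (x - y) `^ (n%:R - alpha).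

(* Absolute convergence of the integral that defines [fractional_integral]; where
   it fails, [fractional_integral] has a junk value. *)
Definition fractional_integral_defined Omega alpha f x : Prop :=
  leb.-integrable setT
    (fun y => (fractional_kernel Omega alpha x y * f y)%:E).

Definition fractional_integral Omega alpha f x : R :=
  \int[leb]_y (fractional_kernel Omega alpha x y * f y).

Definition commutator Omega alpha b f x : R :=
  b x * fractional_integral Omega alpha f x -
  fractional_integral Omega alpha (b \* f) x.

(* [b, T] is bounded from L^p(v) to L^q(w): on all of L^p(v) it is defined by
   absolutely convergent integrals almost everywhere, and it satisfies the norm
   inequality. *)
Definition commutator_bounded Omega alpha b p v q w : Prop :=
  exists C : R, forall f, in_Lp p v f ->
    [/\ {ae leb, forall x,
          fractional_integral_defined Omega alpha f x /\
          fractional_integral_defined Omega alpha (b \* f) x},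
        in_Lp q w (commutator Omega alpha b f) &
        (Lp_norm q w (commutator Omega alpha b f) <= C%:E * Lp_norm p v f)%E].

End definitions.

(* Main.v *)
Require Import Defs.
From HB Require Import structures.
From mathcomp Require Import all_boot all_order all_algebra.
From mathcomp Require Import all_classical all_reals all_analysis.
From mathcomp Require Import measurable_realfun.
From mathcomp Require Import ring lra.

Set Implicit Arguments.
Unset Strict Implicit.
Unset Printing Implicit Defensive.
Import Order.TTheory GRing.Theory Num.Theory.
Import numFieldNormedType.Exports.

Local Open Scope classical_set_scope.
Local Open Scope ring_scope.

(** Write (u)_{a,Q} for the power mean (|Q|^-1 \int_Q u^a)^(1/a) of a weight
    over a cube Q. The condition A_{p,q} bounds (w)_{q,Q} (1/w)_{p',Q}; in
    this form it is symmetric under exchanging w with 1/w and q with p'.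
    Everything is done on half-open cubes, which split exactly into 2^n
    half-open halves and differ from the closed ones by null sets.

    Membership of b in the weighted BMO space gives boundedness. As Omega is
    bounded on the sphere, the commutator is dominated by the positive
    operator with kernel |b(x) - b(y)| |x - y|^(alpha - n). Its bilinear form
    is split over dyadic distances; at distance of order l it is an average,
    over all cubes Q of side 2 l, of the double integral over Q x Q of |b(x) -
    b(y)| f(y) g(x) ([near_average]). That local integral is handled by the
    Hoelder inequality after inserting b_Q. The weights satisfy a reverse
    Hoelder inequality ([muck_open]), so there are exponents a > q and c > p'
    which still satisfy the weight condition, and a weighted John-Nirenberg
    inequality ([weighted_john_nirenberg], [two_weight_oscillation]) bounds
    (|b - b_Q| lambda)_{a,Q} by (omega)_{a,Q} and, dually, (|b - b_Q| /
    omega)_{c,Q} by (1 / lambda)_{c,Q}. What remains is the product of (f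
    omega)_{r,Q} and (g / lambda)_{s,Q} with r < p and s < q'
    ([local_oscillation_bound]). Because both inequalities are strict, the sum
    over all scales converges ([bilinear_scale_sum]): this is a discrete form
    of the Hardy-Littlewood-Sobolev inequality, in which the contribution of
    each point forms two geometric series, in place of a maximal function
    estimate. Duality turns the bound of the form into the norm inequality
    ([riesz_operator_bound]). The same argument with 1 in place of |b(x) -
    b(y)| and the weight omega on both sides shows that the integrals which
    define the commutator converge absolutely almost everywhere.

    Both the reverse Hoelder inequality and the John-Nirenberg inequality come
    from one stopping-time induction on finite dyadic trees ([stopping_le]),
    applied to the averages at depth N; the limit in N is taken by Fatou
    ([fatou_mart]), since the averages converge almost everywhere along a
    subsequence, by density of the cylinder sets in the Borel sets
    ([approximable_measurable]).

    Conversely, let Omega(x0) be nonzero. For a cube Q take the translate Q'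
    of Q by a large multiple of its side in the direction -x0: by continuity
    and homogeneity the kernel has constant sign and size l^(alpha - n) on Q x
    Q' ([kernel_sign]). Let m be a median of b on Q' and F the part of Q'
    where b <= m, or where b >= m. Then b(x) - b(y) keeps its sign for y in F,
    and the commutator applied to the indicator of F is at least a multiple of
    l^alpha times the positive, or negative, part of b(x) - m
    ([commutator_lower]). The norm inequality, the Hoelder inequality and the
    weight conditions on a cube that contains both Q and Q' bound the mean of
    |b - m| over Q by (omega)_{q} (1 / lambda)_{p'}, and this by the mean of
    omega / lambda: the product of omega / lambda, 1 / omega and lambda is 1,
    and power means are multiplicative up to the Hoelder inequality
    ([weights_chain]). *)

(** * Power means *)

Section power_mean.
Context d (T : measurableType d) (R : realType).
Variable m : {measure set T -> \bar R}.
Implicit Types (D Q : set T) (f g : T -> R) (a b c : R).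

Lemma measurable_powR_comp D f a :
  measurable_fun D f -> measurable_fun D (fun x => f x `^ a).
Proof. exact: (@measurableT_comp _ _ _ _ _ _ (@powR R ^~ a)). Qed.

(** The real power with exponent -1 is the inverse for nonnegative arguments
    only, hence the square. *)
Lemma measurable_funV f : measurable_fun setT f -> measurable_fun setT (fun x => (f x)^-1).
Proof.
move=> mf; rewrite (_ : (fun x => _) = fun x => f x * (f x ^+ 2) `^ (-1)).
  by apply: measurable_funM => //; apply: measurable_powR_comp; exact: measurable_funX.
apply/funext => x; rewrite powR_inv1 ?sqr_ge0//.
have [->|f0] := eqVneq (f x) 0; first by rewrite invr0 mul0r.
by field.
Qed.

Lemma hoelder_on D f g p q : measurable D ->
  measurable_fun setT f -> measurable_fun setT g ->
  (forall x, 0 <= f x) -> (forall x, 0 <= g x) ->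
  0 < p -> 0 < q -> p^-1 + q^-1 = 1 ->
  (\int[m]_(x in D) (f x * g x)%:E <=
   (\int[m]_(x in D) (f x `^ p)%:E) `^ p^-1 *
   (\int[m]_(x in D) (g x `^ q)%:E) `^ q^-1)%E.
Proof.
move=> mD mf mg f0 g0 p0 q0 pq.
have mr (h : T -> R) : measurable_fun setT h -> measurable_fun setT (h \_ D).
  move=> mh; have [+ _] := @measurable_restrictT _ _ _ _ D h mD.
  by apply; exact: measurable_funS mh.
have E (h : T -> R) r : 0 < r -> (forall x, 0 <= h x) ->
    (\int[m]_(x in D) (h x `^ r)%:E =
     \int[m]_x (`|(EFin \o (h \_ D)) x| `^ r))%E.
  move=> r0 h0; rewrite integral_mkcond; apply: eq_integral => x _ /=.
  rewrite !patchE; case: ifPn => _ /=.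
    by rewrite ger0_norm.
  by rewrite normr0 powR0 ?gt_eqF.
have := hoelder m (mr _ mf) (mr _ mg) p0 q0 pq.
rewrite Lnorm1 unlock /Lnorm -!E// => H; apply: le_trans H.
rewrite integral_mkcond le_eqVlt; apply/orP; left; apply/eqP.
apply: eq_integral => x _ /=; rewrite !patchE; case: ifPn => _ /=.
  by rewrite ger0_norm// mulr_ge0.
by rewrite mul0r normr0.
Qed.

Definition pmean a Q f : \bar R :=
  (((fine (m Q))^-1)%:E * \int[m]_(x in Q) (f x `^ a)%:E) `^ a^-1.

Lemma pmean_ge0 a Q f : (0 <= pmean a Q f)%E.
Proof. exact: poweR_ge0. Qed.

(** Sets over which normalized means make sense. *)
Definition fat Q := measurable Q /\ exists2 V : R, 0 < V & m Q = V%:E.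

Lemma fine_fat Q : fat Q -> 0 < fine (m Q).
Proof. by move=> [_ [V V0 ->]]. Qed.

Lemma pint_ge0 a Q f : (0 <= \int[m]_(x in Q) (f x `^ a)%:E)%E.
Proof. by apply: integral_ge0 => x _; rewrite lee_fin powR_ge0. Qed.

Lemma fat_inv_ge0 Q : (0 <= ((fine (m Q))^-1)%:E)%E.
Proof. by rewrite lee_fin invr_ge0 fine_ge0. Qed.

(** Hoelder with three exponents: apply the two-exponent inequality to f^c and
    g^c with exponents a/c and b/c. The normalization disappears because 1/c =
    1/a + 1/b. *)
Lemma pmean_hoelder a b c Q f g : fat Q ->
  measurable_fun setT f -> measurable_fun setT g ->
  (forall x, 0 <= f x) -> (forall x, 0 <= g x) ->
  0 < a -> 0 < b -> c^-1 = a^-1 + b^-1 ->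
  (pmean c Q (fun x => f x * g x)%R <= pmean a Q f * pmean b Q g)%E.
Proof.
move=> fQ mf mg f0 g0 a0 b0 cE.
have c0 : 0 < c by rewrite -invr_gt0 cE addr_gt0 ?invr_gt0.
have cn : c != 0 by rewrite gt_eqF.
have [mQ _] := fQ; have V0 := fine_fat fQ.
have vN : (fine (m Q))^-1 != 0 by rewrite invr_eq0 gt_eqF.
have ac0 : 0 < a / c by rewrite divr_gt0.
have bc0 : 0 < b / c by rewrite divr_gt0.
have an : a != 0 by rewrite gt_eqF.
have bn : b != 0 by rewrite gt_eqF.
have E (h : T -> R) r : (\int[m]_(x in Q) (h x `^ r)%:E =
    \int[m]_(x in Q) ((h x `^ c) `^ (r / c))%:E)%E.
  by apply: eq_integral => x _; rewrite -powRrM mulrC divfK.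
have H : (\int[m]_(x in Q) ((f x * g x) `^ c)%:E <=
   (\int[m]_(x in Q) (f x `^ a)%:E) `^ (c / a) *
   (\int[m]_(x in Q) (g x `^ b)%:E) `^ (c / b))%E.
  have -> : (\int[m]_(x in Q) ((f x * g x) `^ c)%:E =
      \int[m]_(x in Q) (f x `^ c * g x `^ c)%:E)%E.
    by apply: eq_integral => x _; rewrite powRM.
  rewrite -(invf_div a c) -(invf_div b c) (E f a) (E g b).
  apply: hoelder_on => //; last by rewrite !invf_div -mulrDr -cE divff.
  - exact: measurable_powR_comp.
  - exact: measurable_powR_comp.
  - by move=> x; exact: powR_ge0.
  - by move=> x; exact: powR_ge0.
rewrite /pmean.
move: H (pint_ge0 a Q f) (pint_ge0 b Q g) (fat_inv_ge0 Q).
set X := (\int[m]_(x in Q) (f x `^ a)%:E)%E.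
set Y := (\int[m]_(x in Q) (g x `^ b)%:E)%E.
move: X Y ((fine (m Q))^-1)%:E => X Y v H X0 Y0 v0.
have ca : c / a * c^-1 = a^-1 by rewrite mulrAC divff// mul1r.
have cb : c / b * c^-1 = b^-1 by rewrite mulrAC divff// mul1r.
have -> : ((v * X) `^ a^-1 * (v * Y) `^ b^-1 =
   (v * (X `^ (c / a) * Y `^ (c / b))) `^ c^-1)%E.
  rewrite (poweRM _ v0 X0) (poweRM _ v0 Y0) muleACA.
  rewrite (poweRM _ v0 (mule_ge0 (poweR_ge0 _ _) (poweR_ge0 _ _))).
  rewrite (poweRM _ (poweR_ge0 _ _) (poweR_ge0 _ _)).
  rewrite -(poweRrM X) -(poweRrM Y) ca cb; congr (_ * _)%E.
  by rewrite cE poweRD// /poweRD_def -cE (negPf (invr_neq0 cn)).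
apply: gt0_ler_poweR.
- by rewrite invr_ge0 ltW.
- rewrite in_itv/= leey andbT mule_ge0//.
  by apply: integral_ge0 => x _; rewrite lee_fin powR_ge0.
- by rewrite in_itv/= leey andbT !mule_ge0// ?poweR_ge0.
- by rewrite lee_wpmul2l.
Qed.

Lemma pmean_cst a Q k : fat Q -> 0 < a -> 0 <= k ->
  pmean a Q (fun=> k) = k%:E.
Proof.
move=> [mQ [V V0 mQV]] a0 k0; rewrite /pmean integral_cst// mQV/=.
rewrite mulrCA mulVf ?gt_eqF// mulr1.
by rewrite -powRrM mulfV ?gt_eqF// powRr1.
Qed.

(** Hoelder against the constant 1. *)
Lemma pmean_mono a c Q f : fat Q -> measurable_fun setT f ->
  (forall x, 0 <= f x) -> 0 < c <= a -> (pmean c Q f <= pmean a Q f)%E.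
Proof.
move=> fQ mf f0 /andP[c0]; rewrite le_eqVlt => /predU1P[->//|ca].
have a0 : 0 < a := lt_trans c0 ca.
pose b := (c^-1 - a^-1)^-1.
have b0 : 0 < b by rewrite invr_gt0 subr_gt0 ltf_pV2.
have := @pmean_hoelder a b c Q f (fun=> 1) fQ mf (measurable_cst _) f0
  (fun=> ler01) a0 b0.
rewrite pmean_cst// mule1 invrK addrC subrK => /(_ erefl); apply: le_trans.
by rewrite [X in (_ <= pmean c Q X)%E](_ : _ = f)//; apply/funext => x; rewrite mulr1.
Qed.

(** If the mean of f vanished, Hoelder for f times 1/f would give a vanishing
    mean of the constant 1, even when the mean of 1/f is infinite. *)
Lemma pmean_gt0 a Q f : fat Q -> measurable_fun setT f ->
  0 < a -> (forall x, 0 < f x) -> (0 < pmean a Q f)%E.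
Proof.
move=> fQ mf a0 f0.
have H := @pmean_hoelder a a (2^-1 * a) Q f (fun x => (f x)^-1) fQ mf.
have mfV := measurable_funV mf.
have {}H := H mfV (fun x => ltW (f0 x)).
rewrite lt0e pmean_ge0 andbT; apply/negP => /eqP E.
have : (pmean (2^-1 * a) Q (fun x => f x * (f x)^-1)%R <=
  pmean a Q f * pmean a Q (fun x => (f x)^-1)%R)%E.
  apply: H => //; first by move=> x; rewrite invr_ge0 ltW.
  by rewrite invfM invrK mulr_natl mulr2n.
rewrite E mul0e (_ : (fun x => _) = (fun=> 1)).
  by rewrite pmean_cst// ?mulr_gt0// lee_fin ler10.
by apply/funext => x; rewrite divff// gt_eqF.
Qed.

Lemma pmean_subset a Q Q' f k : fat Q -> fat Q' -> Q `<=` Q' ->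
  0 < a -> fine (m Q') <= k * fine (m Q) ->
  measurable_fun setT f ->
  (pmean a Q f <= (k `^ a^-1)%:E * pmean a Q' f)%E.
Proof.
move=> fQ fQ' QQ' a0 kQ mf; have V0 := fine_fat fQ; have V0' := fine_fat fQ'.
have k0 : 0 < k by rewrite -(pmulr_lgt0 _ V0) (lt_le_trans V0').
rewrite /pmean -poweR_EFin -poweRM ?lee_fin ?(ltW k0)//; last first.
  by rewrite mule_ge0 ?pint_ge0 ?fat_inv_ge0.
apply: gt0_ler_poweR.
- by rewrite invr_ge0 ltW.
- by rewrite in_itv/= leey andbT mule_ge0// ?pint_ge0 ?fat_inv_ge0.
- by rewrite in_itv/= leey andbT !mule_ge0// ?lee_fin ?(ltW k0)// ?pint_ge0 ?fat_inv_ge0.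
rewrite muleA; apply: lee_pmul; rewrite ?pint_ge0 ?fat_inv_ge0//.
  by rewrite -EFinM lee_fin ler_pdivlMr// mulrC ler_pdivrMr.
have [mQ _] := fQ; have [mQ' _] := fQ'.
apply: ge0_subset_integral => //.
- by apply/measurable_EFinP; apply: measurable_funS (measurable_powR_comp a mf).
- by move=> x _; rewrite lee_fin powR_ge0.
Qed.

End power_mean.

(** * Half-open cubes and their dyadic subdivision *)

Section cubes.
Context {R : realType} {n : nat}.
Local Notation leb := (@lebesgue_rV R n).
Local Notation node := ('rV[R]_n * R)%type.
Implicit Types (Q S : node) (a x : 'rV[R]_n).

Definition hcube Q : set 'rV[R]_n :=
  [set x | forall i, Q.1 ord0 i <= x ord0 i < Q.1 ord0 i + Q.2].

Lemma measurable_box (I : 'I_n -> set R) : (forall i, measurable (I i)) ->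
  measurable [set x : 'rV[R]_n | forall i, I i (x ord0 i)].
Proof.
move=> mI; rewrite (_ : [set _ | _] = \bigcap_(i in [set: 'I_n])
    ((fun x : 'rV[R]_n => x ord0 i) @^-1` I i)).
  apply: fin_bigcap_measurable => // i _; rewrite -[X in measurable X]setTI.
  by apply: (@measurable_coord _ R n i) => //; exact: mI.
by apply/seteqP; split=> [x Ix i _|x Ix i] /=; [exact: Ix|exact: (Ix i)].
Qed.

Lemma hcubeE Q : hcube Q = [set x | forall i,
  `[Q.1 ord0 i, Q.1 ord0 i + Q.2[%classic (x ord0 i)].
Proof.
by apply/seteqP; split=> x /= h i; have := h i; rewrite in_itv.
Qed.

Lemma cubeE a l : cube a l = [set x | forall i,
  `[a ord0 i, a ord0 i + l]%classic (x ord0 i)].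
Proof.
by apply/seteqP; split=> x /= h i; have := h i; rewrite in_itv.
Qed.

Lemma measurable_hcube Q : measurable (hcube Q).
Proof.
rewrite hcubeE; exact: (@measurable_box
  (fun i => `[Q.1 ord0 i, Q.1 ord0 i + Q.2[%classic) (fun i => measurable_itv _)).
Qed.

Lemma measurable_cube a l : measurable (cube a l).
Proof.
rewrite cubeE; exact: (@measurable_box
  (fun i => `[a ord0 i, a ord0 i + l]%classic) (fun i => measurable_itv _)).
Qed.

Lemma leb_itv_prod (I : 'I_n -> set R) l : (forall i, measurable (I i)) ->
  (forall i, lebesgue_measure (I i) = l%:E) ->
  leb [set x | forall i, I i (x ord0 i)] = (l ^+ n)%:E.
Proof.
move=> mI lI; rewrite lebesgue_rV_box//.
under eq_bigr do rewrite lI.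
by rewrite prodEFin prodr_const card_ord.
Qed.

Lemma leb_hcube Q : 0 < Q.2 -> leb (hcube Q) = (Q.2 ^+ n)%:E.
Proof.
move=> Q0; rewrite hcubeE; apply: (@leb_itv_prod
  (fun i => `[Q.1 ord0 i, Q.1 ord0 i + Q.2[%classic)) => // i.
by rewrite lebesgue_measure_itv/= lte_fin ltrDl Q0 -EFinD addrAC subrr add0r.
Qed.

Lemma leb_cube a l : 0 < l -> leb (cube a l) = (l ^+ n)%:E.
Proof.
move=> Q0; rewrite cubeE; apply: (@leb_itv_prod
  (fun i => `[a ord0 i, a ord0 i + l]%classic)) => // i.
by rewrite lebesgue_measure_itv/= lte_fin ltrDl Q0 -EFinD addrAC subrr add0r.
Qed.

Lemma fat_hcube Q : 0 < Q.2 -> fat leb (hcube Q).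
Proof.
move=> Q0; split; first exact: measurable_hcube.
by exists (Q.2 ^+ n); [exact: exprn_gt0|exact: leb_hcube].
Qed.

(** The corner of the cube in whose half x lies, coordinate by coordinate. *)
Definition orth Q x : {ffun 'I_n -> bool} :=
  [ffun i => Q.1 ord0 i + Q.2 / 2 <= x ord0 i].

Definition child Q (e : {ffun 'I_n -> bool}) : node :=
  (\row_i (Q.1 ord0 i + if e i then Q.2 / 2 else 0), Q.2 / 2).

Lemma child_gt0 Q e : 0 < Q.2 -> 0 < (child Q e).2.
Proof. by move=> Q0; rewrite divr_gt0. Qed.

(** The children are the fibres of [orth] inside Q, hence a partition. *)
Lemma hcube_childE Q e x : 0 < Q.2 ->
  hcube (child Q e) x <-> hcube Q x /\ orth Q x = e.
Proof.
move=> Q0; split=> [h|[h <-]]; last first.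
  move=> i; have := h i; rewrite !mxE/= ffunE; case: ifPn; last rewrite -ltNge.
    by move=> -> /andP[_]; rewrite -addrA -splitr.
  by move=> xl /andP[? _]; rewrite addr0 xl andbT.
split.
  move=> i; have := h i; rewrite !mxE/=; case: (e i); rewrite ?addr0.
    by rewrite -addrA -splitr => /andP[h1 ->]; rewrite andbT; lra.
  by move=> /andP[-> h2] /=; lra.
apply/ffunP => i; rewrite ffunE; have := h i; rewrite !mxE /=.
by case: (e i); rewrite ?addr0; [move=> /andP[->]|move=> /andP[_]; rewrite ltNge => /negPf].
Qed.

Lemma sub_hcube_child Q e : 0 < Q.2 -> hcube (child Q e) `<=` hcube Q.
Proof. by move=> Q0 x /(hcube_childE _ _ Q0)[]. Qed.

Lemma hcube_childI Q x : 0 < Q.2 -> hcube Q x -> hcube (child Q (orth Q x)) x.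
Proof. by move=> Q0 Qx; apply/(hcube_childE _ _ Q0). Qed.

Lemma leb_child Q e : 0 < Q.2 ->
  leb (hcube Q) = ((2 ^+ n)%:E * leb (hcube (child Q e)))%E.
Proof.
move=> Q0; rewrite !leb_hcube// ?child_gt0// -EFinM -exprMn /=.
by rewrite mulrCA divff// mulr1.
Qed.

Lemma ge0_integral_child Q (f : 'rV[R]_n -> \bar R) : 0 < Q.2 ->
  measurable_fun (hcube Q) f -> (forall x, hcube Q x -> (0 <= f x)%E) ->
  (\int[leb]_(x in hcube Q) f x =
   \sum_e \int[leb]_(x in hcube (child Q e)) f x)%E.
Proof.
move=> Q0 mf f0.
have E : hcube Q = \big[setU/set0]_e hcube (child Q e).
  rewrite -bigcup_seq; apply/seteqP; split => x.
    by move=> Qx; exists (orth Q x); [rewrite /= mem_index_enum|exact: hcube_childI].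
  by case=> e _ /(sub_hcube_child Q0).
rewrite {1}E ge0_integral_bigsetU//=.
- by move=> e; exact: measurable_hcube.
- exact: index_enum_uniq.
- apply/trivIsetP => e e' _ _ ee'; apply/seteqP; split => // x.
  case=> /(hcube_childE _ _ Q0)[_ h1] /(hcube_childE _ _ Q0)[_ h2].
  by rewrite -h1 -h2 eqxx in ee'.
- by rewrite -E.
- by rewrite -E.
Qed.

(** The descendant of Q at depth N that contains x. *)
Fixpoint leaf N Q x : node := if N is N'.+1 then leaf N' (child Q (orth Q x)) x else Q.

Lemma leaf_gt0 N Q x : 0 < Q.2 -> 0 < (leaf N Q x).2.
Proof. by elim: N Q => [//|N IH] Q Q0 /=; apply: IH; exact: child_gt0. Qed.

Lemma leaf_side N Q x : (leaf N Q x).2 = Q.2 / 2 ^+ N.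
Proof.
elim: N Q => [|N IH] Q /=; first by rewrite expr0 divr1.
by rewrite IH /= exprS invfM mulrA.
Qed.

Lemma hcube_leaf N Q x : 0 < Q.2 -> hcube Q x -> hcube (leaf N Q x) x.
Proof.
elim: N Q => [//|N IH] Q Q0 Qx /=.
by apply: IH; [exact: child_gt0|exact: hcube_childI].
Qed.

Lemma leaf_sub N Q x : 0 < Q.2 -> hcube (leaf N Q x) `<=` hcube Q.
Proof.
elim: N Q => [|N IH] Q Q0 /=; first exact: subset_refl.
by apply: subset_trans (sub_hcube_child Q0); apply: IH; exact: child_gt0.
Qed.

(** Descendants at the same depth are disjoint or equal. *)
Lemma leaf_eq N Q x y : 0 < Q.2 -> hcube Q x -> hcube (leaf N Q x) y ->
  leaf N Q y = leaf N Q x.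
Proof.
elim: N Q => [//|N IH] Q Q0 Qx /= h.
have Q'0 := child_gt0 (orth Q x) Q0.
have h' := leaf_sub Q'0 h.
have /(hcube_childE _ _ Q0)[_ ->] := h'.
by rewrite IH//; exact: hcube_childI.
Qed.

End cubes.

(** * Density of the dyadic cylinder sets *)

Section dyadic_density.
Context {R : realType} {n : nat}.
Local Notation leb := (@lebesgue_rV R n).
Local Notation node := ('rV[R]_n * R)%type.
Implicit Types (Q S : node) (a x y : 'rV[R]_n).

Lemma leaf_le_eq N M Q x y : (N <= M)%N -> 0 < Q.2 -> hcube Q x -> hcube Q y ->
  leaf M Q x = leaf M Q y -> leaf N Q x = leaf N Q y.
Proof.
elim: N M Q => [//|N IH] [//|M] Q NM Q0 Qx Qy /= h.
have Q'0 := child_gt0 (orth Q x) Q0.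
have : hcube (leaf M (child Q (orth Q x)) x) y.
  by rewrite h; apply: hcube_leaf; [exact: child_gt0|exact: hcube_childI].
move=> /(leaf_sub Q'0)/(hcube_childE _ _ Q0)[_ e].
rewrite e in h *; apply: (IH M) => //; first exact: hcube_childI.
by apply/(hcube_childE _ _ Q0).
Qed.

Lemma measurable_leaf N Q (p : set node) : 0 < Q.2 ->
  measurable [set x | hcube Q x /\ p (leaf N Q x)].
Proof.
elim: N Q => [|N IH] Q Q0 /=.
  have [pQ|pQ] := pselect (p Q).
    rewrite (_ : [set _ | _] = hcube Q); first exact: measurable_hcube.
    by apply/seteqP; split=> x //= [].
  rewrite (_ : [set _ | _] = set0); first exact: measurable0.
  by apply/seteqP; split=> x //= [].
rewrite (_ : [set _ | _] = \big[setU/set0]_e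
   [set x | hcube (child Q e) x /\ p (leaf N (child Q e) x)]).
  by apply: bigsetU_measurable => e _; apply: IH; exact: child_gt0.
rewrite -bigcup_seq; apply/seteqP; split => x /=.
  move=> [Qx px]; exists (orth Q x); first by rewrite /= mem_index_enum.
  by split => //; exact: hcube_childI.
by move=> [e _ /= [/(hcube_childE _ _ Q0)[Qx <-] px]].
Qed.

Section approximation.
Variable Q : node.
Hypothesis Q0 : 0 < Q.2.

(** Unions of cubes of depth N inside Q. *)
Definition cyl N (U : set 'rV[R]_n) := forall x y, hcube Q x -> hcube Q y ->
  leaf N Q x = leaf N Q y -> (U x <-> U y).

Definition sdiff (A U : set 'rV[R]_n) : set 'rV[R]_n :=
  [set x | hcube Q x /\ ~ (A x <-> U x)].

Lemma measurable_sdiff A U : measurable A -> measurable U ->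
  measurable (sdiff A U).
Proof.
move=> mA mU.
rewrite (_ : sdiff A U = hcube Q `&` ((A `\` U) `|` (U `\` A))).
  apply: measurableI; first exact: measurable_hcube.
  by apply: measurableU; exact: measurableD.
by apply/seteqP; split => x /=; rewrite /sdiff/=;
  have [?|?] := pselect (A x); have [?|?] := pselect (U x); tauto.
Qed.

Definition approximable (A : set 'rV[R]_n) := measurable A /\
  forall e : R, 0 < e -> exists N U, [/\ measurable U, cyl N U &
    (leb (sdiff A U) <= e%:E)%E].

Lemma cyl_le N M U : (N <= M)%N -> cyl N U -> cyl M U.
Proof. by move=> NM cU x y Qx Qy h; apply: cU => //; exact: leaf_le_eq h. Qed.

Lemma le_leb (A B : set 'rV[R]_n) : measurable A -> measurable B ->
  A `<=` B -> (leb A <= leb B)%E.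
Proof. by move=> mA mB AB; apply: le_measure; rewrite ?inE. Qed.

Lemma approximable0 : approximable set0.
Proof.
split=> // e e0; exists 0%N, set0; split => //.
rewrite (_ : sdiff _ _ = set0) ?measure0 ?lee_fin ?ltW//.
by apply/seteqP; split => x //=; rewrite /sdiff/=; tauto.
Qed.

Lemma approximableC A : approximable A -> approximable (~` A).
Proof.
move=> [mA hA]; split; first exact: measurableC.
move=> e e0; have [N [U [mU cU h]]] := hA e e0.
exists N, (~` U); split; first exact: measurableC.
  by move=> x y Qx Qy /(cU x y Qx Qy) h'; rewrite /setC/=; tauto.
rewrite (_ : sdiff _ _ = sdiff A U)//.
by apply/seteqP; split => x /=; rewrite /sdiff/setC/=; have := @notP (A x); have := @notP (U x); tauto.
Qed.

Lemma approximableU A B : approximable A -> approximable B ->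
  approximable (A `|` B).
Proof.
move=> [mA hA] [mB hB]; split; first exact: measurableU.
move=> e e0; have e20 : 0 < e / 2 by rewrite divr_gt0.
have [N [U [mU cU hU]]] := hA _ e20; have [M [V [mV cV hV]]] := hB _ e20.
exists (maxn N M), (U `|` V); split; first exact: measurableU.
  move=> x y Qx Qy h.
  have := cyl_le (leq_maxl N M) cU Qx Qy h.
  by have := cyl_le (leq_maxr N M) cV Qx Qy h; rewrite /setU/=; tauto.
apply: (@le_trans _ _ (leb (sdiff A U `|` sdiff B V))).
  apply: le_leb; [|by apply: measurableU; exact: measurable_sdiff|].
    by apply: measurable_sdiff; exact: measurableU.
  move=> x; rewrite /sdiff /setU/=.
  by have [?|?] := pselect (A x <-> U x); have [?|?] := pselect (B x <-> V x); tauto.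
apply: le_trans; first by apply: measureU2 => //; exact: measurable_sdiff.
by rewrite [leRHS](_ : _ = (e / 2)%:E + (e / 2)%:E)%E ?leeD// -EFinD -splitr.
Qed.

Lemma approximable_bigcup (A : (set 'rV[R]_n)^nat) :
  (forall i, approximable (A i)) -> approximable (\bigcup_i A i).
Proof.
move=> hA.
pose B k := \big[setU/set0]_(i < k) A i.
have gB k : approximable (B k).
  rewrite /B; elim: k => [|k IH]; first by rewrite big_ord0; exact: approximable0.
  by rewrite big_ord_recr/=; exact: approximableU.
have mA : measurable (\bigcup_i A i).
  by apply: bigcupT_measurable => i; have [] := hA i.
split => // e e0; have e20 : 0 < e / 2 by rewrite divr_gt0.
pose F k := hcube Q `&` (\bigcup_i A i) `\` B k.
have mF k : measurable (F k).
  apply: measurableD; last by have [] := gB k.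
  by apply: measurableI => //; exact: measurable_hcube.
have F0 : \bigcap_k F k = set0.
  apply/seteqP; split => x //= h.
  have [[Qx [i _ Aix]] _] := h 0%N I.
  have [_] := h i.+1 I; apply; rewrite /B -bigcup_mkord.
  by exists i => //=.
have : (leb \o F) x @[x --> \oo] --> leb (\bigcap_k F k).
  apply: nonincreasing_cvg_mu => //.
  - apply: (@le_lt_trans _ _ (leb (hcube Q))).
      by apply: le_leb => //; [exact: measurable_hcube|move=> x [[]]].
    by rewrite leb_hcube// ltry.
  - by rewrite F0; exact: measurable0.
  - move=> i j ij; apply/subsetPset => x [xA xB]; split => //.
    by move=> xBi; apply: xB; move: xBi; rewrite /B; apply: subset_bigsetU.
rewrite F0 measure0 => /fine_cvgP[_].
move=> /cvgrPdist_lt/(_ _ e20)[k _ /(_ k (leqnn k))/=].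
rewrite sub0r normrN => hk.
have Fk : (leb (F k) <= (e / 2)%:E)%E.
  rewrite -[leLHS]fineK ?lee_fin; last first.
    rewrite ge0_fin_numE//; apply: (@le_lt_trans _ _ (leb (hcube Q))).
      by apply: le_leb => //; [exact: measurable_hcube|move=> x [[]]].
    by rewrite leb_hcube// ltry.
  by apply: ltW; apply: le_lt_trans hk; rewrite ler_norm.
have [mB /(_ _ e20) [N [U [mU cU hU]]]] := gB k.
exists N, U; split => //.
apply: (@le_trans _ _ (leb (F k `|` sdiff (B k) U))).
  apply: le_leb; [exact: measurable_sdiff|by apply: measurableU => //; exact: measurable_sdiff|].
  have BA : B k `<=` \bigcup_i A i.
    by rewrite /B -bigcup_mkord => y [j _ Ajy]; exists j.
  rewrite /F; move: (\bigcup_i A i) (B k) BA => AA BB BA x.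
  rewrite /sdiff /setU/setD/setI/=; have := BA x.
  by have [?|?] := pselect (AA x); have [?|?] := pselect (BB x);
     have [?|?] := pselect (U x); tauto.
apply: le_trans; first by apply: measureU2 => //; exact: measurable_sdiff.
by rewrite [leRHS](_ : _ = (e / 2)%:E + (e / 2)%:E)%E ?leeD// -EFinD -splitr.
Qed.

(** A half-space differs from the union of the depth-N cubes contained in it
    only inside a slab of width Q.2 / 2^N, whose measure inside Q tends to 0. *)
Lemma approximable_ray (i : 'I_n) (c : R) :
  approximable [set x : 'rV[R]_n | x ord0 i < c].
Proof.
have mA : measurable [set x : 'rV[R]_n | x ord0 i < c].
  rewrite (_ : [set _ | _] = [set: 'rV[R]_n] `&`
     (fun x => x ord0 i) @^-1` `]-oo, c[%classic).
    by apply: (@measurable_coord _ R n i) => //; exact: measurable_itv.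
  by apply/seteqP; split => x /=; rewrite in_itv/=; tauto.
split=> // e e0.
have [N hN] : exists N : nat, Q.2 ^+ n / e <= N%:R.
  by exists (Num.truncn (Q.2 ^+ n / e)).+1; rewrite ltW// truncnS_gt.
exists N, [set x | hcube Q x /\ (leaf N Q x).1 ord0 i + (leaf N Q x).2 <= c].
split.
- exact: (@measurable_leaf N Q (fun S : node => S.1 ord0 i + S.2 <= c)).
- by move=> x y Qx Qy /= ->; tauto.
pose s := Q.2 / 2 ^+ N.
have s0 : 0 < s by rewrite divr_gt0// exprn_gt0.
pose J j : set R := if j == i then `]c - s, c[%classic
  else `[Q.1 ord0 j, Q.1 ord0 j + Q.2[%classic.
have mJ j : measurable (J j) by rewrite /J; case: ifP.
apply: (@le_trans _ _ (leb [set x | forall j, J j (x ord0 j)])).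
  apply: le_leb; first apply: measurable_sdiff => //.
    exact: (@measurable_leaf N Q (fun S : node => S.1 ord0 i + S.2 <= c)).
    exact: measurable_box.
  move=> x [Qx /= h] j; rewrite /J; have [->|_] := eqVneq j i; last first.
    by have := Qx j; rewrite /= in_itv.
  have := hcube_leaf N Q0 Qx => /(_ i); rewrite leaf_side -/s => /andP[h1 h2].
  rewrite /= in_itv/=.
  have [xc|cx] := ltP (x ord0 i) c; last first.
    exfalso; apply: h; split; first by move=> xc; rewrite ltNge cx in xc.
    by move=> [_]; rewrite leaf_side => h3; exact: lt_le_trans h2 h3.
  rewrite andbT; have [h3|h3] := leP ((leaf N Q x).1 ord0 i + s) c.
    by exfalso; apply: h; split => // _; rewrite leaf_side.
  by lra.
rewrite lebesgue_rV_box// (bigD1 i)//= /J eqxx.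
rewrite (eq_bigr (fun=> Q.2%:E)); last first.
  move=> j /negPf ->; rewrite lebesgue_measure_itv/= lte_fin ltrDl Q0 -EFinD.
  by rewrite addrAC subrr add0r.
rewrite lebesgue_measure_itv/= lte_fin ltrBlDr ltrDl s0 -EFinD opprB addrC subrK.
rewrite prodEFin prodr_const -EFinM lee_fin.
have -> : #|(fun j => j != i)| = n.-1.
  have := cardC1 i; rewrite card_ord => <-; apply: eq_card => j.
  by rewrite !inE.
have n0 : (0 < n)%N := leq_ltn_trans (leq0n i) (ltn_ord i).
rewrite /s mulrAC -exprS prednK// ler_pdivrMr ?exprn_gt0//.
rewrite mulrC -ler_pdivrMr//.
apply: (le_trans hN).
by rewrite -natrX ler_nat ltnW// ltn_expl.
Qed.

(** Approximable sets form a sigma-algebra that contains the half-spaces, and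
    half-spaces generate the product sigma-algebra. *)
Lemma approximable_measurable A : measurable A -> approximable A.
Proof.
have SA : sigma_algebra setT approximable.
  split; first exact: approximable0.
    by move=> B; rewrite setTD; exact: approximableC.
  exact: approximable_bigcup.
apply: (smallest_sub SA) => B; rewrite -bigcup_seq => -[i _ /= [C mC <-]].
rewrite setTI.
have SC : sigma_algebra setT [set C : set R | approximable ((fun x : 'rV[R]_n => x ord0 i) @^-1` C)].
  split => /=.
  - by rewrite preimage_set0; exact: approximable0.
  - by move=> D; rewrite setTD preimage_setC; exact: approximableC.
  - by move=> D hD; rewrite preimage_bigcup; exact: approximable_bigcup.
have {}mC : (@ocitv R).-sigma.-measurable C by exact: mC.
move: mC; rewrite RGenInftyO.measurableE.
apply: (smallest_sub SC) => _ [c ->] /=.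
rewrite (_ : _ @^-1` _ = [set x : 'rV[R]_n | x ord0 i < c]).
  exact: approximable_ray.
by apply/seteqP; split => x /=; rewrite in_itv.
Qed.

End approximation.
End dyadic_density.

(** * Convergence of dyadic averages *)

Import HBSimple.

Section ae_cvg.
Context d (T : measurableType d) (R : realType).
Variable m : {measure set T -> \bar R}.

(** The integral of the sum of all f_j is finite, so that the sum is finite
    almost everywhere and its terms tend to 0. *)
Lemma ae_cvg_summable (D : set T) (f : nat -> T -> R) : measurable D ->
  (forall j, measurable_fun D (f j)) -> (forall j x, 0 <= f j x) ->
  (forall j, \int[m]_(x in D) (f j x)%:E <= (1 / (2 ^ j.+1)%:R)%:E)%E ->
  {ae m, forall x, D x -> f j x @[j --> \oo] --> 0}.
Proof.
move=> mD mf f0 hf.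
have mfE j : measurable_fun D (fun x => (f j x)%:E) by apply/measurable_EFinP.
have fi : m.-integrable D (fun x => \sum_(j <oo) (f j x)%:E)%E.
  apply/integrableP; split.
    apply: (@ge0_emeasurable_sum _ _ _ D (fun j x => (f j x)%:E) xpredT) => //.
    by move=> j x _ _; rewrite lee_fin.
  under eq_integral.
    move=> x _; rewrite gee0_abs; last by apply: nneseries_ge0 => j _ _; rewrite lee_fin.
    over.
  rewrite integral_nneseries//; last by move=> j x _; rewrite lee_fin.
  apply: (@le_lt_trans _ _ 1%:E); last by rewrite ltry.
  apply: le_trans (epsilon_trick0 xpredT ler01).
  apply: lee_nneseries => [j *|j *] //.
  by apply: integral_ge0 => x _; rewrite lee_fin.
have := integrable_ae mD fi; apply: filterS => x h Dx.
have {h} := h Dx; rewrite ge0_fin_numE; last first.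
  by apply: nneseries_ge0 => j _ _; rewrite lee_fin.
move=> h.
have h0 : (\sum_(N <= k <oo) (f k x)%:E)%E @[N --> \oo] --> 0%E.
  by apply: (@nneseries_tail_cvg _ (fun k => (f k x)%:E) xpredT) => // k _; rewrite lee_fin.
have : (f j x)%:E @[j --> \oo] --> 0%E.
  apply: (squeeze_cvge _ (cvg_cst _) h0); near=> j.
  rewrite lee_fin f0/= (nneseries_split _ 1); last by move=> k _; rewrite lee_fin.
  rewrite addn1 big_nat1 leeDl//.
  by apply: nneseries_ge0 => k _ _; rewrite lee_fin.
by move/fine_cvgP => [_].
Unshelve. all: end_near.
Qed.

End ae_cvg.

Section martingale.
Context {R : realType} {n : nat}.
Local Notation leb := (@lebesgue_rV R n).
Local Notation node := ('rV[R]_n * R)%type.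
Implicit Types (Q S : node) (a x y : 'rV[R]_n) (f g c : 'rV[R]_n -> R).

Definition avg f Q : R := mean f (hcube Q).
(** The martingale of averages of g along the dyadic filtration of Q. *)
Definition mart N Q g x : R := avg g (leaf N Q x).

Lemma measurable_leaf_fun N Q (F : node -> R) : 0 < Q.2 ->
  measurable_fun (hcube Q) (fun x => F (leaf N Q x)).
Proof.
move=> Q0 _ Y mY; exact: (@measurable_leaf _ _ N Q (F @^-1` Y) Q0).
Qed.

(** A quantity that depends on the depth N+1 descendant of x is, on each child
    of Q, the same quantity at depth N for that child. All inductions on the
    depth go through this identity. *)
Lemma integral_leafS N Q (H : node -> 'rV[R]_n -> \bar R) : 0 < Q.2 ->
  (forall S x, (0 <= H S x)%E) ->
  measurable_fun (hcube Q) (fun x => H (leaf N.+1 Q x) x) ->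
  (\int[leb]_(x in hcube Q) H (leaf N.+1 Q x) x =
   \sum_e \int[leb]_(x in hcube (child Q e)) H (leaf N (child Q e) x) x)%E.
Proof.
move=> Q0 H0 mH; rewrite ge0_integral_child//; apply: eq_bigr => e _.
apply: eq_integral => x /set_mem/(hcube_childE _ _ Q0)[_ <-] //.
Qed.

Lemma integrable_child g Q e : 0 < Q.2 -> leb.-integrable (hcube Q) (EFin \o g) ->
  leb.-integrable (hcube (child Q e)) (EFin \o g).
Proof.
move=> Q0; apply: integrableS; try exact: measurable_hcube.
exact: sub_hcube_child.
Qed.

Lemma integrable_leaf g Q N x : 0 < Q.2 -> leb.-integrable (hcube Q) (EFin \o g) ->
  leb.-integrable (hcube (leaf N Q x)) (EFin \o g).
Proof.
move=> Q0; apply: integrableS; try exact: measurable_hcube.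
exact: leaf_sub.
Qed.

Lemma leb_hcube_lty Q : 0 < Q.2 -> (leb (hcube Q) < +oo)%E.
Proof. by move=> Q0; rewrite leb_hcube// ltry. Qed.

Lemma integrable_cst_hcube Q (k : R) : 0 < Q.2 ->
  leb.-integrable (hcube Q) (EFin \o (fun=> k)).
Proof.
move=> Q0; apply: (@measurable_bounded_integrable _ _ _ leb) => //.
- exact: measurable_hcube.
- exact: leb_hcube_lty.
- by exists `|k|; split => // M kM x _ /=; exact: ltW.
Qed.

Lemma avg_cst Q (k : R) : 0 < Q.2 -> avg (fun=> k) Q = k.
Proof.
move=> Q0; rewrite /avg /mean Rintegral_cst; last exact: measurable_hcube.
by rewrite mulrC -mulrA divff ?mulr1// gt_eqF// fine_fat//; exact: fat_hcube.
Qed.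

Lemma avgB Q f g : leb.-integrable (hcube Q) (EFin \o f) ->
  leb.-integrable (hcube Q) (EFin \o g) ->
  avg (fun x => f x - g x) Q = avg f Q - avg g Q.
Proof.
move=> fi gi; rewrite /avg /mean RintegralB ?mulrBr//.
exact: measurable_hcube.
Qed.

Lemma norm_avg_le Q g : 0 < Q.2 -> leb.-integrable (hcube Q) (EFin \o g) ->
  (`|avg g Q|%:E * leb (hcube Q) <= \int[leb]_(x in hcube Q) `|g x|%:E)%E.
Proof.
move=> Q0 gi; rewrite leb_hcube// -EFinM /avg /mean leb_hcube//=.
have V0 : 0 < Q.2 ^+ n by rewrite exprn_gt0.
rewrite normrM gtr0_norm ?invr_gt0// mulrAC mulVf ?gt_eqF// mul1r.
rewrite EFin_normr_Rintegral//; last exact: measurable_hcube.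
apply: le_abse_integral; first exact: measurable_hcube.
by have [] := integrableP _ _ _ gi.
Qed.

(** Averaging contracts the L^1 norm, cube by cube. *)
Lemma mart_contract N Q g : 0 < Q.2 -> leb.-integrable (hcube Q) (EFin \o g) ->
  (\int[leb]_(x in hcube Q) `|mart N Q g x|%:E <=
   \int[leb]_(x in hcube Q) `|g x|%:E)%E.
Proof.
elim: N Q => [|N IH] Q Q0 gi.
  apply: le_trans (norm_avg_le Q0 gi).
  by rewrite -(integral_cst leb (measurable_hcube Q)).
rewrite (@integral_leafS N Q (fun S _ => `|avg g S|%:E))//; last first.
  apply/measurable_EFinP.
  exact: (@measurable_leaf_fun N.+1 Q (fun S => `|avg g S|)).
rewrite [leRHS]ge0_integral_child//.
- apply: lee_sum => e _; apply: IH; first exact: child_gt0.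
  exact: integrable_child.
- by have /integrableP[mg _] := gi; apply/measurable_EFinP/measurableT_comp => //; apply/measurable_EFinP.
Qed.

Section approx.
Variable Q : node.
Hypothesis Q0 : 0 < Q.2.

(** Approximation in L^1 by functions that are constant on the cubes of some
    fixed depth; such functions are fixed by averaging at that depth. *)
Definition step_approx g := forall e : R, 0 < e -> exists N c,
  [/\ leb.-integrable (hcube Q) (EFin \o c),
     (forall x y, hcube Q x -> hcube Q y -> leaf N Q x = leaf N Q y -> c x = c y) &
     (\int[leb]_(x in hcube Q) `|g x - c x|%:E <= e%:E)%E].

Lemma step_approx_indic (A : set 'rV[R]_n) (k : R) : measurable A ->
  step_approx (fun x => k * \1_A x).
Proof.
move=> mA e e0; have k0 : 0 < `|k| + 1 by rewrite ltr_wpDl.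
have [_ /(_ (e / (`|k| + 1)) (divr_gt0 e0 k0))] := approximable_measurable Q0 mA.
move=> [N [U [mU cU hU]]]; exists N, (fun x => k * \1_U x); split.
- apply: (@measurable_bounded_integrable _ _ _ leb) => //.
  + exact: measurable_hcube.
  + exact: leb_hcube_lty.
  + by apply: measurable_funM => //; exact: measurable_indic.
  + exists `|k|; split => // M kM x _ /=; rewrite indicE normrM.
    rewrite (le_trans _ (ltW kM))// ler_piMr// normr_nat.
    by case: (_ \in _).
- move=> x y Qx Qy h; congr (_ * _); rewrite !indicE.
  suff -> : (x \in U) = (y \in U) by [].
  by have := cU x y Qx Qy h; have [/set_mem Ux|/negP Ux] := boolP (x \in U);
    have [/set_mem Uy|/negP Uy] := boolP (y \in U) => //; rewrite ?inE in Ux Uy; tauto.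
- have mQ := @measurable_hcube R n Q.
  apply: (@le_trans _ _ (\int[leb]_(x in hcube Q) (`|k| * \1_(sdiff Q A U) x)%:E)%E).
    apply: ge0_le_integral => //.
    + apply/measurable_EFinP/measurableT_comp => //.
      by apply: measurable_funB; apply: measurable_funM => //; exact: measurable_indic.
    + apply/measurable_EFinP/measurable_funM => //.
      by apply: measurable_indic; exact: measurable_sdiff.
    + move=> x Qx; rewrite lee_fin -mulrBr normrM ler_wpM2l// !indicE.
      have [/set_mem Ux|/negP Ux] := boolP (x \in U);
        have [/set_mem Ax|/negP Ax] := boolP (x \in A);
        rewrite ?subrr ?normr0 ?subr0 ?sub0r ?normrN ?normr1//.
        by rewrite mem_set// /sdiff/=; rewrite inE in Ax; tauto.
      by rewrite mem_set// /sdiff/=; rewrite inE in Ux; tauto.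
  under eq_integral do rewrite EFinM.
  have mS : measurable (sdiff Q A U) by exact: measurable_sdiff.
  rewrite ge0_integralZl_EFin//; last first.
    by apply/measurable_EFinP; exact: measurable_indic.
  rewrite integral_indic//.
  apply: (@le_trans _ _ (`|k|%:E * (e / (`|k| + 1))%:E)%E).
    rewrite lee_wpmul2l// (le_trans _ hU)//; apply: le_leb => //.
    by apply: measurableI => //; exact: measurable_hcube.
  by rewrite -EFinM lee_fin mulrCA ler_piMr ?(ltW e0)// ler_pdivrMr// mul1r lerDl.
Qed.

Lemma step_approxD f g : measurable_fun (hcube Q) f -> measurable_fun (hcube Q) g ->
  step_approx f -> step_approx g -> step_approx (fun x => f x + g x).
Proof.
move=> mf mg hf hg e e0; have e20 : 0 < e / 2 by rewrite divr_gt0.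
have [N [c [ci cc hc]]] := hf _ e20; have [M [c' [ci' cc' hc']]] := hg _ e20.
have mc h : leb.-integrable (hcube Q) (EFin \o h) -> measurable_fun (hcube Q) h.
  by move=> /integrableP[/measurable_EFinP].
exists (maxn N M), (fun x => c x + c' x); split.
- have -> : EFin \o (fun x => c x + c' x) = ((EFin \o c) \+ (EFin \o c'))%E by [].
  by apply: integrableD => //; exact: measurable_hcube.
- move=> x y Qx Qy h; congr (_ + _).
    by apply: cc => //; exact: leaf_le_eq (leq_maxl _ _) Q0 Qx Qy h.
  by apply: cc' => //; exact: leaf_le_eq (leq_maxr _ _) Q0 Qx Qy h.
- apply: (@le_trans _ _ (\int[leb]_(x in hcube Q) (`|f x - c x|%:E + `|g x - c' x|%:E))%E).
    apply: ge0_le_integral => //.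
    + exact: measurable_hcube.
    + apply/measurable_EFinP/measurableT_comp => //.
      by apply: measurable_funB; apply: measurable_funD => //; exact: mc.
    + apply: emeasurable_funD; apply/measurable_EFinP/measurableT_comp => //;
      by apply: measurable_funB => //; exact: mc.
    + move=> x Qx; rewrite -EFinD lee_fin opprD addrACA; exact: ler_normD.
  rewrite ge0_integralD//; last 3 first.
  + exact: measurable_hcube.
  + by apply/measurable_EFinP/measurableT_comp => //; apply: measurable_funB => //; exact: mc.
  + by apply/measurable_EFinP/measurableT_comp => //; apply: measurable_funB => //; exact: mc.
  by rewrite [leRHS](_ : _ = (e / 2)%:E + (e / 2)%:E)%E ?leeD// -EFinD -splitr.
Qed.

(** Integrable functions are L^1 limits of simple functions, and each level
    set of a simple function is approximable. *)
Lemma step_approx_integrable g : leb.-integrable (hcube Q) (EFin \o g) ->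
  step_approx g.
Proof.
move=> gi e e0; have e20 : 0 < e / 2 by rewrite divr_gt0.
have mQ := @measurable_hcube R n Q.
have [h [hi _ hg]] := approximation_sfun_integrable mQ gi.
have [k hk] : exists k, (\int[leb]_(x in hcube Q) `|(g x)%:E - (h k x)%:E| <= (e / 2)%:E)%E.
  move/fine_cvgP : hg => [/= fin /cvgrPdist_lt/(_ _ e20) hg].
  near \oo => k; exists k.
  rewrite -[leLHS]fineK; last by near: k.
  rewrite lee_fin; apply: ltW.
  have : `|0 - fine (\int[leb]_(x in hcube Q) `|(g x)%:E - (h k x)%:E|)| < e / 2 by near: k.
  by rewrite sub0r normrN; apply: le_lt_trans; rewrite ler_norm.
have hh : step_approx (h k).
  pose s := finmap.enum_fset (fset_set (range (h k))).
  have E x : h k x = \sum_(y <- s) y * \1_(h k @^-1` [set y]) x.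
    by rewrite {1}fimfunE fsbig_finite.
  have mh (y : R) : measurable (h k @^-1` [set y]).
    by rewrite -[X in measurable X]setTI; apply: (@measurable_funP _ _ _ _ _ (h k)).
  suff : step_approx (fun x => \sum_(y <- s) y * \1_(h k @^-1` [set y]) x).
    by rewrite (_ : (fun x => _) = h k)//; apply/funext => x; rewrite -E.
  elim: s {E} => [|y s IH].
    move=> r r0; exists 0%N, (fun=> 0); split => //.
      exact: integrable_cst_hcube.
    under eq_integral do rewrite big_nil subrr normr0.
    by rewrite integral0 lee_fin ltW.
  rewrite (_ : (fun x => _) = fun x => y * \1_(h k @^-1` [set y]) x +
     \sum_(y <- s) y * \1_(h k @^-1` [set y]) x); last first.
    by apply/funext => x; rewrite big_cons.
  apply: step_approxD => //; last exact: step_approx_indic.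
  + by apply: measurable_funM => //; exact: measurable_indic.
  + by apply: measurable_sum => z; exact: measurable_funM.
have [N [c [ci cc hc]]] := hh _ e20; exists N, c; split => //.
have mc r : leb.-integrable (hcube Q) (EFin \o r) -> measurable_fun (hcube Q) r.
  by move=> /integrableP[/measurable_EFinP].
have mg := mc _ gi; have mcc := mc _ ci; have mhk := mc _ (hi k).
apply: (@le_trans _ _ (\int[leb]_(x in hcube Q) (`|g x - h k x|%:E + `|h k x - c x|%:E))%E).
  apply: ge0_le_integral => //.
  + by apply/measurable_EFinP/measurableT_comp => //; exact: measurable_funB.
  + by apply: emeasurable_funD; apply/measurable_EFinP/measurableT_comp => //;
      exact: measurable_funB.
  + by move=> x Qx; rewrite -EFinD lee_fin; exact: ler_distD.
rewrite ge0_integralD//; last 2 first.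
+ by apply/measurable_EFinP/measurableT_comp => //; exact: measurable_funB.
+ by apply/measurable_EFinP/measurableT_comp => //; exact: measurable_funB.
by rewrite [leRHS](_ : _ = (e / 2)%:E + (e / 2)%:E)%E ?leeD// -EFinD -splitr.
Unshelve. all: end_near.
Qed.

Lemma measurable_mart N g : measurable_fun (hcube Q) (mart N Q g).
Proof. exact: (@measurable_leaf_fun N Q (avg g)). Qed.

(** Compare g with a function c that is constant on the cubes of depth N:
    averaging fixes c and contracts the error g - c. *)
Lemma mart_L1 g (e : R) : 0 < e -> leb.-integrable (hcube Q) (EFin \o g) ->
  exists N, (\int[leb]_(x in hcube Q) `|g x - mart N Q g x|%:E <= e%:E)%E.
Proof.
move=> e0 gi; have e20 : 0 < e / 2 by rewrite divr_gt0.
have [N [c [ci cc hc]]] := step_approx_integrable gi e20.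
exists N; have mQ := @measurable_hcube R n Q.
have mc r : leb.-integrable (hcube Q) (EFin \o r) -> measurable_fun (hcube Q) r.
  by move=> /integrableP[/measurable_EFinP].
have mg := mc _ gi; have mcc := mc _ ci.
have mN := measurable_mart N.
have gci : leb.-integrable (hcube Q) (EFin \o (fun x => g x - c x)).
  have -> : EFin \o (fun x => g x - c x) = ((EFin \o g) \- (EFin \o c))%E by [].
  exact: integrableB.
have Ec x : hcube Q x -> mart N Q c x = c x.
  move=> Qx; have L0 := leaf_gt0 N x Q0.
  rewrite -(avg_cst (c x) L0); congr (_ * _); apply: eq_Rintegral => y /set_mem yL.
  by apply: cc => //; [exact: leaf_sub yL|exact: leaf_eq].
apply: (@le_trans _ _ (\int[leb]_(x in hcube Q) (`|g x - c x|%:E +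
    `|mart N Q (fun x => g x - c x) x|%:E))%E).
  apply: ge0_le_integral => //.
  + by apply/measurable_EFinP/measurableT_comp => //; exact: measurable_funB.
  + by apply: emeasurable_funD; apply/measurable_EFinP/measurableT_comp => //;
      exact: measurable_funB.
  + move=> x Qx; rewrite -EFinD lee_fin /mart avgB; try exact: integrable_leaf.
    have := Ec x Qx; rewrite /mart => ->.
    by rewrite (distrC (avg g _)); exact: ler_distD.
rewrite ge0_integralD//; last 2 first.
+ by apply/measurable_EFinP/measurableT_comp => //; exact: measurable_funB.
+ by apply/measurable_EFinP/measurableT_comp.
have -> : e%:E = ((e / 2)%:E + (e / 2)%:E)%E by rewrite -EFinD -splitr.
apply: leeD => //.
exact: le_trans (mart_contract N Q0 gci) hc.
Qed.

Lemma powR_cvg_pos (u : nat -> R) (l t : R) : 0 < l -> u j @[j --> \oo] --> l ->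
  u j `^ t @[j --> \oo] --> l `^ t.
Proof.
move=> l0 ul.
have h : expR (t * ln (u j)) @[j --> \oo] --> expR (t * ln l).
  apply: continuous_cvg; first exact: continuous_expR.
  apply: cvgMr; apply: continuous_cvg => //; exact: continuous_ln.
rewrite {2}/powR gt_eqF//; apply: cvg_trans h; apply: near_eq_cvg.
have : \forall j \near \oo, 0 < u j.
  by move/cvgrPdist_lt : ul => /(_ _ l0); apply: filterS => j; rewrite ltr_norml; lra.
by apply: filterS => j uj; rewrite /powR gt_eqF.
Qed.

(** Bounds that are uniform in the depth pass to the limit. Along a
    subsequence the averages converge to g almost everywhere, and Fatou
    applies. Where g = b the claim is trivial, which avoids continuity of t-th
    powers at 0. *)
Lemma fatou_mart g (w : 'rV[R]_n -> R) (b t : R) (C : \bar R) : 0 < t ->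
  leb.-integrable (hcube Q) (EFin \o g) ->
  measurable_fun (hcube Q) w -> (forall x, 0 <= w x) ->
  (forall N, \int[leb]_(x in hcube Q) (`|mart N Q g x - b| `^ t * w x)%:E <= C)%E ->
  (\int[leb]_(x in hcube Q) (`|g x - b| `^ t * w x)%:E <= C)%E.
Proof.
move=> t0 gi mw w0 hC; have mQ := @measurable_hcube R n Q.
have mg : measurable_fun (hcube Q) g by have /integrableP[/measurable_EFinP] := gi.
have hN j : exists N, (\int[leb]_(x in hcube Q) `|g x - mart N Q g x|%:E
    <= (1 / (2 ^ j.+1)%:R)%:E)%E.
  by apply: mart_L1 => //; rewrite divr_gt0// ltr0n expn_gt0.
have {hN}[N hN] := boolp.choice hN.
have mm j : measurable_fun (hcube Q) (mart (N j) Q g) by exact: measurable_mart.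
have ae := @ae_cvg_summable _ _ _ leb (hcube Q) (fun j x => `|g x - mart (N j) Q g x|) mQ
  (fun j => measurableT_comp (@normr_measurable _ _) (measurable_funB mg (mm j)))
  (fun j x => normr_ge0 _) hN.
have mF j : measurable_fun (hcube Q) (fun x => (`|mart (N j) Q g x - b| `^ t * w x)%:E).
  apply/measurable_EFinP/measurable_funM => //; apply: measurable_powR_comp.
  by apply: measurableT_comp => //; exact: measurable_funB.
apply: (@le_trans _ _ (\int[leb]_(x in hcube Q) limn_einf
    (fun j => (`|mart (N j) Q g x - b| `^ t * w x)%:E))%E).
  apply: ae_ge0_le_integral => //.
  - by move=> x _; rewrite lee_fin mulr_ge0// powR_ge0.
  - apply/measurable_EFinP/measurable_funM => //; apply: measurable_powR_comp.
    by apply: measurableT_comp => //; exact: measurable_funB.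
  - move=> x Qx; rewrite limn_einf_lim; apply: lime_ge.
      exact: is_cvg_einfs.
    apply: nearW => j; apply: le_ereal_inf_tmp => _ [k _ <-].
    by rewrite lee_fin mulr_ge0// powR_ge0.
  - apply: (emeasurable_fun_cvg (fun k x => einfs
        (fun j => (`|mart (N j) Q g x - b| `^ t * w x)%:E) k)).
      by move=> k; exact: measurable_fun_einfs.
    by move=> x _; rewrite limn_einf_lim; exact: is_cvg_einfs.
  apply: filterS ae => x h Qx; have {}h := h Qx.
  have hm : mart (N j) Q g x @[j --> \oo] --> g x.
    apply/cvgrPdist_lt => r r0; move/cvgrPdist_lt : h => /(_ _ r0).
    by apply: filterS => j; rewrite sub0r normrN normr_id.
  have [gb|gb] := eqVneq (g x) b.
    rewrite gb subrr normr0 powR0 ?gt_eqF// mul0r.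
    rewrite limn_einf_lim; apply: lime_ge; first exact: is_cvg_einfs.
    apply: nearW => j; apply: le_ereal_inf_tmp => _ [k _ <-].
    by rewrite lee_fin mulr_ge0// powR_ge0.
  have hl : (`|mart (N j) Q g x - b| `^ t * w x)%:E @[j --> \oo] --> (`|g x - b| `^ t * w x)%:E.
    apply: cvg_EFin; first by apply: nearW.
    apply: cvgMl; apply: powR_cvg_pos; first by rewrite normr_gt0 subr_eq0.
    by apply: cvg_norm; apply: cvgB => //; exact: cvg_cst.
  by rewrite (cvg_limn_einf_sup hl).1.
apply: (le_trans (fatou _ _ _ _)) => //.
  by move=> j x _; rewrite lee_fin mulr_ge0// powR_ge0.
rewrite limn_einf_lim; apply: lime_le; first exact: is_cvg_einfs.
apply: nearW => j; apply: ge_ereal_inf.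
exists (\int[leb]_(x in hcube Q) (`|mart (N j) Q g x - b| `^ t * w x)%:E)%E => //.
by exists j => /=.
Qed.

End approx.
End martingale.

(** * Stopping times on finite dyadic trees *)

Section stopping.
Context {R : realType} {n : nat}.
Local Notation leb := (@lebesgue_rV R n).
Local Notation node := ('rV[R]_n * R)%type.
Implicit Types (Q S : node) (x y : 'rV[R]_n) (f g : 'rV[R]_n -> R) (st : node -> bool).

(** The union of the first cubes, from Q downwards and at depth at most N, on
    which the stopping rule st holds. *)
Fixpoint stopset st N Q : set 'rV[R]_n :=
  if st Q then hcube Q else
  if N is N'.+1 then [set x | hcube Q x /\ stopset st N' (child Q (orth Q x)) x]
  else set0.

(** The sum of nu over the maximal stopped cubes whose union is [stopset]. *)
Fixpoint ssum st (nu : node -> \bar R) N Q : \bar R :=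
  if st Q then nu Q else
  if N is N'.+1 then (\sum_e ssum st nu N' (child Q e))%E else 0%E.

Lemma stopset_sub st N Q : stopset st N Q `<=` hcube Q.
Proof. by case: N => [|N] /=; case: ifP => _ x //= []. Qed.

Lemma measurable_stopset st N Q : 0 < Q.2 -> measurable (stopset st N Q).
Proof.
elim: N Q => [|N IH] Q Q0 /=; case: ifP => _; try exact: measurable_hcube.
  exact: measurable0.
rewrite (_ : [set _ | _] = \big[setU/set0]_e stopset st N (child Q e)).
  by apply: bigsetU_measurable => e _; apply: IH; exact: child_gt0.
rewrite -bigcup_seq; apply/seteqP; split => x /=.
  by move=> [Qx px]; exists (orth Q x) => //=; rewrite mem_index_enum.
move=> [e _ px]; have /(hcube_childE _ _ Q0)[Qx eE] := stopset_sub px.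
by split => //; rewrite eE.
Qed.

Lemma ssum_integral st N Q f : 0 < Q.2 -> measurable_fun setT f ->
  (forall x, 0 <= f x) ->
  ssum st (fun S => \int[leb]_(x in hcube S) (f x)%:E)%E N Q =
  (\int[leb]_(x in stopset st N Q) (f x)%:E)%E.
Proof.
move=> Q0 mf f0; elim: N Q Q0 => [|N IH] Q Q0.
  by rewrite /=; case: ifP => _ //; rewrite integral_set0.
have [sQ|sQ] := boolP (st Q); first by rewrite /= sQ.
rewrite -[in RHS](setIidr (@stopset_sub st N.+1 Q)) integral_mkcondr.
rewrite ge0_integral_child//; last 2 first.
- rewrite restrict_EFin; apply/measurable_EFinP.
  have [+ _] := @measurable_restrictT _ _ _ _ (stopset st N.+1 Q) f (measurable_stopset _ _ Q0).
  move=> h; apply: measurable_funS (h _) => //.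
  exact: measurable_funS mf.
- by move=> x _; rewrite patchE; case: ifP => // _; rewrite lee_fin.
rewrite /= (negPf sQ); apply: eq_bigr => e _.
rewrite IH; last exact: child_gt0.
rewrite -[in LHS](setIidr (@stopset_sub st N (child Q e))) integral_mkcondr.
apply: eq_integral => x /set_mem /(hcube_childE _ _ Q0)[Qx Qe].
rewrite !patchE; congr (if _ then _ else _).
by apply: asbool_equiv_eq; rewrite /= Qe; split => // -[].
Qed.

Lemma ssum_le st (nu nu' : node -> \bar R) N Q : 0 < Q.2 ->
  (forall S, 0 < S.2 -> st S -> (nu S <= nu' S)%E) ->
  (ssum st nu N Q <= ssum st nu' N Q)%E.
Proof.
move=> Q0 h; elim: N Q Q0 => [|N IH] Q Q0 /=; case: ifP => sQ //; try exact: h.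
by apply: lee_sum => e _; apply: IH; exact: child_gt0.
Qed.

(** On each stopped cube the integral of f is at least K times the measure,
    and the stopped cubes are disjoint subsets of Q. *)
Lemma stopset_markov st N Q f (K : R) : 0 < Q.2 -> measurable_fun setT f ->
  (forall x, 0 <= f x) -> 0 <= K ->
  (forall S, 0 < S.2 -> st S -> (K%:E * leb (hcube S) <= \int[leb]_(x in hcube S) (f x)%:E)%E) ->
  (K%:E * leb (stopset st N Q) <= \int[leb]_(x in hcube Q) (f x)%:E)%E.
Proof.
move=> Q0 mf f0 K0 h.
have mS := measurable_stopset st N Q0.
apply: (@le_trans _ _ (\int[leb]_(x in stopset st N Q) (f x)%:E)%E); last first.
  apply: ge0_subset_integral => //; first exact: measurable_hcube.
  - by apply/measurable_EFinP; exact: measurable_funS mf.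
  - by move=> x _; rewrite lee_fin.
  - exact: stopset_sub.
rewrite -(integral_cst leb mS) -(ssum_integral _ _ Q0 mf f0).
rewrite -[X in (X <= _)%E](@ssum_integral _ _ _ (fun=> K))//.
apply: ssum_le => // S S0 sS.
by rewrite (integral_cst leb (@measurable_hcube _ _ S) K%:E); exact: h.
Qed.

(** The induction behind both self-improvement results. Phi is subadditive
    over children. Cubes are subdivided until the rule st holds; on a stopped
    cube Phi is controlled by psi (the induction hypothesis at a smaller depth
    k < N), on a cube that is never stopped by theta. The predicate P records
    what is inherited by a child of a cube that was not stopped, typically
    that the jump from the parent to the child is at most 2^n. *)
Lemma stopping_le st (P : node -> Prop) (Phi : nat -> node -> \bar R)
    (psi theta : node -> \bar R) N Q :
  (forall k S, 0 < S.2 -> (Phi k.+1 S <= \sum_e Phi k (child S e))%E) ->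
  (forall S, (0 <= theta S)%E) ->
  (forall S, 0 < S.2 -> (\sum_e theta (child S e) <= theta S)%E) ->
  (forall k S, (k < N)%N -> 0 < S.2 -> P S -> st S -> (Phi k S <= psi S)%E) ->
  (forall S, 0 < S.2 -> P S -> ~~ st S -> (Phi 0%N S <= theta S)%E) ->
  (forall S e, 0 < S.2 -> P S -> ~~ st S -> P (child S e)) ->
  0 < Q.2 -> P Q -> ~~ st Q ->
  (Phi N Q <= ssum st psi N Q + theta Q)%E.
Proof.
move=> HPhi th0 Hth Hpsi Hleaf Hchild.
elim: N Hpsi Q => [|N IH] Hpsi Q Q0 PQ sQ /=.
  by rewrite (negPf sQ) add0e; exact: Hleaf.
rewrite (negPf sQ); apply: le_trans (HPhi _ _ Q0) _.
apply: (@le_trans _ _ (\sum_e (ssum st psi N (child Q e) + theta (child Q e)))%E).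
  apply: lee_sum => e _; have c0 := child_gt0 e Q0.
  have Pc := Hchild Q e Q0 PQ sQ.
  have [sc|sc] := boolP (st (child Q e)); last first.
    by apply: IH => // k S kN; apply: Hpsi; exact: ltnW.
  have -> : ssum st psi N (child Q e) = psi (child Q e).
    by case: (N) => [|?] /=; rewrite sc.
  by apply: le_trans (leeDl _ (th0 _)); exact: Hpsi.
by rewrite big_split/= leeD2l// Hth.
Qed.

End stopping.

(** * Muckenhoupt weights *)

Section real_aux.
Context {R : realType}.
Implicit Types (x y t : R).

(** Either y is at most a small multiple of x, and is absorbed in the factor 1
    + eta, or x is at most a multiple of y. The constant thus exists for all t
    > 0, also where the power is concave. *)
Lemma powRD_le t (eta : R) : 0 < t -> 0 < eta -> exists2 C : R, 0 < C &
  forall x y, 0 <= x -> 0 <= y ->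
    (x + y) `^ t <= (1 + eta) * x `^ t + C * y `^ t.
Proof.
move=> t0 eta0; pose de := (1 + eta) `^ t^-1 - 1.
have de1 : 1 + de = (1 + eta) `^ t^-1 by rewrite /de addrC subrK.
have det : (1 + de) `^ t = 1 + eta.
  by rewrite de1 -powRrM mulVf ?gt_eqF// powRr1// ltW// addr_gt0.
have de0 : 0 < de.
  rewrite ltNge; apply/negP => de0.
  have : (1 + de) `^ t <= 1 `^ t.
    by apply: ge0_ler_powR; rewrite ?nnegrE ?ler01 ?(ltW t0) ?de1 ?powR_ge0//; lra.
  rewrite det powR1; lra.
exists ((de^-1 + 1) `^ t).
  by rewrite powR_gt0// addr_gt0// invr_gt0.
move=> x y x0 y0; have [yx|xy] := leP y (de * x).
  rewrite ler_wpDr ?mulr_ge0 ?powR_ge0//; rewrite -det -powRM//; last by lra.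
  apply: ge0_ler_powR; rewrite ?nnegrE ?addr_ge0 ?mulr_ge0 ?(ltW t0)//; lra.
rewrite ler_wpDl ?mulr_ge0 ?powR_ge0//; first by lra.
have d0 : 0 <= de^-1 by rewrite invr_ge0 ltW.
rewrite -powRM//; last by lra.
apply: ge0_ler_powR; rewrite ?nnegrE ?addr_ge0 ?mulr_ge0 ?(ltW t0)//; first by lra.
by rewrite mulrDl mul1r lerD2r mulrC ler_pdivlMr// mulrC ltW.
Qed.

Lemma one_powR t : 1 `^ t = 1 :> R.
Proof. by rewrite powR1. Qed.

Lemma le_poweR_mul (a k l : R) (X Y : \bar R) : 0 <= a -> 0 <= k -> 0 <= l ->
  (0 <= X -> 0 <= Y -> k%:E * X <= l%:E * Y ->
  (k `^ a)%:E * X `^ a <= (l `^ a)%:E * Y `^ a)%E.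
Proof.
move=> a0 k0 l0 X0 Y0 h; rewrite -!poweR_EFin -!poweRM ?lee_fin//.
by apply: gt0_ler_poweR => //; rewrite in_itv/= leey andbT mule_ge0.
Qed.

Lemma powR_gt1 x t : 1 < x -> 0 < t -> 1 < x `^ t.
Proof.
move=> x1 t0; rewrite -(one_powR t); apply: gt0_ltr_powR => //; rewrite nnegrE//.
by lra.
Qed.

Lemma exists_powR_eq x y : 1 < x -> 1 < y -> exists2 e, 0 < e & x `^ e = y.
Proof.
move=> x1 y1; exists (ln y / ln x).
  by rewrite divr_gt0// ln_gt0.
rewrite /powR gt_eqF; last lra.
rewrite divfK ?lnK ?posrE//; first lra.
by rewrite gt_eqF// ln_gt0.
Qed.

End real_aux.

Section muckenhoupt.
Context {R : realType} {n : nat}.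
Local Notation leb := (@lebesgue_rV R n).
Local Notation node := ('rV[R]_n * R)%type.
Implicit Types (Q S : node) (x y : 'rV[R]_n) (f g u v w b : 'rV[R]_n -> R).
Local Notation pm a Q f := (pmean leb a (hcube Q) f).

Definition posfun u := measurable_fun setT u /\ forall x, 0 < u x.

Lemma posfun_inv u : posfun u -> posfun (fun x => (u x)^-1).
Proof.
by move=> [mu u0]; split; [exact: measurable_funV|move=> x; rewrite invr_gt0].
Qed.

Lemma posfun_powR u t : posfun u -> posfun (fun x => u x `^ t).
Proof. by move=> [mu u0]; split=> [|x]; [exact: measurable_powR_comp|exact: powR_gt0]. Qed.

(** A weight condition with two free exponents: A_{p,q} is the case a = q, c =
    p'. The exponents are kept independent because they are opened up
    separately. *)
Definition muck a c (K : R) u := posfun u /\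
  forall Q, 0 < Q.2 -> (pm a Q u * pm c Q (fun x => (u x)^-1)%R <= K%:E)%E.

Lemma muckV a c K u : muck a c K u -> muck c a K (fun x => (u x)^-1).
Proof.
move=> [pu h]; split; first exact: posfun_inv.
move=> Q Q0; rewrite muleC; have := h Q Q0.
by rewrite (_ : (fun x => (u x)^-1^-1) = u)//; apply/funext => x; rewrite invrK.
Qed.

Lemma pm_gt0 a Q u : 0 < a -> 0 < Q.2 -> posfun u -> (0 < pm a Q u)%E.
Proof. by move=> a0 Q0 [mu u0]; apply: pmean_gt0 => //; exact: fat_hcube. Qed.

Lemma muck_lty a c K u Q : 0 < a -> 0 < c -> muck a c K u -> 0 < Q.2 ->
  (pm a Q u < +oo)%E.
Proof.
move=> a0 c0 [pu h] Q0; have := h Q Q0.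
have p0 := pm_gt0 c0 Q0 (posfun_inv pu).
have := pm_gt0 a0 Q0 pu.
case E : (pm a Q u) => [r| |]//= _; first by rewrite ltry.
by rewrite gt0_mulye// leNgt ltry.
Qed.

Lemma muck_int_lty a c K u Q : 0 < a -> 0 < c -> muck a c K u -> 0 < Q.2 ->
  (\int[leb]_(x in hcube Q) (u x `^ a)%:E < +oo)%E.
Proof.
move=> a0 c0 hM Q0; have := muck_lty a0 c0 hM Q0; rewrite /pmean.
have V0 : 0 < (fine (leb (hcube Q)))^-1 by rewrite invr_gt0 fine_fat//; exact: fat_hcube.
move/lty_poweRy; rewrite invr_eq0 gt_eqF// => /(_ isT).
case: (\int[leb]_(x in hcube Q) _)%E => [r _| |//]; first by rewrite ltry.
by rewrite gt0_muley// ltxx.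
Qed.

Lemma pm_powR a Q u : 0 < a -> 0 < Q.2 ->
  (pm a Q u `^ a = ((fine (leb (hcube Q)))^-1)%:E * \int[leb]_(x in hcube Q) (u x `^ a)%:E)%E.
Proof.
move=> a0 Q0; rewrite /pmean -poweRrM mulVf ?gt_eqF// poweRe1//.
by rewrite mule_ge0 ?pint_ge0 ?fat_inv_ge0.
Qed.

(** A subset of at most half the measure of a cube carries at most the
    fraction 1 - kappa of its weight. *)
Definition ainfty (kappa : R) w := forall Q (S : set 'rV[R]_n), 0 < Q.2 ->
  measurable S -> S `<=` hcube Q -> (2%:E * leb S <= leb (hcube Q))%E ->
  (\int[leb]_(x in S) (w x)%:E <=
   (1 - kappa)%:E * \int[leb]_(x in hcube Q) (w x)%:E)%E.

(** Let E be the complement in Q of the small set, so that E has at least half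
    of the measure of Q. Hoelder for u 1_E times 1/u bounds a constant from
    below by the product of the means of u 1_E and 1/u, and the weight
    condition bounds the mean of 1/u by that of u. Hence E carries a fixed
    fraction of the integral of u^a. *)
Lemma muck_ainfty a c K u : 0 < a -> 0 < c -> muck a c K u ->
  exists2 kappa, 0 < kappa < 1 & ainfty kappa (fun x => u x `^ a).
Proof.
move=> a0 c0 hM; have [[mu u0] hK] := hM.
pose s := (a^-1 + c^-1)^-1.
have s0 : 0 < s by rewrite invr_gt0 addr_gt0 ?invr_gt0.
pose K1 := `|K| + 1; have K10 : 0 < K1 by rewrite ltr_wpDl.
(* k0 is the fraction of the u^a-integral of Q which a subset of half its
   measure must carry. *)
pose k0 := (2^-1 `^ s^-1 / K1) `^ a.
have k00 : 0 < k0 by rewrite powR_gt0// divr_gt0// powR_gt0// invr_gt0.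
have k01 : k0 <= 1.
  rewrite -[leRHS](one_powR a); apply: ge0_ler_powR; rewrite ?nnegrE ?(ltW a0)//.
    by rewrite divr_ge0 ?powR_ge0// ltW.
  rewrite ler_pdivrMr// mul1r /K1 ler_wpDl// -[leRHS](one_powR s^-1).
  have h21 : 2^-1 <= 1 :> R by lra.
  by apply: ge0_ler_powR; [rewrite invr_ge0 ltW|rewrite nnegrE; lra|rewrite nnegrE|].
exists (k0 / 2); first by apply/andP; split; lra.
move=> Q S Q0 mS SQ hS.
have fQ := fat_hcube Q0; have [mQ _] := fQ; have V0 := fine_fat fQ.
pose E := hcube Q `\` S.
have mE : measurable E by exact: measurableD.
have mua : measurable_fun setT (fun x => u x `^ a) by exact: measurable_powR_comp.
have mf (D : set 'rV[R]_n) : measurable_fun D (fun x => (u x `^ a)%:E).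
  by apply/measurable_EFinP; exact: measurable_funS mua.
have ge0 x : (0 <= (u x `^ a)%:E)%E by rewrite lee_fin powR_ge0.
have split_ (f : 'rV[R]_n -> \bar R) : measurable_fun setT f -> (forall x, (0 <= f x)%E) ->
   (\int[leb]_(x in hcube Q) f x = \int[leb]_(x in S) f x + \int[leb]_(x in E) f x)%E.
  move=> mf' f0; rewrite -[in LHS](setDUK SQ).
  rewrite ge0_integral_setU//; first exact: measurable_funS mf'.
  by apply/disj_setPS => x [Sx [_]].
have leE : (leb (hcube Q) <= 2%:E * leb E)%E.
  have e1 : leb (hcube Q) = (leb S + leb E)%E.
    have := split_ (cst 1%E) (measurable_cst _) (fun=> lee01).
    by rewrite !integral_cst// !mul1e.
  have fS : leb S \is a fin_num.
    rewrite ge0_fin_numE//; apply: le_lt_trans (leb_hcube_lty Q0).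
    exact: le_leb.
  have fE : leb E \is a fin_num.
    rewrite ge0_fin_numE//; apply: le_lt_trans (leb_hcube_lty Q0).
    by apply: le_leb => // x [].
  move: hS; rewrite e1 -(fineK fS) -(fineK fE) -EFinD -!EFinM !lee_fin; lra.
pose uE x := u x * \1_E x.
have muE : measurable_fun setT uE by apply: measurable_funM => //; exact: measurable_indic.
have uE0 x : 0 <= uE x by rewrite mulr_ge0// ltW.
have pV := posfun_inv (conj mu u0).
have H := @pmean_hoelder _ _ R leb a c s (hcube Q) uE (fun x => (u x)^-1) fQ muE pV.1
  uE0 (fun x => ltW (pV.2 x)) a0 c0 (invrK _).
have L1 : ((2^-1 `^ s^-1)%:E <= pmean leb s (hcube Q) (fun x => uE x * (u x)^-1)%R)%E.
  rewrite /pmean.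
  have -> : (\int[leb]_(x in hcube Q) ((uE x * (u x)^-1) `^ s)%:E = leb E)%E.
    transitivity (\int[leb]_(x in hcube Q) (\1_E x)%:E)%E.
      apply: eq_integral => x _; rewrite /uE mulrAC divff ?gt_eqF// mul1r.
      by rewrite indicE; case: (_ \in _); rewrite ?powR1// powR0// gt_eqF.
    by rewrite integral_indic// setIidl// => x [].
  rewrite -poweR_EFin; apply: gt0_ler_poweR.
  - by rewrite invr_ge0 ltW.
  - by rewrite in_itv/= leey andbT lee_fin; lra.
  - by rewrite in_itv/= leey andbT mule_ge0// fat_inv_ge0.
  have fE : leb E \is a fin_num.
    rewrite ge0_fin_numE//; apply: le_lt_trans (leb_hcube_lty Q0).
    by apply: le_leb => // x [].
  have fQn : leb (hcube Q) \is a fin_num by rewrite ge0_fin_numE// leb_hcube_lty.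
  move: leE; rewrite -(fineK fE) -(fineK fQn) -!EFinM !lee_fin => h.
  by rewrite mulrC ler_pdivlMr// mulrC ler_pdivrMr// mulrC.
have L2 : ((2^-1 `^ s^-1)%:E * pm a Q u <= K1%:E * pm a Q uE)%E.
  apply: (@le_trans _ _ (pm a Q uE * pm c Q (fun x => (u x)^-1)%R * pm a Q u)%E).
    by rewrite lee_wpmul2r ?pmean_ge0// (le_trans L1 H).
  rewrite -muleA muleC lee_wpmul2r ?pmean_ge0// muleC (le_trans (hK Q Q0))//.
  by rewrite lee_fin /K1 (le_trans (ler_norm _))// lerDl.
have L3 : (((2^-1 `^ s^-1) `^ a)%:E * \int[leb]_(x in hcube Q) (u x `^ a)%:E <=
   (K1 `^ a)%:E * \int[leb]_(x in E) (u x `^ a)%:E)%E.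
  have HE : (\int[leb]_(x in hcube Q) (uE x `^ a)%:E = \int[leb]_(x in E) (u x `^ a)%:E)%E.
    rewrite -(setIidr (_ : E `<=` hcube Q)); last by move=> x [].
    rewrite integral_mkcondr; apply: eq_integral => x _.
    rewrite patchE /uE indicE; case: (x \in E); rewrite ?mulr1//.
    by rewrite mulr0 powR0 ?gt_eqF.
  have := le_poweR_mul (ltW a0) (powR_ge0 _ _) (ltW K10)
    (pmean_ge0 _ _ _ _) (pmean_ge0 _ _ _ _) L2.
  rewrite (pm_powR u a0 Q0) (pm_powR uE a0 Q0) HE; move: V0; rewrite -invr_gt0 -lte_fin.
  move: (\int[leb]_(x in hcube Q) _)%E (\int[leb]_(x in E) _)%E (fine (leb (hcube Q)))^-1.
  by move=> X Y V V0; rewrite !(muleCA _ V%:E) (lee_pmul2l _ V0).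
have fin (D : set 'rV[R]_n) : measurable D -> D `<=` hcube Q ->
    (\int[leb]_(x in D) (u x `^ a)%:E)%E \is a fin_num.
  move=> mD DQ; rewrite ge0_fin_numE ?integral_ge0//.
  apply: le_lt_trans (muck_int_lty a0 c0 hM Q0).
  exact: ge0_subset_integral.
have fS := fin S mS SQ.
have fE : (\int[leb]_(x in E) (u x `^ a)%:E)%E \is a fin_num by apply: fin => // x [].
move: L3; rewrite (split_ (fun x => (u x `^ a)%:E))//.
have S0 : (0 <= \int[leb]_(x in S) (u x `^ a)%:E)%E by exact: integral_ge0.
have E0 : (0 <= \int[leb]_(x in E) (u x `^ a)%:E)%E by exact: integral_ge0.
move: S0 E0; rewrite -(fineK fS) -(fineK fE) -!EFinD -!EFinM !lee_fin.
move: (fine _) (fine _) => Y X X0 Y0 h.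
have : k0 * (X + Y) <= Y.
  rewrite /k0 powRM ?powR_ge0 ?invr_ge0 ?(ltW K10)//.
  have -> : K1^-1 `^ a = (K1 `^ a)^-1.
    by rewrite -(powR_inv1 (ltW K10)) powRAC powR_inv1 ?powR_ge0.
  rewrite mulrAC ler_pdivrMr ?powR_gt0//.
  by rewrite [Y * _]mulrC.
nra.
Qed.

End muckenhoupt.

(** * Reverse Hoelder inequality *)

Section self_improvement.
Context {R : realType} {n : nat}.
Local Notation leb := (@lebesgue_rV R n).
Local Notation node := ('rV[R]_n * R)%type.
Implicit Types (Q S : node) (x y : 'rV[R]_n) (f g u v w b : 'rV[R]_n -> R).
Local Notation pm a Q f := (pmean leb a (hcube Q) f).

Lemma fine_leb_hcube Q : 0 < Q.2 ->
  fine ((leb : {measure set _ -> \bar R}) (hcube Q)) = Q.2 ^+ n.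
Proof. by move=> Q0; have := leb_hcube Q0 => /= ->. Qed.

Lemma avgM Q g : 0 < Q.2 -> leb.-integrable (hcube Q) (EFin \o g) ->
  ((avg g Q)%:E * leb (hcube Q) = \int[leb]_(x in hcube Q) (g x)%:E)%E.
Proof.
move=> Q0 gi; rewrite leb_hcube// /avg /mean /Rintegral leb_hcube//=.
rewrite -[RHS]fineK; last first.
  by apply: integrable_fin_num => //; exact: measurable_hcube.
by rewrite -EFinM mulrAC mulVf ?mul1r// gt_eqF// exprn_gt0.
Qed.

Lemma avg_ge0 Q g : (forall x, 0 <= g x) -> 0 <= avg g Q.
Proof.
move=> g0; rewrite /avg /mean mulr_ge0 ?invr_ge0 ?fine_ge0//.
by apply: integral_ge0 => x _; rewrite lee_fin.
Qed.

(** A child has 2^-n of the measure of its parent. *)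
Lemma avg_child_le Q e g : 0 < Q.2 -> leb.-integrable (hcube Q) (EFin \o g) ->
  (forall x, 0 <= g x) -> avg g (child Q e) <= 2 ^+ n * avg g Q.
Proof.
move=> Q0 gi g0; have c0 := child_gt0 e Q0.
have V0 : 0 < (child Q e).2 ^+ n by rewrite exprn_gt0.
have : ((avg g (child Q e))%:E * leb (hcube (child Q e)) <=
   (2 ^+ n * avg g Q)%:E * leb (hcube (child Q e)))%E.
  rewrite avgM//; last exact: integrable_child.
  rewrite (mulrC (2 ^+ n)) EFinM -muleA -leb_child// avgM//.
  apply: ge0_subset_integral => //; try exact: measurable_hcube.
  - by have /integrableP[] := gi.
  - by move=> x _; rewrite lee_fin.
  - exact: sub_hcube_child.
by rewrite leb_hcube// -!EFinM lee_fin ler_pM2r.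
Qed.

Lemma integral_lin (S : set 'rV[R]_n) f g (k l : R) : measurable S ->
  measurable_fun S f -> measurable_fun S g -> (forall x, 0 <= f x) ->
  (forall x, 0 <= g x) -> 0 <= k -> 0 <= l ->
  (\int[leb]_(x in S) (k * f x + l * g x)%:E =
   k%:E * \int[leb]_(x in S) (f x)%:E + l%:E * \int[leb]_(x in S) (g x)%:E)%E.
Proof.
move=> mS mf mg f0 g0 k0 l0.
under eq_integral do rewrite EFinD.
rewrite ge0_integralD//.
- under eq_integral do rewrite EFinM.
  under [X in (_ + X)%E]eq_integral do rewrite EFinM.
  rewrite !ge0_integralZl_EFin//.
  + by move=> x _; rewrite lee_fin.
  + exact/measurable_EFinP.
  + by move=> x _; rewrite lee_fin.
  + exact/measurable_EFinP.
- by move=> x _; rewrite lee_fin mulr_ge0.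
- by apply/measurable_EFinP; exact: measurable_funM.
- by move=> x _; rewrite lee_fin mulr_ge0.
- by apply/measurable_EFinP; exact: measurable_funM.
Qed.

(** Cubes are stopped when the mean of g exceeds K, at least twice its mean
    over Q; by the Markov inequality they fill at most half of Q. *)
Lemma stopset_half (st : node -> bool) N Q g (K : R) : 0 < Q.2 -> 0 < K ->
  measurable_fun setT g -> (forall x, 0 <= g x) ->
  leb.-integrable (hcube Q) (EFin \o g) ->
  (forall S, 0 < S.2 -> st S -> (K%:E * leb (hcube S) <= \int[leb]_(x in hcube S) (g x)%:E)%E) ->
  2 * avg g Q <= K ->
  (2%:E * leb (stopset st N Q) <= leb (hcube Q))%E.
Proof.
move=> Q0 K0 mg g0 gi hst hK.
have := stopset_markov N Q0 mg g0 (ltW K0) hst.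
rewrite -avgM//; have fQ : leb (hcube Q) \is a fin_num.
  by rewrite ge0_fin_numE// leb_hcube_lty.
have fS : leb (stopset st N Q) \is a fin_num.
  rewrite ge0_fin_numE//; apply: le_lt_trans (leb_hcube_lty Q0).
  by apply: le_leb; [exact: measurable_stopset|exact: measurable_hcube|exact: stopset_sub].
have Q1 : 0 <= fine (leb (hcube Q)) by rewrite fine_ge0.
rewrite -(fineK fQ) -(fineK fS) -!EFinM !lee_fin => h.
rewrite -(ler_pM2l K0); nra.
Qed.

(** The bound is proved for the averages of w at depth N, by strong induction
    on N. Stop at the first cubes S where the mean of w exceeds K = 2 (w)_Q.
    Off them the average is at most K. On them the induction hypothesis
    applies and the mean is at most 2^n K, which costs the factor (2^n K)^e;
    but their union has at most half of the measure of Q, hence carries at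
    most the fraction 1 - kappa of the weight. For small e the product
    (2^(n+1))^e (1 - kappa) is below 1 and the induction closes. *)
Lemma ainfty_reverse_hoelder (kappa : R) w : 0 < kappa < 1 ->
  measurable_fun setT w -> (forall x, 0 < w x) ->
  (forall Q, 0 < Q.2 -> leb.-integrable (hcube Q) (EFin \o w)) ->
  ainfty kappa w ->
  exists e A : R, [/\ 0 < e, 0 < A & forall Q, 0 < Q.2 ->
    (\int[leb]_(x in hcube Q) (w x `^ (1 + e))%:E <=
     (A * avg w Q `^ (1 + e))%:E * leb (hcube Q))%E].
Proof.
move=> /andP[k0 k1] mw w0 wi hw.
have wge0 x : 0 <= w x by exact: ltW.
(* The choice of e makes (2^n K)^e (1 - kappa) = (1 - kappa/2) (w)_Q^e for K =
   2 (w)_Q; the slack kappa/2 pays for the cubes that are not stopped, which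
   fixes A. *)
have [e e0 eE] : exists2 e, 0 < e & (2 ^+ n.+1) `^ e = (1 - kappa / 2) / (1 - kappa).
  apply: exists_powR_eq; first by rewrite exprn_egt1// ltr1n.
  by rewrite ltr_pdivlMr ?mul1r; lra.
pose A := 2 * 2 `^ e / kappa.
have A0 : 0 < A by rewrite !mulr_gt0 ?powR_gt0// invr_gt0.
have an0 Q : 0 < Q.2 -> 0 < avg w Q.
  move=> Q0; have V0 : 0 < Q.2 ^+ n by rewrite exprn_gt0.
  have : (0 < \int[leb]_(x in hcube Q) (w x)%:E)%E.
    have := @pmean_gt0 _ _ _ leb 1 _ _ (fat_hcube Q0) mw ltr01 w0.
    rewrite /pmean invr1 poweRe1; last by rewrite mule_ge0 ?pint_ge0 ?fat_inv_ge0.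
    under eq_integral do rewrite powRr1//.
    by rewrite pmule_rgt0// lte_fin invr_gt0 fine_fat//; exact: fat_hcube.
  by rewrite -avgM; [|by []|exact: wi]; rewrite leb_hcube// -EFinM lte_fin pmulr_lgt0.
have main N Q : 0 < Q.2 ->
    (\int[leb]_(x in hcube Q) (`|mart N Q w x - 0| `^ (1 + e) * 1)%:E <=
     (A * avg w Q `^ e)%:E * \int[leb]_(x in hcube Q) (w x)%:E)%E.
  elim/ltn_ind: N Q => N IH Q Q0.
  pose K := 2 * avg w Q; have aQ := an0 _ Q0; have K0 : 0 < K by rewrite mulr_gt0.
  pose st S := K < avg w S.
  pose Phi k S := (\int[leb]_(x in hcube S) (`|mart k S w x - 0| `^ (1 + e) * 1)%:E)%E.
  pose cpsi := A * (2 ^+ n * K) `^ e.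
  have cpsi0 : 0 <= cpsi by rewrite mulr_ge0 ?powR_ge0// ltW.
  pose psi S := (\int[leb]_(x in hcube S) (cpsi * w x)%:E)%E.
  pose theta S := (\int[leb]_(x in hcube S) (K `^ e * w x)%:E)%E.
  have mcw (k : R) : measurable_fun setT (fun x => k * w x) by exact: measurable_funM.
  have psiE k (D : set 'rV[R]_n) : measurable D -> 0 <= k ->
      (\int[leb]_(x in D) (k * w x)%:E = k%:E * \int[leb]_(x in D) (w x)%:E)%E.
    move=> mD k00; under eq_integral do rewrite EFinM.
    rewrite ge0_integralZl_EFin//; first by move=> x _; rewrite lee_fin.
    by apply/measurable_EFinP; exact: measurable_funS mw.
  have Phi0 S : 0 < S.2 -> (Phi 0%N S = (avg w S `^ e)%:E * \int[leb]_(x in hcube S) (w x)%:E)%E.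
    move=> S0; rewrite /Phi /mart/= subr0 mulr1.
    rewrite (integral_cst leb (measurable_hcube S) (`|avg w S| `^ (1 + e))%:E).
    rewrite -avgM; [|by []|exact: wi].
    rewrite muleA -EFinM ger0_norm ?(ltW (an0 _ S0))//.
    by rewrite powRD ?powRr1 1?mulrC ?(ltW (an0 _ S0))// (gt_eqF (an0 _ S0)) implybT.
  have := @stopping_le _ _ st (fun S => avg w S <= 2 ^+ n * K) Phi psi theta N Q.
  have h1 k S : 0 < S.2 -> (Phi k.+1 S <= \sum_e0 Phi k (child S e0))%E.
    move=> S0; rewrite /Phi (@integral_leafS _ _ k S
      (fun T _ => (`|avg w T - 0| `^ (1 + e) * 1)%:E)); [by []|by []| |].
      by move=> T ?; rewrite lee_fin mulr1 powR_ge0.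
    apply/measurable_EFinP.
    exact: (@measurable_leaf_fun _ _ k.+1 S (fun T => `|avg w T - 0| `^ (1 + e) * 1)).
  have h2 S : (0 <= theta S)%E.
    by apply: integral_ge0 => x _; rewrite lee_fin mulr_ge0// powR_ge0.
  have h3 S : 0 < S.2 -> (\sum_e0 theta (child S e0) <= theta S)%E.
    move=> S0; rewrite /theta [leRHS]ge0_integral_child//.
    - by apply/measurable_EFinP; exact: measurable_funS (mcw _).
    - by move=> x _; rewrite lee_fin mulr_ge0// powR_ge0.
  have h4 k S : (k < N)%N -> 0 < S.2 -> avg w S <= 2 ^+ n * K -> st S -> (Phi k S <= psi S)%E.
    move=> kN S0 PS _; apply: le_trans (IH k kN S S0) _.
    rewrite /psi psiE//; last exact: measurable_hcube.
    rewrite lee_wpmul2r ?integral_ge0//; first by move=> x _; rewrite lee_fin.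
    rewrite lee_fin ler_wpM2l ?(ltW A0)//; apply: ge0_ler_powR; rewrite ?nnegrE ?(ltW e0)//.
      exact: ltW (an0 _ S0).
    by rewrite mulr_ge0 ?exprn_ge0// ltW.
  have h5 S : 0 < S.2 -> avg w S <= 2 ^+ n * K -> ~~ st S -> (Phi 0%N S <= theta S)%E.
    move=> S0 _; rewrite /st -leNgt => sS; rewrite Phi0// /theta psiE ?powR_ge0//; last exact: measurable_hcube.
    rewrite lee_wpmul2r ?integral_ge0//; first by move=> x _; rewrite lee_fin.
    rewrite lee_fin; apply: ge0_ler_powR; rewrite ?nnegrE ?(ltW e0)//.
      exact: ltW (an0 _ S0).
    exact: ltW.
  have h6 S e1 : 0 < S.2 -> avg w S <= 2 ^+ n * K -> ~~ st S -> avg w (child S e1) <= 2 ^+ n * K.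
    move=> S0 _; rewrite /st -leNgt => sS; apply: (le_trans (avg_child_le e1 S0 (wi _ S0) wge0)).
    by rewrite ler_wpM2l ?exprn_ge0.
  have n1 : 1 <= 2 ^+ n :> R by rewrite exprn_ege1// ler1n.
  have PQ : avg w Q <= 2 ^+ n * K by rewrite /K; nra.
  have sQ : ~~ st Q by rewrite /st -leNgt /K; lra.
  move=> /(_ h1 h2 h3 h4 h5 h6 Q0 PQ sQ) /le_trans; apply.
  have mS := measurable_stopset st N Q0.
  rewrite /psi (@ssum_integral _ _ st N Q (fun x => cpsi * w x))//; last first.
    by move=> x; rewrite mulr_ge0.
  rewrite /theta !psiE ?powR_ge0//; last exact: measurable_hcube.
  have hS : (2%:E * leb (stopset st N Q) <= leb (hcube Q))%E.
    apply: (@stopset_half st N Q w K) => //; first exact: wi.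
    move=> S S0 sS; rewrite -avgM; [|by []|exact: wi].
    by rewrite lee_wpmul2r// lee_fin ltW.
  have := hw Q _ Q0 mS (@stopset_sub _ _ st N Q) hS.
  have fQ : (\int[leb]_(x in hcube Q) (w x)%:E)%E \is a fin_num.
    by apply: integrable_fin_num; [exact: measurable_hcube|exact: wi].
  have fS : (\int[leb]_(x in stopset st N Q) (w x)%:E)%E \is a fin_num.
    apply: integrable_fin_num => //; apply: integrableS (wi _ Q0) => //.
    - exact: measurable_hcube.
    - exact: stopset_sub.
  have : (0 <= \int[leb]_(x in hcube Q) (w x)%:E)%E by apply: integral_ge0 => x _; rewrite lee_fin.
  rewrite -(fineK fQ) -(fineK fS) -!EFinM -EFinD !lee_fin.
  move: (fine _) (fine _) => Y X X0 YX.
  have E1 : cpsi = A * ((1 - kappa / 2) / (1 - kappa)) * avg w Q `^ e.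
    rewrite /cpsi /K mulrA -exprSr powRM ?exprn_ge0 ?(ltW aQ)// eE mulrA//.
  have E2 : K `^ e = (A * (kappa / 2)) * avg w Q `^ e.
    rewrite /K powRM ?(ltW aQ)//; congr (_ * _); rewrite /A; field.
    by rewrite gt_eqF.
  apply: (@le_trans _ _ (cpsi * ((1 - kappa) * X) + K `^ e * X)).
    by rewrite lerD2r ler_wpM2l.
  rewrite E1 E2 le_eqVlt; apply/orP; left; apply/eqP; field.
  by rewrite subr_eq0 gt_eqF.
exists e, A; split => // Q Q0.
have e1 : 0 < 1 + e by rewrite addr_gt0.
have mw' : measurable_fun (hcube Q) (fun=> 1 : R) by exact: measurable_cst.
have := @fatou_mart _ _ Q Q0 w (fun=> 1) 0 (1 + e) _ e1 (wi _ Q0) mw' (fun=> ler01) (fun N => main N Q Q0).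
have -> : (\int[leb]_(x in hcube Q) (`|w x - 0| `^ (1 + e) * 1)%:E =
   \int[leb]_(x in hcube Q) (w x `^ (1 + e))%:E)%E.
  by apply: eq_integral => x _; rewrite subr0 mulr1 ger0_norm.
move=> /le_trans; apply; rewrite -avgM//; last exact: wi.
rewrite muleA -EFinM powRD ?(gt_eqF (an0 _ Q0)) ?implybT//.
by rewrite powRr1 ?(ltW (an0 _ Q0))// mulrAC mulrA.
Qed.

(** The reverse Hoelder inequality for the weight u^a, rewritten for power
    means of u. *)
Lemma muck_open a c K u : 0 < a -> 0 < c -> muck a c K u ->
  exists a' C : R, [/\ a < a', 0 < C & forall Q, 0 < Q.2 ->
    (pm a' Q u <= C%:E * pm a Q u)%E].
Proof.
move=> a0 c0 hM; have [[mu u0] hK] := hM.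
have [kappa hk hA] := muck_ainfty a0 c0 hM.
have [mw w0] := posfun_powR a hM.1.
have wge0 x : 0 <= u x `^ a by exact: powR_ge0.
have wi Q : 0 < Q.2 -> leb.-integrable (hcube Q) (EFin \o (fun x => u x `^ a)).
  move=> Q0; apply/integrableP; split.
    by apply/measurable_EFinP; exact: measurable_funS mw.
  under eq_integral do rewrite /= ger0_norm//.
  exact: muck_int_lty hM Q0.
have [e [A [e0 A0 h]]] := ainfty_reverse_hoelder hk mw w0 wi hA.
have e1 : 0 < 1 + e by rewrite addr_gt0.
exists (a * (1 + e)), (A `^ (a * (1 + e))^-1); split.
- by rewrite ltr_pMr// ltrDl.
- exact: powR_gt0.
move=> Q Q0; have V0 : 0 < Q.2 ^+ n by rewrite exprn_gt0.
have av0 : 0 <= avg (fun x => u x `^ a) Q by exact: avg_ge0.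
have -> : pm a Q u = (avg (fun x => u x `^ a) Q `^ a^-1)%:E.
  rewrite /pmean -avgM//; last exact: wi.
  rewrite leb_hcube// -EFinM poweR_EFin; congr (_ `^ _)%:E.
  by rewrite fine_leb_hcube// mulrC mulfK// gt_eqF.
have := h Q Q0; rewrite leb_hcube// -EFinM => hQ.
have ae : 0 < a * (1 + e) by rewrite mulr_gt0.
apply: (@le_trans _ _ (((A * avg (fun x => u x `^ a) Q `^ (1 + e))%:E) `^ (a * (1 + e))^-1)%E).
  apply: gt0_ler_poweR.
  - by rewrite invr_ge0 ltW.
  - by rewrite in_itv/= leey andbT mule_ge0 ?pint_ge0 ?fat_inv_ge0.
  - by rewrite in_itv/= leey andbT lee_fin mulr_ge0 ?powR_ge0// ltW.
  rewrite fine_leb_hcube//; under eq_integral do rewrite powRrM.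
  rewrite muleC lee_pdivrMr//.
rewrite poweR_EFin powRM ?powR_ge0 ?(ltW A0)// EFinM -powRrM.
by rewrite invfM mulrCA mulfV ?mulr1// gt_eqF.
Qed.

End self_improvement.

(** * Weighted John-Nirenberg inequality *)

Section john_nirenberg.
Context {R : realType} {n : nat}.
Local Notation leb := (@lebesgue_rV R n).
Local Notation node := ('rV[R]_n * R)%type.
Implicit Types (Q S : node) (x y : 'rV[R]_n) (f g u v w b : 'rV[R]_n -> R).
Local Notation pm a Q f := (pmean leb a (hcube Q) f).

Lemma avg_dist_le Q b (beta : R) : 0 < Q.2 -> leb.-integrable (hcube Q) (EFin \o b) ->
  `|avg b Q - beta| <= avg (fun x => `|b x - beta|) Q.
Proof.
move=> Q0 bi; have ci := integrable_cst_hcube beta Q0.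
have bci : leb.-integrable (hcube Q) (EFin \o (fun x => b x - beta)).
  have -> : EFin \o (fun x => b x - beta) = ((EFin \o b) \- (EFin \o (fun=> beta)))%E by [].
  by apply: integrableB => //; exact: measurable_hcube.
rewrite -{1}(avg_cst beta Q0) -avgB//.
rewrite /avg /mean normrM ger0_norm ?invr_ge0 ?fine_ge0//.
rewrite ler_wpM2l ?invr_ge0 ?fine_ge0//.
by apply: le_normr_Rintegral => //; exact: measurable_hcube.
Qed.

(** The induction of the reverse Hoelder inequality, applied to b - b_Q. Cubes
    are stopped when the mean of |b - b_Q| exceeds 2 D, where D bounds the
    oscillation of b on Q. On a stopped cube S replace b_Q by b_S, at the
    price |b_S - b_Q| <= 2^n 2 D; the induction hypothesis bounds the rest by
    A times the v-integral over S. As the stopped cubes carry at most the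
    fraction 1 - kappa of the v-integral, the factor (1 + kappa/2)(1 - kappa)
    <= 1 - kappa/2 leaves room for the terms with D, which the last hypothesis
    converts from w to v. The weights w and v differ: D itself may depend on
    Q. *)
Lemma weighted_john_nirenberg (t kappa B : R) b w v : 0 < t -> 0 < kappa < 1 -> 0 <= B ->
  measurable_fun setT b ->
  (forall Q, 0 < Q.2 -> leb.-integrable (hcube Q) (EFin \o b)) ->
  measurable_fun setT w -> (forall x, 0 <= w x) ->
  measurable_fun setT v -> (forall x, 0 <= v x) ->
  (forall Q, 0 < Q.2 -> (\int[leb]_(x in hcube Q) (v x)%:E < +oo)%E) ->
  ainfty kappa v ->
  (forall Q, 0 < Q.2 -> exists D : R, [/\ 0 < D,
     avg (fun x => `|b x - avg b Q|) Q <= D &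
     ((D `^ t)%:E * \int[leb]_(x in hcube Q) (w x)%:E <=
       B%:E * \int[leb]_(x in hcube Q) (v x)%:E)%E]) ->
  exists2 A : R, 0 <= A & forall Q, 0 < Q.2 ->
    (\int[leb]_(x in hcube Q) (`|b x - avg b Q| `^ t * w x)%:E <=
     A%:E * \int[leb]_(x in hcube Q) (v x)%:E)%E.
Proof.
move=> t0 /andP[k0 k1] B0 mb bi mw w0 mv v0 vfin hv hD.
have eta0 : 0 < kappa / 2 by rewrite divr_gt0.
have [C C0 hC] := powRD_le t0 eta0.
(* c1 collects the two terms with D^t: the change from b_S to b_Q on the
   stopped cubes, and the cubes that are not stopped. A is chosen so that c1 B
   = (kappa/2) A. *)
pose c1 := (C * (2 ^+ n) `^ t + 1) * 2 `^ t.
have c10 : 0 < c1.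
  by rewrite mulr_gt0 ?powR_gt0// addr_gt0// mulr_gt0// powR_gt0// exprn_gt0.
pose A := 2 / kappa * (c1 * B).
have A0 : 0 <= A by apply: mulr_ge0; [apply: divr_ge0 => //|apply: mulr_ge0 => //]; exact: ltW.
have bci S (beta : R) : 0 < S.2 -> leb.-integrable (hcube S) (EFin \o (fun x => `|b x - beta|)).
  move=> S0; apply: integrable_norm.
  have -> : EFin \o (fun x => b x - beta) = ((EFin \o b) \- (EFin \o (fun=> beta)))%E by [].
  apply: integrableB; [exact: measurable_hcube|exact: bi|exact: integrable_cst_hcube].
have main N Q : 0 < Q.2 ->
    (\int[leb]_(x in hcube Q) (`|mart N Q b x - avg b Q| `^ t * w x)%:E <=
     A%:E * \int[leb]_(x in hcube Q) (v x)%:E)%E.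
  elim/ltn_ind: N Q => N IH Q Q0.
  have [D [D0 hDQ hDB]] := hD Q Q0.
  pose beta := avg b Q; pose g x := `|b x - beta|.
  have mg : measurable_fun setT g.
    by apply: measurableT_comp => //; exact: measurable_funB.
  have gi S : 0 < S.2 -> leb.-integrable (hcube S) (EFin \o g) by move=> S0; exact: bci.
  have g0 x : 0 <= g x by exact: normr_ge0.
  pose K := 2 * D; have K0 : 0 < K by rewrite mulr_gt0.
  pose st S := K < avg g S.
  pose Phi k S := (\int[leb]_(x in hcube S) (`|mart k S b x - beta| `^ t * w x)%:E)%E.
  pose h x := ((1 + kappa / 2) * A) * v x + (C * (2 ^+ n * K) `^ t) * w x.
  have cA0 : 0 <= (1 + kappa / 2) * A by rewrite mulr_ge0// addr_ge0 ?ltW.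
  have cC0 : 0 <= C * (2 ^+ n * K) `^ t by rewrite mulr_ge0 ?powR_ge0// ltW.
  have mh : measurable_fun setT h by apply: measurable_funD; exact: measurable_funM.
  have h0 x : 0 <= h x by rewrite addr_ge0// mulr_ge0.
  pose psi S := (\int[leb]_(x in hcube S) (h x)%:E)%E.
  pose theta S := (\int[leb]_(x in hcube S) (K `^ t * w x)%:E)%E.
  have mF k S : 0 < S.2 -> measurable_fun (hcube S) (fun x => (`|mart k S b x - beta| `^ t * w x)%:E).
    move=> S0; apply/measurable_EFinP/measurable_funM; last exact: measurable_funS mw.
    exact: (@measurable_leaf_fun _ _ k S (fun T => `|avg b T - beta| `^ t)).
  have h1 k S : 0 < S.2 -> (Phi k.+1 S <= \sum_e Phi k (child S e))%E.
    move=> S0; rewrite /Phi (@integral_leafS _ _ k S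
      (fun T x => (`|avg b T - beta| `^ t * w x)%:E)); [by []|by []| |exact: mF].
    by move=> T ?; rewrite lee_fin mulr_ge0 ?powR_ge0.
  have h2 S : (0 <= theta S)%E.
    by apply: integral_ge0 => x _; rewrite lee_fin mulr_ge0// powR_ge0.
  have h3 S : 0 < S.2 -> (\sum_e theta (child S e) <= theta S)%E.
    move=> S0; rewrite /theta [leRHS]ge0_integral_child//.
    - by apply/measurable_EFinP/measurable_funM => //; exact: measurable_funS mw.
    - by move=> x _; rewrite lee_fin mulr_ge0// powR_ge0.
  have h4 k S : (k < N)%N -> 0 < S.2 -> avg g S <= 2 ^+ n * K -> st S -> (Phi k S <= psi S)%E.
    move=> kN S0 PS _.
    have dS : `|avg b S - beta| <= 2 ^+ n * K.
      by apply: le_trans PS; exact: avg_dist_le (bi _ S0).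
    have mS := @measurable_hcube R n S.
    have mwS : measurable_fun (hcube S) w by exact: measurable_funS mw.
    have mvS : measurable_fun (hcube S) v by exact: measurable_funS mv.
    pose F x := `|mart k S b x - avg b S| `^ t * w x.
    have mFS : measurable_fun (hcube S) F.
      apply/measurable_funM => //.
      exact: (@measurable_leaf_fun _ _ k S (fun T => `|avg b T - avg b S| `^ t)).
    apply: (@le_trans _ _ (\int[leb]_(x in hcube S) ((1 + kappa / 2) * F x +
        (C * (2 ^+ n * K) `^ t) * w x)%:E)%E).
      apply: ge0_le_integral => //.
      - by move=> x _; rewrite lee_fin mulr_ge0 ?powR_ge0.
      - exact: mF.
      - by apply/measurable_EFinP; apply: measurable_funD; exact: measurable_funM.
      move=> x Sx; rewrite lee_fin /F mulrA -mulrDl ler_wpM2r//.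
      apply: (@le_trans _ _ ((`|mart k S b x - avg b S| + `|avg b S - beta|) `^ t)).
        apply: ge0_ler_powR; rewrite ?nnegrE ?addr_ge0 ?(ltW t0)//.
        exact: ler_distD.
      apply: le_trans (hC _ _ (normr_ge0 _) (normr_ge0 _)) _.
      rewrite lerD2l ler_wpM2l ?(ltW C0)//.
      by apply: ge0_ler_powR; rewrite ?nnegrE ?(ltW t0)// mulr_ge0 ?exprn_ge0// ltW.
    have e0 : 0 <= 1 + kappa / 2 by rewrite addr_ge0 ?ltW.
    have F0 x : 0 <= F x by rewrite mulr_ge0 ?powR_ge0.
    rewrite (integral_lin mS mFS mwS F0 w0 e0 cC0).
    rewrite /psi /h (integral_lin mS mvS mwS v0 w0 cA0 cC0).
    rewrite leeD2r// EFinM -muleA lee_wpmul2l//.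
    exact: IH kN S S0.
  have h5 S : 0 < S.2 -> avg g S <= 2 ^+ n * K -> ~~ st S -> (Phi 0%N S <= theta S)%E.
    move=> S0 _; rewrite /st -leNgt => sS; rewrite /Phi /theta /mart/=.
    apply: ge0_le_integral => //.
    - exact: measurable_hcube.
    - by move=> x _; rewrite lee_fin mulr_ge0 ?powR_ge0.
    - exact: (mF 0%N).
    - by apply/measurable_EFinP/measurable_funM => //; exact: measurable_funS mw.
    move=> x Sx; rewrite lee_fin ler_wpM2r//.
    apply: ge0_ler_powR; rewrite ?nnegrE ?(ltW t0) ?(ltW K0)//.
    by apply: le_trans sS; exact: avg_dist_le (bi _ S0).
  have h6 S e1 : 0 < S.2 -> avg g S <= 2 ^+ n * K -> ~~ st S -> avg g (child S e1) <= 2 ^+ n * K.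
    move=> S0 _; rewrite /st -leNgt => sS; apply: (le_trans (avg_child_le e1 S0 (gi _ S0) g0)).
    by rewrite ler_wpM2l ?exprn_ge0.
  have n1 : 1 <= 2 ^+ n :> R by rewrite exprn_ege1// ler1n.
  have gQ : avg g Q <= D by exact: hDQ.
  have ag0 : 0 <= avg g Q by exact: avg_ge0.
  have PQ : avg g Q <= 2 ^+ n * K by rewrite /K; nra.
  have sQ : ~~ st Q by rewrite /st -leNgt /K; lra.
  have := @stopping_le _ _ st (fun S => avg g S <= 2 ^+ n * K) Phi psi theta N Q.
  move=> /(_ h1 h2 h3 h4 h5 h6 Q0 PQ sQ) /le_trans; apply.
  have mS := measurable_stopset st N Q0.
  have mQ := @measurable_hcube R n Q.
  rewrite /psi (@ssum_integral _ _ st N Q h)//.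
  have SQ := @stopset_sub _ _ st N Q.
  have mmS f (D' : set 'rV[R]_n) : measurable_fun setT f -> measurable_fun D' f.
    by move=> mf; exact: measurable_funS mf.
  rewrite /h (integral_lin mS (mmS _ _ mv) (mmS _ _ mw) v0 w0 cA0 cC0).
  rewrite /theta; under [X in (_ + X)%E]eq_integral do rewrite EFinM.
  rewrite ge0_integralZl_EFin ?powR_ge0//; last 2 first.
  - by move=> x _; rewrite lee_fin.
  - by apply/measurable_EFinP; exact: mmS.
  have hS : (2%:E * leb (stopset st N Q) <= leb (hcube Q))%E.
    apply: (@stopset_half _ _ st N Q g K) => //; first exact: gi.
    - move=> S S0 sS; rewrite -avgM; [|by []|exact: gi].
      by rewrite lee_wpmul2r// lee_fin ltW.
    - by rewrite /K ler_wpM2l.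
  have vS := hv Q _ Q0 mS SQ hS.
  have wS : (\int[leb]_(x in stopset st N Q) (w x)%:E <= \int[leb]_(x in hcube Q) (w x)%:E)%E.
    apply: ge0_subset_integral => //; first by apply/measurable_EFinP; exact: mmS.
    by move=> x _; rewrite lee_fin.
  apply: (@le_trans _ _ (((1 + kappa / 2) * A)%:E * ((1 - kappa)%:E * \int[leb]_(x in hcube Q) (v x)%:E) +
     (C * (2 ^+ n * K) `^ t)%:E * \int[leb]_(x in hcube Q) (w x)%:E +
     (K `^ t)%:E * \int[leb]_(x in hcube Q) (w x)%:E)%E).
    by rewrite leeD2r// leeD// lee_wpmul2l.
  have -> : C * (2 ^+ n * K) `^ t = C * (2 ^+ n) `^ t * 2 `^ t * D `^ t.
    by rewrite /K !powRM ?mulr_ge0 ?exprn_ge0 ?(ltW D0)// !mulrA.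
  have -> : K `^ t = 2 `^ t * D `^ t by rewrite /K powRM ?(ltW D0).
  have vQ0 : (0 <= \int[leb]_(x in hcube Q) (v x)%:E)%E by apply: integral_ge0 => x _; rewrite lee_fin.
  have wQ0 : (0 <= \int[leb]_(x in hcube Q) (w x)%:E)%E by apply: integral_ge0 => x _; rewrite lee_fin.
  have vQf : (\int[leb]_(x in hcube Q) (v x)%:E)%E \is a fin_num by rewrite ge0_fin_numE// vfin.
  have wQf : (\int[leb]_(x in hcube Q) (w x)%:E)%E \is a fin_num.
    rewrite ge0_fin_numE//; case: (\int[leb]_(x in hcube Q) (w x)%:E)%E hDB => [r _| |//]; first by rewrite ltry.
    rewrite gt0_muley ?lte_fin ?powR_gt0// -(fineK vQf) -EFinM leye_eq//.
  move: vQ0 wQ0 hDB; rewrite -(fineK vQf) -(fineK wQf) -!EFinM -!EFinD !lee_fin.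
  move: (fine _) (fine _) => W V V0 W0 hW.
  have hW' : 0 <= D `^ t * W by rewrite mulr_ge0 ?powR_ge0.
  apply: (@le_trans _ _ ((1 + kappa / 2) * A * ((1 - kappa) * V) + c1 * (D `^ t * W))).
    by rewrite /c1 le_eqVlt; apply/orP; left; apply/eqP; ring.
  apply: (@le_trans _ _ ((1 + kappa / 2) * A * ((1 - kappa) * V) + c1 * (B * V))).
    by rewrite lerD2l ler_wpM2l// ltW.
  have -> : c1 * (B * V) = kappa / 2 * A * V by rewrite /A; field; rewrite gt_eqF.
  have AV : 0 <= A * V by rewrite mulr_ge0.
  nra.
exists A => // Q Q0.
exact: (@fatou_mart _ _ Q Q0 b w (avg b Q) t _ t0 (bi _ Q0) (measurable_funS _ _ mw) w0 (fun N => main N Q Q0)).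
Qed.

End john_nirenberg.

(** * Summation over all scales *)

Section geometric_sums.
Context {R : realType}.
Implicit Types (rho beta v X : R).

(** The sum is comparable with its largest term, which is at most X^beta. The
    constant does not depend on the range or on the starting point of the
    progression. *)
Lemma geometric_sum_le rho beta : 1 < rho -> 0 < beta ->
  exists2 C : R, 0 < C & forall m v X, 0 < v ->
    \sum_(i < m | rho ^+ i * v <= X) (rho ^+ i * v) `^ beta <= C * X `^ beta.
Proof.
move=> rho1 beta0; have rho0 : 0 < rho by lra.
have rb1 := powR_gt1 rho1 beta0; have rb0 : 0 < rho `^ beta by lra.
pose C := (1 - (rho `^ beta)^-1)^-1.
have C0 : 0 < C by rewrite invr_gt0 subr_gt0 invf_lt1.
have CE : C * (rho `^ beta)^-1 + 1 = C.
  by rewrite /C; field; rewrite !gt_eqF//= subr_gt0.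
exists C => // m v X v0.
have full k : \sum_(i < k) (rho ^+ i * v) `^ beta <= C * (rho `^ beta)^-1 * (rho ^+ k * v) `^ beta.
  elim: k => [|k IH].
    by rewrite big_ord0; apply: mulr_ge0; [apply: mulr_ge0; [exact: ltW|rewrite invr_ge0; exact: ltW]|exact: powR_ge0].
  rewrite big_ord_recr/=; apply: (le_trans (lerD IH (lexx _))).
  rewrite -[X in _ + X]mul1r -mulrDl CE exprS -(mulrA rho) (powRM _ (ltW rho0)); last first.
    by rewrite mulr_ge0 ?exprn_ge0 ?(ltW rho0) ?(ltW v0).
  by rewrite mulrA divfK// gt_eqF.
elim: m => [|m IH]; first by rewrite big_ord0 mulr_ge0 ?powR_ge0// ltW.
have [mX|Xm] := leP (rho ^+ m * v) X; last first.
  by rewrite big_mkcond big_ord_recr/= (leNgt _ X) Xm/= addr0 -big_mkcond.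
apply: (@le_trans _ _ (\sum_(i < m.+1) (rho ^+ i * v) `^ beta)).
  rewrite [leLHS]big_mkcond; apply: ler_sum => i _; case: ifP => // _.
  exact: powR_ge0.
apply: (le_trans (full _)); rewrite exprS -(mulrA rho) (powRM _ (ltW rho0)); last first.
  by rewrite mulr_ge0 ?exprn_ge0 ?(ltW rho0) ?(ltW v0).
rewrite mulrA divfK ?gt_eqF// ler_wpM2l ?(ltW C0)//.
have h0 : 0 <= rho ^+ m * v by rewrite mulr_ge0 ?exprn_ge0 ?(ltW rho0) ?(ltW v0).
by apply: ge0_ler_powR; rewrite ?nnegrE ?(ltW beta0)// (le_trans h0).
Qed.

(** The counterpart for the decreasing powers: the largest term is the first
    one, at most X^(-beta). *)
Lemma geometric_sum_gt rho beta : 1 < rho -> 0 < beta ->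
  exists2 C : R, 0 < C & forall m v X, 0 < v -> 0 < X ->
    \sum_(i < m | X < rho ^+ i * v) (rho ^+ i * v) `^ (- beta) <= C * X `^ (- beta).
Proof.
move=> rho1 beta0; have rho0 : 0 < rho by lra.
have rb1 := powR_gt1 rho1 beta0; have rb0 : 0 < rho `^ beta by lra.
pose C := (1 - (rho `^ beta)^-1)^-1.
have C0 : 0 < C by rewrite invr_gt0 subr_gt0 invf_lt1.
have CE : 1 + C * (rho `^ beta)^-1 = C.
  by rewrite /C; field; rewrite !gt_eqF//= subr_gt0.
exists C => // m v X v0 X0.
have shift k (u : R) : rho ^+ k.+1 * u = rho ^+ k * (rho * u) by rewrite exprSr mulrA.
have full k u : 0 < u -> \sum_(i < k) (rho ^+ i * u) `^ (- beta) <= C * u `^ (- beta).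
  elim: k u => [|k IH] u u0; first by rewrite big_ord0 mulr_ge0 ?powR_ge0// ltW.
  rewrite big_ord_recl/= expr0 mul1r.
  under eq_bigr do rewrite /bump/= add1n shift.
  apply: (le_trans (lerD (lexx _) (IH (rho * u) _))); first exact: mulr_gt0.
  by rewrite powRM ?(ltW rho0) ?(ltW u0)// (powRN rho) mulrA -{1}(mul1r (u `^ _)) -mulrDl CE.
elim: m v v0 => [|m IH] v v0; first by rewrite big_ord0 mulr_ge0 ?powR_ge0// ltW.
have [vX|Xv] := leP v X.
  rewrite big_mkcond big_ord_recl/= expr0 mul1r ltNge vX/= add0r.
  under eq_bigr do rewrite /bump/= add1n shift.
  by rewrite -big_mkcond; apply: IH; exact: mulr_gt0.
apply: (@le_trans _ _ (\sum_(i < m.+1) (rho ^+ i * v) `^ (- beta))).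
  rewrite [leLHS]big_mkcond; apply: ler_sum => i _; case: ifP => // _.
  exact: powR_ge0.
apply: (le_trans (full _ _ v0)); rewrite ler_wpM2l ?(ltW C0)// !powRN.
rewrite lef_pV2 ?posrE ?powR_gt0//.
by apply: ge0_ler_powR; rewrite ?nnegrE ltW.
Qed.

Lemma poweRD_le (B : R) (x y : \bar R) : 0 < B -> (0 <= x -> 0 <= y ->
  (x + y) `^ B <= (2 `^ B)%:E * (x `^ B + y `^ B))%E.
Proof.
move=> B0; have H (u v : \bar R) : (0 <= u -> u <= v ->
    (u + v) `^ B <= (2 `^ B)%:E * (u `^ B + v `^ B))%E.
  move=> u0 uv; have v0 := le_trans u0 uv.
  apply: (@le_trans _ _ ((2%:E * v) `^ B)%E).
    apply: gt0_ler_poweR; rewrite ?(ltW B0) ?in_itv/= ?leey ?andbT ?adde_ge0 ?mule_ge0//.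
    by rewrite mule_natl mule2n leeD2r.
  by rewrite poweRM// poweR_EFin lee_wpmul2l ?lee_fin ?powR_ge0// leeDr ?poweR_ge0.
move=> x0 y0; have [xy|yx] := leP x y; first exact: H.
by rewrite addeC (addeC (x `^ B)%E); apply: H => //; exact: ltW.
Qed.

Lemma poweR_le1 (B : R) (x : \bar R) : 1 <= B -> (0 <= x -> x <= 1 -> x `^ B <= x)%E.
Proof.
move=> B1; case: x => [x| |]//; rewrite !lee_fin => x0 x1.
move: x0; rewrite le_eqVlt => /predU1P[<-|x0].
  by rewrite powR0// gt_eqF//; lra.
by apply: ge1r_powR => //; rewrite x0.
Qed.

End geometric_sums.

Section averages.
Context {R : realType} {n : nat}.
Local Notation leb := (@lebesgue_rV R n).
Local Notation V := ('rV[R]_n).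
Implicit Types (x y z : V) (f g phi : V -> R).

Lemma measurable_in_hcube (l : R) :
  measurable [set p : V * V | hcube (p.1, l) p.2].
Proof.
rewrite (_ : [set _ | _] = \bigcap_(i in [set: 'I_n])
  [set p : V * V | `[0, l[%classic (p.2 ord0 i - p.1 ord0 i)]).
  apply: fin_bigcap_measurable => // i _; rewrite -[X in measurable X]setTI.
  have mf : measurable_fun setT (fun p : V * V => p.2 ord0 i - p.1 ord0 i).
    apply: measurable_funB.
      by have /= := measurableT_comp (@measurable_coord _ R n i)
        (@measurable_snd _ _ V V).
    by have /= := measurableT_comp (@measurable_coord _ R n i)
      (@measurable_fst _ _ V V).
  by apply: mf => //; exact: measurable_itv.
apply/seteqP; split => [[z x] h i _|[z x] h i] /=.
  by have := h i; rewrite /= in_itv/=; lra.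
by have := h i I; rewrite /= in_itv/=; lra.
Qed.

Lemma cornerE (l : R) x : [set z | hcube (z, l) x] = [set z : V | forall i,
   `]x ord0 i - l, x ord0 i]%classic (z ord0 i)].
Proof.
by apply/seteqP; split => z /= h i; have := h i; rewrite /= in_itv/=; lra.
Qed.

Lemma measurable_corner (l : R) x : measurable [set z | hcube (z, l) x].
Proof.
rewrite cornerE; exact: (@measurable_box _ _
  (fun i => `]x ord0 i - l, x ord0 i]%classic) (fun i => measurable_itv _)).
Qed.

Lemma leb_corner (l : R) x : 0 < l ->
  leb [set z | hcube (z, l) x] = (l ^+ n)%:E.
Proof.
move=> l0; rewrite cornerE.
apply: (@leb_itv_prod _ _ (fun i => `]x ord0 i - l, x ord0 i]%classic)) => // i.
rewrite lebesgue_measure_itv/= lte_fin ltrBlDr ltrDl l0 -EFinD.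
by rewrite opprB addrC subrK.
Qed.

Lemma measurable_fun_hcube_prod (l : R) (f : V -> \bar R) : measurable_fun setT f ->
  measurable_fun setT (fun p : V * V => (f p.2 * (\1_[set p : V * V | hcube (p.1, l) p.2] p)%:E)%E).
Proof.
move=> mf; apply: emeasurable_funM.
  by have /= := measurableT_comp mf (@measurable_snd _ _ V V).
by apply/measurable_EFinP; apply: measurable_indic; exact: measurable_in_hcube.
Qed.

Lemma integral_hcube_indic (l : R) (f : V -> \bar R) z :
  (\int[leb]_(x in hcube (z, l)) f x =
   \int[leb]_x (f x * (\1_[set p : V * V | hcube (p.1, l) p.2] (z, x))%:E))%E.
Proof.
rewrite integral_mkcond; apply: eq_integral => x _; rewrite patchE indicE.
have -> : ((z, x) \in [set p : V * V | hcube (p.1, l) p.2]) = (x \in hcube (z, l)).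
  by apply: asbool_equiv_eq.
by case: ifP => _; rewrite ?mule1 ?mule0.
Qed.

Lemma measurable_hcube_int (l : R) (f : V -> \bar R) : measurable_fun setT f ->
  (forall x, (0 <= f x)%E) ->
  measurable_fun setT (fun z => \int[leb]_(x in hcube (z, l)) f x)%E.
Proof.
move=> mf f0; under eq_fun do rewrite integral_hcube_indic.
apply: (@measurable_fun_fubini_tonelli_F _ _ V V R leb
  _ (measurable_fun_hcube_prod l mf)).
by move=> p /=; rewrite mule_ge0// lee_fin.
Qed.

Lemma fubini_hcube (l : R) (f : V -> \bar R) : 0 < l -> measurable_fun setT f ->
  (forall x, (0 <= f x)%E) ->
  (\int[leb]_z \int[leb]_(x in hcube (z, l)) f x = (l ^+ n)%:E * \int[leb]_x f x)%E.
Proof.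
move=> l0 mf f0; under eq_integral do rewrite integral_hcube_indic.
have := @fubini_tonelli _ _ V V R leb leb (fun p : V * V => (f p.2 * (\1_[set p : V * V | hcube (p.1, l) p.2] p)%:E)%E).
move=> ->; last 2 first.
- exact: measurable_fun_hcube_prod.
- by move=> p /=; rewrite mule_ge0// lee_fin.
rewrite -ge0_integralZl//; last by rewrite lee_fin exprn_ge0// ltW.
apply: eq_integral => x _ /=; rewrite ge0_integralZl//.
- rewrite muleC; congr (_ * _)%E.
  transitivity (\int[leb]_z (\1_[set z | hcube (z, l) x] z)%:E)%E.
    apply: eq_integral => z _; rewrite !indicE; congr (_%:R%:E).
  rewrite (integral_indic leb measurableT (measurable_corner l x)) setIT.
  exact: leb_corner.
- by apply/measurable_EFinP; apply: measurable_indic; exact: measurable_corner.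
Qed.

End averages.

Section scale_sum.
Context {R : realType} {n : nat}.
Hypothesis n0 : (0 < n)%N.
Local Notation leb := (@lebesgue_rV R n).
Local Notation V := ('rV[R]_n).
Implicit Types (x y z : V) (f g phi : V -> R).

Definition side (l0 : R) i := 2 ^+ i * l0.
Definition vol (l0 : R) i : R := side l0 i ^+ n.

Lemma side_gt0 l0 i : 0 < l0 -> 0 < side l0 i.
Proof. by move=> l00; rewrite mulr_gt0// exprn_gt0. Qed.

Lemma vol_gt0 l0 i : 0 < l0 -> 0 < vol l0 i.
Proof. by move=> l00; rewrite exprn_gt0// side_gt0. Qed.

Lemma volE l0 i : vol l0 i = (2 ^+ n) ^+ i * l0 ^+ n.
Proof. by rewrite /vol /side exprMn -!exprM mulnC. Qed.

(** The mean over the cube with corner z, as a function of z. *)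
Definition cavg l phi z : \bar R :=
  ((l ^+ n)^-1%:E * \int[leb]_(x in hcube (z, l)) (phi x)%:E)%E.

Lemma cavg_ge0 l phi z : 0 <= l -> (forall x, 0 <= phi x) -> (0 <= cavg l phi z)%E.
Proof.
move=> l0 p0; rewrite mule_ge0 ?lee_fin ?invr_ge0 ?exprn_ge0//.
by apply: integral_ge0 => x _; rewrite lee_fin.
Qed.

Lemma measurable_cavg l phi : measurable_fun setT phi -> (forall x, 0 <= phi x) ->
  measurable_fun setT (cavg l phi).
Proof.
move=> mp p0; apply: emeasurable_funM => //.
apply: measurable_hcube_int; last by move=> x; rewrite lee_fin.
exact/measurable_EFinP.
Qed.

(** Averaging over all translates of a cube preserves the integral. *)
Lemma integral_cavg l phi : 0 < l -> measurable_fun setT phi -> (forall x, 0 <= phi x) ->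
  (\int[leb]_z cavg l phi z = \int[leb]_x (phi x)%:E)%E.
Proof.
move=> l0 mp p0; have mpE : measurable_fun setT (EFin \o phi) by exact/measurable_EFinP.
have l0n : 0 < l ^+ n by exact: exprn_gt0.
rewrite ge0_integralZl//; last 3 first.
- by apply: measurable_hcube_int => // x; rewrite lee_fin.
- by move=> x _; apply: integral_ge0 => y _; rewrite lee_fin.
- by rewrite lee_fin invr_ge0 ltW.
rewrite fubini_hcube//.
by rewrite muleA -EFinM mulVf ?mul1e// gt_eqF.
Qed.

Lemma cavgE l phi z : 0 < l -> (forall x, 0 <= phi x) ->
  cavg l phi z = pmean leb 1 (hcube (z, l)) phi.
Proof.
move=> l0 p0; rewrite /pmean fine_leb_hcube//= invr1 poweRe1; last first.
  rewrite mule_ge0 ?lee_fin ?invr_ge0 ?exprn_ge0 ?(ltW l0)//.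
  by apply: integral_ge0 => x _; rewrite lee_fin powR_ge0.
by congr (_ * _)%E; apply: eq_integral => x _; rewrite powRr1.
Qed.

Lemma cavg_pow_le l phi z B : 0 < l -> 1 <= B -> measurable_fun setT phi ->
  (forall x, 0 <= phi x) ->
  (cavg l phi z `^ B <= cavg l (fun x => phi x `^ B)%R z)%E.
Proof.
move=> l0 B1 mp p0; have B0 : 0 < B by lra.
have fQ := @fat_hcube R n (z, l) l0.
apply: (@le_trans _ _ (pmean leb B (hcube (z, l)) phi `^ B)%E).
  rewrite cavgE//; apply: gt0_ler_poweR; first exact: ltW.
  - by rewrite in_itv/= leey andbT pmean_ge0.
  - by rewrite in_itv/= leey andbT pmean_ge0.
  - by apply: pmean_mono => //; rewrite ltr01.
by rewrite (pm_powR phi B0)//= /cavg fine_leb_hcube.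
Qed.

Lemma cavgD_le l f g h z B : 0 < l -> 0 < B ->
  measurable_fun setT f -> measurable_fun setT g ->
  (forall x, 0 <= f x) -> (forall x, 0 <= g x) -> (forall x, h x = f x + g x) ->
  (cavg l h z `^ B <= (2 `^ B)%:E * (cavg l f z `^ B + cavg l g z `^ B))%E.
Proof.
move=> l0 B0 mf mg f0 g0 hE.
have -> : cavg l h z = (cavg l f z + cavg l g z)%E.
  rewrite /cavg -ge0_muleDr; last 2 first.
  - by apply: integral_ge0 => x _; rewrite lee_fin.
  - by apply: integral_ge0 => x _; rewrite lee_fin.
  congr (_ * _)%E; under eq_integral do rewrite hE EFinD.
  have mQ := @measurable_hcube R n (z, l).
  apply: ge0_integralD => //.
  - by move=> x _; rewrite lee_fin.
  - by apply/measurable_EFinP; exact: measurable_funS mf.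
  - by move=> x _; rewrite lee_fin.
  - by apply/measurable_EFinP; exact: measurable_funS mg.
by apply: poweRD_le => //; apply: cavg_ge0 => //; exact: ltW.
Qed.

(** The scale-invariant estimate that does the work of a maximal function. At
    the scale of volume v split phi at the level v^(-1/P). The low part is
    treated by convexity of the B-th power, the high part by the bound phi <=
    v^(-1/P) for averages (normalization of phi in L^P), which turns the B-th
    power into a first power. After integration in z each point x contributes
    a sum over scales v <= phi(x)^(-P), respectively v > phi(x)^(-P), and
    these are geometric series with sum comparable to phi(x)^P. *)
Lemma scale_sum (P B : R) : 1 < P -> P < B ->
  exists2 C : R, 0 < C & forall (m : nat) (l0 : R) phi, 0 < l0 ->
    measurable_fun setT phi -> (forall x, 0 <= phi x) ->
    (\int[leb]_x (phi x `^ P)%:E <= 1)%E ->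
    (\sum_(i < m) (vol l0 i `^ (B / P - 1))%:E *
        \int[leb]_z (cavg (side l0 i) phi z `^ B) <= C%:E)%E.
Proof.
move=> P1 PB; have P0 : 0 < P by lra. have B0 : 0 < B by lra.
have rho1 : 1 < 2 ^+ n :> R by rewrite exprn_egt1// ?ltr1n// -lt0n.
have be0 : 0 < B / P - 1 by rewrite subr_gt0 ltr_pdivlMr// mul1r.
have ga0 : 0 < 1 - P^-1 by rewrite subr_gt0 invf_lt1.
have [C1 C10 hC1] := geometric_sum_le rho1 be0.
have [C2 C20 hC2] := geometric_sum_gt rho1 ga0.
pose C := 2 `^ B * (C1 + C2).
exists C; first by rewrite mulr_gt0 ?powR_gt0// addr_gt0.
move=> m l0 phi l00 mp p0 hphi.
(* The level v^(-1/P), written without division so that the case phi(x) = 0 is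
   included. *)
pose lo i x := vol l0 i * phi x `^ P <= 1.
pose fl i x := if lo i x then phi x else 0.
pose fh i x := if lo i x then 0 else phi x.
have mphiP r : measurable_fun setT (fun x => phi x `^ r) by exact: measurable_powR_comp.
have mlo i : measurable_fun setT (lo i).
  by apply: measurable_fun_ler => //; exact: measurable_funM.
have mfl i : measurable_fun setT (fl i) by exact: measurable_fun_ifT.
have mfh i : measurable_fun setT (fh i) by exact: measurable_fun_ifT.
have fl0 i x : 0 <= fl i x by rewrite /fl; case: ifP.
have fh0 i x : 0 <= fh i x by rewrite /fh; case: ifP.
have hE i x : phi x = fl i x + fh i x by rewrite /fl /fh; case: ifP; rewrite ?addr0 ?add0r.
have V0 i : 0 < vol l0 i by exact: vol_gt0.
have L0 i : 0 < side l0 i by exact: side_gt0.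
(* Jensen and the normalization of phi: averages at volume v are at most
   v^(-1/P). *)
have small i z : (cavg (side l0 i) phi z <= (vol l0 i `^ (- P^-1))%:E)%E.
  rewrite cavgE//.
  have fQ := @fat_hcube R n (z, side l0 i) (L0 i).
  apply: (le_trans (pmean_mono (a := P) fQ mp p0 _)); first by rewrite ltr01 ltW.
  rewrite /pmean fine_leb_hcube//= -/(vol l0 i).
  have -> : (vol l0 i `^ (- P^-1))%:E = ((((vol l0 i)^-1)%:E * 1) `^ P^-1)%E.
    rewrite mule1 poweR_EFin; congr _%:E.
    by rewrite -[(vol l0 i)^-1]powR_inv1 ?(ltW (V0 i))// -powRrM mulN1r.
  apply: gt0_ler_poweR; first by rewrite invr_ge0 ltW.
  - by rewrite in_itv/= leey andbT mule_ge0 ?pint_ge0// lee_fin invr_ge0 ltW.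
  - by rewrite in_itv/= leey andbT mule1 lee_fin invr_ge0 ltW.
  rewrite lee_wpmul2l ?lee_fin ?invr_ge0 ?(ltW (V0 i))//.
  apply: le_trans hphi; apply: ge0_subset_integral => //.
  - exact: measurable_hcube.
  - exact/measurable_EFinP.
  - by move=> x _; rewrite lee_fin powR_ge0.
have high i z : ((vol l0 i `^ (B / P - 1))%:E * (cavg (side l0 i) (fh i) z `^ B) <=
   (vol l0 i `^ (- (1 - P^-1)))%:E * cavg (side l0 i) (fh i) z)%E.
  have c0 : (0 <= cavg (side l0 i) (fh i) z)%E by apply: cavg_ge0 => //; exact: ltW.
  have cle : ((vol l0 i `^ P^-1)%:E * cavg (side l0 i) (fh i) z <= 1)%E.
    apply: (@le_trans _ _ ((vol l0 i `^ P^-1)%:E * (vol l0 i `^ (- P^-1))%:E)%E); last first.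
      by rewrite -EFinM powRN mulfV// gt_eqF// powR_gt0.
    rewrite lee_wpmul2l ?lee_fin ?powR_ge0//; apply: le_trans (small i z).
    rewrite lee_wpmul2l ?lee_fin ?invr_ge0 ?exprn_ge0 ?(ltW (L0 i))//.
    apply: ge0_le_integral => //.
    - exact: measurable_hcube.
    - by move=> x _; rewrite lee_fin.
    - by apply/measurable_EFinP; exact: measurable_funS (mfh i).
    - by apply/measurable_EFinP; exact: measurable_funS mp.
    - by move=> x _; rewrite lee_fin (hE i) lerDr.
  have B1 : 1 <= B by lra.
  have v0 : (0 <= (vol l0 i `^ P^-1)%:E)%E by rewrite lee_fin powR_ge0.
  have := poweR_le1 B1 (mule_ge0 v0 c0) cle.
  rewrite poweRM// poweR_EFin -powRrM => h.
  have vn : vol l0 i != 0 by rewrite gt_eqF.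
  have -> : vol l0 i `^ (B / P - 1) = vol l0 i `^ (-1) * vol l0 i `^ (P^-1 * B).
    by rewrite -powRD ?vn ?implybT//; congr (_ `^ _); ring.
  have -> : vol l0 i `^ (- (1 - P^-1)) = vol l0 i `^ (-1) * vol l0 i `^ P^-1.
    by rewrite -powRD ?vn ?implybT//; congr (_ `^ _); ring.
  by rewrite !EFinM -!muleA lee_wpmul2l// lee_fin powR_ge0.
have mcav f i : measurable_fun setT f -> (forall x, 0 <= f x) ->
    measurable_fun setT (fun z => cavg (side l0 i) f z).
  by move=> mf f0; exact: measurable_cavg.
have mcavB f i : measurable_fun setT f -> (forall x, 0 <= f x) ->
    measurable_fun setT (fun z => cavg (side l0 i) f z `^ B)%E.
  by move=> mf f0; exact: (measurableT_comp (@measurable_poweR R B) (mcav f i mf f0)).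
have term i : ((vol l0 i `^ (B / P - 1))%:E * \int[leb]_z (cavg (side l0 i) phi z `^ B) <=
   (2 `^ B)%:E * (\int[leb]_x (vol l0 i `^ (B / P - 1) * fl i x `^ B)%:E +
    \int[leb]_x (vol l0 i `^ (- (1 - P^-1)) * fh i x)%:E))%E.
  have vb0 r : 0 <= vol l0 i `^ r by exact: powR_ge0.
  rewrite -ge0_integralZl//; last 3 first.
  - exact: mcavB.
  - by move=> z _; exact: poweR_ge0.
  - by rewrite lee_fin.
  apply: (@le_trans _ _ (\int[leb]_z ((2 `^ B)%:E *
     ((vol l0 i `^ (B / P - 1))%:E * cavg (side l0 i) (fun x => fl i x `^ B)%R z +
     (vol l0 i `^ (- (1 - P^-1)))%:E * cavg (side l0 i) (fh i) z)))%E).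
    apply: ge0_le_integral => //.
    - by move=> z _; rewrite mule_ge0 ?poweR_ge0 ?lee_fin.
    - by apply: emeasurable_funM => //; exact: mcavB.
    - apply: emeasurable_funM => //; apply: emeasurable_funD; apply: emeasurable_funM => //.
        by apply: mcav => [|x]; [exact: measurable_powR_comp|exact: powR_ge0].
      exact: mcav.
    move=> z _.
    have := @cavgD_le (side l0 i) (fl i) (fh i) phi z B (L0 i) B0 (mfl i) (mfh i) (fl0 i) (fh0 i) (hE i).
    move=> /(lee_wpmul2l (vb0 (B / P - 1) : (0 <= _%:E)%E)) /le_trans; apply.
    rewrite muleCA lee_wpmul2l ?lee_fin ?powR_ge0//.
    rewrite ge0_muleDr ?poweR_ge0//; apply: leeD; last exact: high.
    rewrite lee_wpmul2l ?lee_fin//; apply: cavg_pow_le => //; lra.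
  have cl0 z : (0 <= cavg (side l0 i) (fun x => fl i x `^ B)%R z)%E.
    by apply: cavg_ge0 => [|x]; [exact: ltW|exact: powR_ge0].
  have ch0 z : (0 <= cavg (side l0 i) (fh i) z)%E by apply: cavg_ge0 => //; exact: ltW.
  have mcl := mcav (fun x => fl i x `^ B) i (measurable_powR_comp B (mfl i)) (fun x => powR_ge0 _ _).
  have mch := mcav (fh i) i (mfh i) (fh0 i).
  rewrite ge0_integralZl//; last 2 first.
  - by apply: emeasurable_funD; exact: emeasurable_funM.
  - by move=> z _; rewrite adde_ge0// mule_ge0// lee_fin.
  rewrite lee_wpmul2l ?lee_fin ?powR_ge0//.
  rewrite ge0_integralD//; last 4 first.
  - by move=> z _; rewrite mule_ge0// lee_fin.
  - exact: emeasurable_funM.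
  - by move=> z _; rewrite mule_ge0// lee_fin.
  - exact: emeasurable_funM.
  have Zc (k : R) (F : V -> \bar R) : 0 <= k -> measurable_fun setT F ->
      (forall z, (0 <= F z)%E) -> (\int[leb]_z (k%:E * F z) = k%:E * \int[leb]_z F z)%E.
    by move=> k0 mF F0; rewrite ge0_integralZl.
  have mE f : measurable_fun setT f -> measurable_fun setT (EFin \o f).
    by move=> mf; exact/measurable_EFinP.
  rewrite (Zc _ _ (vb0 _) mcl cl0) (Zc _ _ (vb0 _) mch ch0).
  rewrite (integral_cavg (L0 i) (measurable_powR_comp B (mfl i)) (fun x => powR_ge0 _ _)).
  rewrite (integral_cavg (L0 i) (mfh i) (fh0 i)).
  rewrite -(Zc _ _ (vb0 _) (mE _ (measurable_powR_comp B (mfl i)))); last first.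
    by move=> x; rewrite lee_fin powR_ge0.
  rewrite -(Zc _ _ (vb0 _) (mE _ (mfh i))); last by move=> x; rewrite lee_fin.
  exact: lexx.
apply: (@le_trans _ _ (\sum_(i < m) ((2 `^ B)%:E *
   (\int[leb]_x (vol l0 i `^ (B / P - 1) * fl i x `^ B)%:E +
    \int[leb]_x (vol l0 i `^ (- (1 - P^-1)) * fh i x)%:E)))%E).
  by apply: lee_sum => i _; exact: term.
rewrite -ge0_sume_distrr; last first.
  move=> i _; rewrite adde_ge0//; apply: integral_ge0 => x _.
    by rewrite lee_fin mulr_ge0 ?powR_ge0.
  by rewrite lee_fin mulr_ge0 ?powR_ge0.
rewrite big_split/= -!ge0_integral_sum//; last 4 first.
- by move=> i; apply/measurable_EFinP; exact: measurable_funM.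
- by move=> i x _; rewrite lee_fin mulr_ge0 ?powR_ge0.
- by move=> i; apply/measurable_EFinP; apply: measurable_funM => //; exact: measurable_powR_comp.
- by move=> i x _; rewrite lee_fin mulr_ge0 ?powR_ge0.
rewrite /C EFinM lee_wpmul2l ?lee_fin ?powR_ge0// EFinD.
have bound (F : V -> R) (k : R) : 0 < k -> measurable_fun setT F -> (forall x, 0 <= F x) ->
    (forall x, F x <= k * phi x `^ P) -> (\int[leb]_x (F x)%:E <= k%:E)%E.
  move=> k0 mF F0 hF; rewrite -[leRHS]mule1.
  apply: (@le_trans _ _ (k%:E * \int[leb]_x (phi x `^ P)%:E)%E); last first.
    by rewrite lee_wpmul2l// lee_fin ltW.
  rewrite -ge0_integralZl//; last 3 first.
  - exact/measurable_EFinP.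
  - by move=> x _; rewrite lee_fin powR_ge0.
  - by rewrite lee_fin ltW.
  apply: ge0_le_integral => //.
  - by move=> x _; rewrite lee_fin.
  - exact/measurable_EFinP.
  - by apply: emeasurable_funM => //; exact/measurable_EFinP.
  - by move=> x _; rewrite -EFinM lee_fin.
have Elo i x : 0 < phi x -> lo i x = (vol l0 i <= phi x `^ (- P)).
  by move=> x0; rewrite /lo powRN -[in RHS]div1r ler_pdivlMr// powR_gt0.
apply: leeD.
- under eq_integral do rewrite sumEFin.
  apply: bound => //.
  + by apply: measurable_sum => i; apply: measurable_funM => //; exact: measurable_powR_comp.
  + by move=> x; apply: sumr_ge0 => i _; rewrite mulr_ge0 ?powR_ge0.
  move=> x; have := p0 x; rewrite le_eqVlt => /predU1P[x0|x0].
    rewrite big1 ?mulr_ge0 ?powR_ge0 ?(ltW C10)// => i _.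
    by rewrite /fl -x0; case: ifP => _; rewrite powR0 ?mulr0// gt_eqF.
  have := hC1 m (l0 ^+ n) (phi x `^ (- P)) (exprn_gt0 n l00).
  move=> /(ler_wpM2r (powR_ge0 (phi x) B)).
  rewrite mulr_suml => h; apply: (@le_trans _ _ (C1 * (phi x `^ (- P)) `^ (B / P - 1) * phi x `^ B)).
    apply: le_trans h; rewrite big_mkcond/= [leRHS]big_mkcond/=; apply: ler_sum => i _.
    rewrite -volE -Elo// /fl.
    by case: ifP => // _; rewrite powR0 ?mulr0// gt_eqF.
  rewrite -mulrA -powRrM -powRD ?(gt_eqF x0) ?implybT//.
  rewrite (_ : - P * (B / P - 1) + B = P)//.
  by field; rewrite gt_eqF.
- under eq_integral do rewrite sumEFin.
  apply: bound => //.
  + by apply: measurable_sum => i; exact: measurable_funM.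
  + by move=> x; apply: sumr_ge0 => i _; rewrite mulr_ge0 ?powR_ge0.
  move=> x; have := p0 x; rewrite le_eqVlt => /predU1P[x0|x0].
    rewrite big1 ?mulr_ge0 ?powR_ge0 ?(ltW C20)// => i _.
    by rewrite /fh -x0; case: ifP => _; rewrite mulr0.
  have := hC2 m (l0 ^+ n) (phi x `^ (- P)) (exprn_gt0 n l00) (powR_gt0 _ x0).
  move=> /(ler_wpM2r (ltW x0)).
  rewrite mulr_suml => h; apply: (@le_trans _ _ (C2 * (phi x `^ (- P)) `^ (- (1 - P^-1)) * phi x)).
    apply: le_trans h; rewrite big_mkcond/= [leRHS]big_mkcond/=; apply: ler_sum => i _.
    rewrite -volE ltNge -Elo// /fh.
    by case: ifP => //=; rewrite mulr0.
  rewrite -mulrA -powRrM -[X in _ * (_ * X)](powRr1 (ltW x0)) -powRD ?(gt_eqF x0) ?implybT//.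
  rewrite (_ : - P * (- (1 - P^-1)) + 1 = P)//.
  by field; rewrite gt_eqF.
Qed.

End scale_sum.

(** * Bilinear sums and averages over cubes *)

Section bilinear.
Context {R : realType} {n : nat}.
Hypothesis n0 : (0 < n)%N.
Local Notation leb := (@lebesgue_rV R n).
Local Notation V := ('rV[R]_n).
Implicit Types (x y z : V) (f g F G : V -> R).

Lemma youngE (a b : R) (X Y : \bar R) : 1 < a -> 1 < b -> a^-1 + b^-1 = 1 ->
  (0 <= X -> 0 <= Y -> X * Y <= X `^ a + Y `^ b)%E.
Proof.
move=> a1 b1 ab X0 Y0; have a0 : 0 < a by lra. have b0 : 0 < b by lra.
have [->|Xoo] := eqVneq X +oo%E.
  by rewrite poweRyr ?gt_eqF// addye ?leey// gt_eqF// (lt_le_trans _ (poweR_ge0 _ _)).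
have [->|Yoo] := eqVneq Y +oo%E.
  by rewrite poweRyr ?gt_eqF// addey ?leey// gt_eqF// (lt_le_trans _ (poweR_ge0 _ _)).
case: X Y X0 Y0 Xoo Yoo => [x| |]// [y| |]//; rewrite !lee_fin => x0 y0 _ _.
apply: le_trans (conjugate_powR x0 y0 a0 b0 ab) _.
by apply: lerD; rewrite ler_pdivrMr ?a0 ?b0// ler_peMr ?powR_ge0// ltW.
Qed.

Lemma youngE_scaled (a b k1 k2 k3 : R) (X Y : \bar R) : 1 < a -> 1 < b ->
  a^-1 + b^-1 = 1 -> 0 <= k1 -> 0 <= k2 -> 0 <= k3 -> (0 <= X -> 0 <= Y ->
  (k3 * (k1 * k2))%:E * (X * Y) <=
  (k3 * k1 `^ a)%:E * X `^ a + (k3 * k2 `^ b)%:E * Y `^ b)%E.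
Proof.
move=> a1 b1 ab k10 k20 k30 X0 Y0.
have h := @youngE a b (k1%:E * X) (k2%:E * Y) a1 b1 ab.
rewrite !EFinM -!muleA -ge0_muleDr ?mule_ge0 ?poweR_ge0 ?lee_fin ?powR_ge0//.
apply: lee_wpmul2l; first by rewrite lee_fin.
rewrite -!poweR_EFin -!poweRM ?lee_fin// (muleCA k2%:E) muleA.
by apply: h; rewrite mule_ge0.
Qed.

Lemma pmean_cavg r l F z : 0 < l -> pmean leb r (hcube (z, l)) F =
  (cavg l (fun x => F x `^ r)%R z `^ r^-1)%E.
Proof. by move=> l0; rewrite /pmean fine_leb_hcube. Qed.

Lemma measurable_pmean r l F : 0 < l -> measurable_fun setT F ->
  measurable_fun setT (fun z => pmean leb r (hcube (z, l)) F).
Proof.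
move=> l0 mF; under eq_fun do rewrite pmean_cavg//.
apply: (measurableT_comp (@measurable_poweR R r^-1)).
by apply: measurable_cavg => [|x]; [exact: measurable_powR_comp|exact: powR_ge0].
Qed.

(** The previous estimate for F^r, with P = p/r > 1. *)
Lemma scale_sum_pmean (r p a : R) : 0 < r -> r < p -> p < a ->
  exists2 C : R, 0 < C & forall (m : nat) (l0 : R) F, 0 < l0 ->
    measurable_fun setT F -> (forall x, 0 <= F x) ->
    (\int[leb]_x (F x `^ p)%:E <= 1)%E ->
    (\sum_(i < m) (vol (n := n) l0 i `^ (a / p - 1))%:E *
        \int[leb]_z (pmean leb r (hcube (z, side l0 i)) F `^ a) <= C%:E)%E.
Proof.
move=> r0 rp pa; have p0 : 0 < p by lra.
have rn : r != 0 by rewrite gt_eqF.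
have P1 : 1 < p / r by rewrite ltr_pdivlMr// mul1r.
have PB : p / r < a / r by rewrite ltr_pM2r// invr_gt0.
have [C C0 hC] := @scale_sum R n n0 _ _ P1 PB.
exists C => // m l0 F l00 mF F0 hF.
have := hC m l0 (fun x => F x `^ r) l00 (measurable_powR_comp r mF) (fun x => powR_ge0 _ _).
have -> : (\int[leb]_x ((F x `^ r) `^ (p / r))%:E = \int[leb]_x (F x `^ p)%:E)%E.
  by apply: eq_integral => x _; rewrite -powRrM mulrC divfK.
move=> /(_ hF); apply: le_trans; apply: lee_sum => i _.
have -> : a / r / (p / r) = a / p by field; rewrite rn gt_eqF.
rewrite lee_wpmul2l ?lee_fin ?powR_ge0// le_eqVlt; apply/orP; left; apply/eqP.
apply: eq_integral => z _; rewrite pmean_cavg ?side_gt0// -poweRrM.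
by rewrite mulrC.
Qed.

(** Young with exponents a > p and b > q', 1/a + 1/b = 1, at each scale and
    each corner z. There is room for such a and b because 1/p + 1/q' > 1; the
    powers of the volume are distributed so that each factor falls under the
    one-function estimate. *)
Lemma bilinear_scale_sum (p q' r s : R) : 1 < p -> 1 < q' -> 1 < p^-1 + q'^-1 ->
  0 < r -> r < p -> 0 < s -> s < q' ->
  exists2 C : R, 0 < C & forall (m : nat) (l0 : R) F G, 0 < l0 ->
    measurable_fun setT F -> (forall x, 0 <= F x) ->
    measurable_fun setT G -> (forall x, 0 <= G x) ->
    (\int[leb]_x (F x `^ p)%:E <= 1)%E -> (\int[leb]_x (G x `^ q')%:E <= 1)%E ->
    (\sum_(i < m) (vol (n := n) l0 i `^ (p^-1 + q'^-1 - 1))%:E *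
        \int[leb]_z (pmean leb r (hcube (z, side l0 i)) F *
                     pmean leb s (hcube (z, side l0 i)) G) <= C%:E)%E.
Proof.
move=> p1 q1 pq r0 rp s0 sq.
have p0 : 0 < p by lra. have q0 : 0 < q' by lra.
(* The midpoint of the interval from 1 - 1/q' to 1/p, which is nonempty
   because 1/p + 1/q' > 1. *)
pose ai := (p^-1 + 1 - q'^-1) / 2.
have pi1 : p^-1 < 1 by rewrite invf_lt1.
have qi1 : q'^-1 < 1 by rewrite invf_lt1.
have pi0 : 0 < p^-1 by rewrite invr_gt0.
have qi0 : 0 < q'^-1 by rewrite invr_gt0.
have ai0 : 0 < ai by rewrite /ai; lra.
have aip : ai < p^-1 by rewrite /ai; lra.
have bi0 : 0 < 1 - ai by rewrite /ai; lra.
have biq : 1 - ai < q'^-1 by rewrite /ai; lra.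
pose a := ai^-1; pose b := (1 - ai)^-1.
have a0 : 0 < a by rewrite invr_gt0.
have b0 : 0 < b by rewrite invr_gt0.
have pa : p < a by rewrite -(invrK p) ltf_pV2 ?posrE.
have qb : q' < b by rewrite -(invrK q') ltf_pV2 ?posrE.
have ab : a^-1 + b^-1 = 1 by rewrite /a /b !invrK; lra.
have a1 : 1 < a by lra. have b1 : 1 < b by lra.
have [C1 C10 h1] := scale_sum_pmean r0 rp pa.
have [C2 C20 h2] := scale_sum_pmean s0 sq qb.
exists (C1 + C2); first exact: addr_gt0.
move=> m l0 F G l00 mF F0 mG G0 hF hG.
rewrite EFinD; apply: (le_trans _ (leeD (h1 m l0 F l00 mF F0 hF) (h2 m l0 G l00 mG G0 hG))).
rewrite -big_split/=; apply: lee_sum => i _.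
have L0 := side_gt0 i l00; set v := vol l0 i; have v0 : 0 < v by exact: vol_gt0.
have vn : v != 0 by rewrite gt_eqF.
pose X z := pmean leb r (hcube (z, side l0 i)) F.
pose Y z := pmean leb s (hcube (z, side l0 i)) G.
have mX : measurable_fun setT X by exact: measurable_pmean.
have mY : measurable_fun setT Y by exact: measurable_pmean.
have X0 z : (0 <= X z)%E by exact: pmean_ge0.
have Y0 z : (0 <= Y z)%E by exact: pmean_ge0.
have mP (H : V -> \bar R) t : measurable_fun setT H -> measurable_fun setT (fun z => H z `^ t)%E.
  by move=> mH; exact: (measurableT_comp (@measurable_poweR R t) mH).
have Zc (k : R) (H : V -> \bar R) : measurable_fun setT H ->
    (forall z, (0 <= H z)%E) -> (\int[leb]_z ((v `^ k)%:E * H z) = (v `^ k)%:E * \int[leb]_z H z)%E.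
  by move=> mH H0; rewrite ge0_integralZl// lee_fin powR_ge0.
rewrite -(Zc _ (fun z => X z * Y z)%E); last 2 first.
- exact: emeasurable_funM.
- by move=> z; rewrite mule_ge0.
rewrite -(Zc _ (fun z => X z `^ a)%E (mP _ _ mX) (fun z => poweR_ge0 _ _)).
rewrite -(Zc _ (fun z => Y z `^ b)%E (mP _ _ mY) (fun z => poweR_ge0 _ _)).
have mvX : measurable_fun setT (fun z => ((v `^ (a / p - 1))%:E * X z `^ a)%E).
  by apply: emeasurable_funM => //; exact: mP.
have mvY : measurable_fun setT (fun z => ((v `^ (b / q' - 1))%:E * Y z `^ b)%E).
  by apply: emeasurable_funM => //; exact: mP.
rewrite -ge0_integralD//; last 2 first.
- by move=> z _; rewrite mule_ge0 ?poweR_ge0// lee_fin powR_ge0.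
- by move=> z _; rewrite mule_ge0 ?poweR_ge0// lee_fin powR_ge0.
apply: ge0_le_integral => //.
- by move=> z _; rewrite mule_ge0 ?mule_ge0// lee_fin powR_ge0.
- by apply: emeasurable_funM => //; exact: emeasurable_funM.
- exact: emeasurable_funD.
move=> z _.
have e1 : v `^ (p^-1 + q'^-1 - 1) = v `^ (-1) * (v `^ p^-1 * v `^ q'^-1).
  by rewrite -!powRD ?vn ?implybT//; congr (_ `^ _); ring.
have e2 : v `^ (a / p - 1) = v `^ (-1) * (v `^ p^-1) `^ a.
  by rewrite -powRrM -powRD ?vn ?implybT//; congr (_ `^ _); ring.
have e3 : v `^ (b / q' - 1) = v `^ (-1) * (v `^ q'^-1) `^ b.
  by rewrite -powRrM -powRD ?vn ?implybT//; congr (_ `^ _); ring.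
by rewrite e1 e2 e3; apply: youngE_scaled => //; exact: powR_ge0.
Qed.

Definition near_set (l : R) : set (V * V) :=
  [set p : V * V | forall i, `|p.1 ord0 i - p.2 ord0 i| <= l].

Lemma measurable_near_set l : measurable (near_set l).
Proof.
rewrite (_ : near_set l = \bigcap_(i in [set: 'I_n])
  [set p : V * V | `]-oo, l]%classic `|p.1 ord0 i - p.2 ord0 i|]).
  apply: fin_bigcap_measurable => // i _; rewrite -[X in measurable X]setTI.
  have mf : measurable_fun setT (fun p : V * V => `|p.1 ord0 i - p.2 ord0 i|).
    apply: measurableT_comp => //; apply: measurable_funB.
      by have /= := measurableT_comp (@measurable_coord _ R n i)
        (@measurable_fst _ _ V V).
    by have /= := measurableT_comp (@measurable_coord _ R n i)
      (@measurable_snd _ _ V V).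
  by apply: mf => //; exact: measurable_itv.
apply/seteqP; split => [p h i _|p h i] /=.
  by have := h i; rewrite /= in_itv.
by have := h i I; rewrite /= in_itv.
Qed.

(** Triples ((z, x), y) with x and y in the cube with corner z. Measurability
    in z of the double integral over that cube follows from Fubini on this
    set. *)
Definition in_hcube2 (l : R) : set ((V * V) * V) :=
  [set w | hcube (w.1.1, l) w.1.2 /\ hcube (w.1.1, l) w.2].

Lemma measurable_in_hcube2 l : measurable (in_hcube2 l).
Proof.
have mfst := @measurable_fst _ _ (V * V)%type V.
have msnd := @measurable_snd _ _ (V * V)%type V.
have mw1 : measurable_fun setT (fun w : (V * V) * V => w.1.1).
  exact: (measurableT_comp (@measurable_fst _ _ V V) mfst).
have mw2 : measurable_fun setT (fun w : (V * V) * V => w.1.2).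
  exact: (measurableT_comp (@measurable_snd _ _ V V) mfst).
pose S := [set p : V * V | hcube (p.1, l) p.2].
have mS : measurable S := measurable_in_hcube l.
rewrite (_ : in_hcube2 l = (fun w : (V * V) * V => (w.1.1, w.1.2)) @^-1` S `&`
  (fun w : (V * V) * V => (w.1.1, w.2)) @^-1` S)//.
apply: measurableI; rewrite -[X in measurable X]setTI.
  have : measurable_fun setT (fun w : (V * V) * V => (w.1.1, w.1.2)).
    exact: measurable_fun_pair.
  by apply.
have : measurable_fun setT (fun w : (V * V) * V => (w.1.1, w.2)).
  exact: measurable_fun_pair.
by apply.
Qed.

Section hcube_iint.
Variables (l : R) (u : V * V -> \bar R).
Hypotheses (mu : measurable_fun setT u) (u0 : forall p, (0 <= u p)%E).

Let U2 (w : (V * V) * V) := (u (w.1.2, w.2) * (\1_(in_hcube2 l) w)%:E)%E.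

Lemma measurable_in_hcube2M : measurable_fun setT U2.
Proof.
apply: emeasurable_funM.
  have mp : measurable_fun setT (fun w : (V * V) * V => (w.1.2, w.2)).
    apply: measurable_fun_pair; last exact: (@measurable_snd _ _ (V * V)%type V).
    exact: (measurableT_comp (@measurable_snd _ _ V V) (@measurable_fst _ _ (V * V)%type V)).
  exact: (measurableT_comp mu mp).
by apply/measurable_EFinP; apply: measurable_indic; exact: measurable_in_hcube2.
Qed.

Let U20 w : (0 <= U2 w)%E. Proof. by rewrite mule_ge0// lee_fin. Qed.

Lemma measurable_in_hcube2_int : measurable_fun setT (fun p : V * V => \int[leb]_y U2 (p, y))%E.
Proof.
exact: (@measurable_fun_fubini_tonelli_F _ _ (V * V)%type V R leb U2 measurable_in_hcube2M U20).
Qed.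

Lemma hcube_iintE z : (\int[leb]_(x in hcube (z, l)) \int[leb]_(y in hcube (z, l)) u (x, y) =
   \int[leb]_x \int[leb]_y (u (x, y) * (\1_(in_hcube2 l) ((z, x), y))%:E))%E.
Proof.
rewrite [LHS]integral_mkcond; apply: eq_integral => x _; rewrite patchE.
case: ifPn => xQ.
  rewrite [LHS]integral_mkcond; apply: eq_integral => y _; rewrite patchE indicE.
  have -> : (((z, x), y) \in in_hcube2 l) = (y \in hcube (z, l)).
    by apply: asbool_equiv_eq; split => [[]//|h]; split => //; exact: set_mem.
  by case: ifP => _; rewrite ?mule1 ?mule0.
rewrite integral0_eq// => y _; rewrite indicE memNset ?mule0//.
by move=> [/= h _]; move/negP: xQ; apply; exact: mem_set.
Qed.

Lemma measurable_hcube_iint : measurable_fun setT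
  (fun z => \int[leb]_(x in hcube (z, l)) \int[leb]_(y in hcube (z, l)) u (x, y))%E.
Proof.
under eq_fun do rewrite hcube_iintE.
apply: (@measurable_fun_fubini_tonelli_F _ _ V V R leb _ measurable_in_hcube2_int) => p.
exact: integral_ge0.
Qed.

End hcube_iint.

(** If x and y differ by at most l in each coordinate, the corners z for which
    the cube of side 2 l contains both points form a set of measure at least
    l^n. The rest is Tonelli. *)
Lemma near_average (l : R) (u : V * V -> \bar R) : 0 < l ->
  measurable_fun setT u -> (forall p, (0 <= u p)%E) ->
  ((l ^+ n)%:E * \int[leb]_x \int[leb]_y (u (x, y) * (\1_(near_set l) (x, y))%:E) <=
   \int[leb]_z \int[leb]_(x in hcube (z, (2 * l)%R))
      \int[leb]_(y in hcube (z, (2 * l)%R)) u (x, y))%E.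
Proof.
move=> l0 mu u0; have l20 : 0 < 2 * l by rewrite mulr_gt0.
pose T := in_hcube2 (2 * l).
pose U2 (w : (V * V) * V) := (u (w.1.2, w.2) * (\1_T w)%:E)%E.
have mU2 : measurable_fun setT U2 by exact: measurable_in_hcube2M.
have U20 w : (0 <= U2 w)%E by rewrite mule_ge0// lee_fin.
pose F (p : V * V) := (\int[leb]_y U2 (p, y))%E.
have mF : measurable_fun setT F by exact: measurable_in_hcube2_int.
have F0 p : (0 <= F p)%E by exact: integral_ge0.
have E1 z : (\int[leb]_(x in hcube (z, (2 * l)%R)) \int[leb]_(y in hcube (z, (2 * l)%R)) u (x, y) =
   \int[leb]_x F (z, x))%E by exact: hcube_iintE.
rewrite [leRHS](eq_integral _ _ (fun z _ => E1 z)).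
rewrite (@fubini_tonelli _ _ V V R leb leb F mF F0).
have muN : measurable_fun setT (fun p : V * V => (u p * (\1_(near_set l) p)%:E)%E).
  by apply: emeasurable_funM => //; apply/measurable_EFinP; apply: measurable_indic; exact: measurable_near_set.
have uN0 (p : V * V) : (0 <= u p * (\1_(near_set l) p)%:E)%E by rewrite mule_ge0// lee_fin.
have mN := @measurable_fun_fubini_tonelli_F _ _ V V R leb _ muN uN0.
have ln0 : (0 <= (l ^+ n)%:E)%E by rewrite lee_fin exprn_ge0// ltW.
rewrite -ge0_integralZl//; last by move=> x _; exact: integral_ge0.
apply: ge0_le_integral => //.
- by move=> x _; rewrite mule_ge0// integral_ge0.
- exact: emeasurable_funM.
- exact: (@measurable_fun_fubini_tonelli_G _ _ V V R leb F mF F0).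
move=> x _.
have mzy : measurable_fun setT (fun p : V * V => U2 ((p.1, x), p.2)).
  have mp : measurable_fun setT (fun p : V * V => ((p.1, x), p.2)).
    apply: measurable_fun_pair; last exact: (@measurable_snd _ _ V V).
    by apply: measurable_fun_pair => //; exact: (@measurable_fst _ _ V V).
  exact: (measurableT_comp mU2 mp).
have Uzy0 (p : V * V) : (0 <= U2 ((p.1, x), p.2))%E by exact: U20.
rewrite [leRHS](@fubini_tonelli _ _ V V R leb leb _ mzy Uzy0)/=.
have mNx : measurable_fun setT (fun y => (u (x, y) * (\1_(near_set l) (x, y))%:E)%E).
  exact: (measurableT_comp muN (@measurable_pair1 _ _ V V x)).
rewrite -ge0_integralZl//.
apply: ge0_le_integral => //.
- by move=> y _; rewrite mule_ge0.
- exact: emeasurable_funM.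
- exact: (@measurable_fun_fubini_tonelli_G _ _ V V R leb _ mzy Uzy0).
move=> y _; rewrite /U2/=.
have mTz : measurable [set z | T ((z, x), y)].
  rewrite (_ : [set _ | _] = [set z | hcube (z, 2 * l) x] `&` [set z | hcube (z, 2 * l) y])//.
  by apply: measurableI; exact: measurable_corner.
have TE z : (\1_T ((z, x), y) : R) = \1_[set z | T ((z, x), y)] z.
  by rewrite !indicE; congr (_%:R); apply: asbool_equiv_eq.
rewrite ge0_integralZl//; last first.
  apply/measurable_EFinP; under eq_fun do rewrite TE.
  exact: measurable_indic.
rewrite muleCA lee_wpmul2l//.
have -> : (\int[leb]_z (\1_T ((z, x), y))%:E = leb [set z | T ((z, x), y)])%E.
  by under eq_integral do rewrite TE; rewrite integral_indic// setIT.
rewrite indicE; have [/set_mem pN|_] := boolP ((x, y) \in near_set l); last by rewrite mule0.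
rewrite mule1.
(* Every z with coordinates in these intervals of length l is the corner of a
   cube of side 2 l that contains x and y. *)
pose J i : set R := `]Num.max (x ord0 i) (y ord0 i) - 2 * l,
  Num.max (x ord0 i) (y ord0 i) - l]%classic.
have mJ i : measurable (J i) by exact: measurable_itv.
apply: (@le_trans _ _ (leb [set z | forall i, J i (z ord0 i)])).
  rewrite (@leb_itv_prod _ _ J l)// => i.
  rewrite lebesgue_measure_itv/= lte_fin ltrD2l ltrN2 ltr_pMl ?ltr1n// -EFinD.
  by congr _%:E; ring.
apply: le_leb => //; first exact: measurable_box.
move=> z h; split => i; have := h i; rewrite /J /= in_itv/=; have := pN i;
  rewrite /= ler_norml; case: (leP (x ord0 i) (y ord0 i)) => ? /andP[? ?] /andP[? ?];
  apply/andP; split; lra.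
Qed.

End bilinear.

(** * Duality and iterated integrals *)

Section duality.
Context {R : realType} {n : nat}.
Local Notation leb := (@lebesgue_rV R n).
Local Notation V := ('rV[R]_n).
Implicit Types (x y z : V) (f g F G : V -> R).

Definition cball (j : nat) : set V := hcube (const_mx (- (j.+1%:R : R)), 2 * j.+1%:R).

Lemma cball_near x : \forall j \near \oo, cball j x.
Proof.
pose N := (\sum_(i < n) (Num.truncn `|x ord0 i|).+1)%N.
exists N => // j /= Nj i /=; rewrite mxE.
have h : `|x ord0 i| < j.+1%:R.
  apply: (@lt_le_trans _ _ (Num.truncn `|x ord0 i|).+1%:R); first exact: truncnS_gt.
  rewrite ler_nat; apply: leq_trans (leqW Nj).
  by rewrite /N (bigD1 i)//= leq_addr.
by move: h; rewrite ltr_norml => /andP[h1 h2]; apply/andP; split; lra.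
Qed.

(** The converse of the Hoelder inequality for k with values in [0, +oo]. It
    is applied to truncations of k by the constant j and by a bounded cube,
    whose q-th power is integrable, with the extremal G; then j tends to
    infinity. *)
Lemma dual_norm_le (q q' C : R) (k : V -> \bar R) : 1 < q -> q^-1 + q'^-1 = 1 -> 0 <= C ->
  measurable_fun setT k -> (forall x, (0 <= k x)%E) ->
  (forall G, measurable_fun setT G -> (forall x, 0 <= G x) ->
     (\int[leb]_x (G x `^ q')%:E <= 1 -> \int[leb]_x (k x * (G x)%:E) <= C%:E)%E) ->
  (\int[leb]_x (k x `^ q) <= (C `^ q)%:E)%E.
Proof.
move=> q1 qq C0 mk k0 hG; have q0 : 0 < q by lra.
have qi0 : 0 < q^-1 by rewrite invr_gt0.
have qi1 : q^-1 < 1 by rewrite invf_lt1.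
have q'0 : 0 < q' by rewrite -invr_gt0; lra.
have q'E : (q - 1) * q' = q.
  have -> : q' = q / (q - 1).
    rewrite -[q']invrK (_ : q'^-1 = 1 - q^-1); last by rewrite -qq addrAC subrr add0r.
    by field; rewrite !gt_eqF ?subr_gt0//=; lra.
  by rewrite mulrCA divff ?mulr1// gt_eqF; lra.
pose kj (j : nat) x : R := fine (mine (k x) j%:R%:E) * \1_(cball j) x.
have mkj j : measurable_fun setT (kj j).
  apply: measurable_funM; last by apply: measurable_indic; exact: measurable_hcube.
  apply: measurableT_comp => //; exact: measurable_mine.
have fmin (j : nat) x : mine (k x) j%:R%:E \is a fin_num.
  rewrite ge0_fin_numE; last by rewrite le_min k0/= lee_fin.
  by rewrite gt_min ltry orbT.
have kj0 j x : 0 <= kj j x.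
  by rewrite mulr_ge0// fine_ge0// le_min k0/= lee_fin.
have kjb j x : kj j x <= j%:R.
  rewrite /kj indicE; case: (_ \in _); rewrite ?mulr0// mulr1.
  by rewrite -lee_fin fineK// ge_min lexx orbT.
have kjk j x : ((kj j x)%:E <= k x)%E.
  rewrite /kj indicE; case: (_ \in _); rewrite ?mulr0// mulr1.
  by rewrite fineK// ge_min lexx.
have bound j : (\int[leb]_x (kj j x `^ q)%:E <= (C `^ q)%:E)%E.
  have mq : measurable_fun setT (fun x => kj j x `^ q) by exact: measurable_powR_comp.
  have Sfin : (\int[leb]_x (kj j x `^ q)%:E)%E \is a fin_num.
    rewrite ge0_fin_numE; last by apply: integral_ge0 => x _; rewrite lee_fin powR_ge0.
    apply: (@le_lt_trans _ _ (\int[leb]_x (j%:R `^ q * \1_(cball j) x)%:E)%E).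
      apply: ge0_le_integral => //.
      - by move=> x _; rewrite lee_fin powR_ge0.
      - exact/measurable_EFinP.
      - apply/measurable_EFinP/measurable_funM => //.
        by apply: measurable_indic; exact: measurable_hcube.
      move=> x _; rewrite lee_fin; have := kjb j x; have := kj0 j x; rewrite /kj indicE.
      case: (_ \in _); rewrite ?mulr0 ?mulr1 => h0 h1.
        by apply: ge0_ler_powR; rewrite ?nnegrE ?(ltW q0).
      by rewrite powR0// gt_eqF.
    under eq_integral do rewrite EFinM.
    have mB : measurable (cball j) by exact: measurable_hcube.
    rewrite ge0_integralZl_EFin ?powR_ge0//; last first.
      by apply/measurable_EFinP; exact: measurable_indic.
    rewrite integral_indic// setIT; apply: lte_mul_pinfty => //.
    by apply: leb_hcube_lty; rewrite mulr_gt0.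
  have [S0|S0] := leP (fine (\int[leb]_x (kj j x `^ q)%:E)%E) 0.
    by rewrite -(fineK Sfin) lee_fin (le_trans S0)// powR_ge0.
  move: S0; set S := fine _ => S0.
  have SE : (\int[leb]_x (kj j x `^ q)%:E)%E = S%:E by rewrite /S fineK.
  (* The extremal function of the Hoelder inequality, normalized in L^q'. *)
  pose G x := S `^ (- q'^-1) * kj j x `^ (q - 1).
  have mG : measurable_fun setT G.
    by apply: measurable_funM => //; exact: measurable_powR_comp.
  have G0 x : 0 <= G x by rewrite mulr_ge0 ?powR_ge0.
  have Z (c : R) : 0 <= c -> (\int[leb]_x (c * kj j x `^ q)%:E = (c * S)%:E)%E.
    move=> c0; under eq_integral do rewrite EFinM.
    rewrite ge0_integralZl_EFin// ?SE//.
    - by move=> x _; rewrite lee_fin powR_ge0.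
    - exact/measurable_EFinP.
  have hG1 : (\int[leb]_x (G x `^ q')%:E <= 1)%E.
    rewrite (_ : (\int[leb]_x (G x `^ q')%:E) = (S `^ (-1) * S)%:E)%E.
      by rewrite powR_inv1 ?(ltW S0)// mulVf// gt_eqF.
    rewrite -(Z _ (powR_ge0 _ _)); apply: eq_integral => x _.
    rewrite /G powRM ?powR_ge0// -!powRrM q'E mulNr mulVf//.
    by rewrite gt_eqF.
  have := hG G mG G0 hG1.
  have E2 : (S `^ q^-1)%:E = (\int[leb]_x ((kj j x)%:E * (G x)%:E))%E.
    transitivity (S `^ (- q'^-1) * S)%:E.
      congr _%:E; rewrite -[X in _ = _ * X](powRr1 (ltW S0)) -powRD ?(gt_eqF S0) ?implybT//.
      by congr (_ `^ _); lra.
    rewrite -(Z _ (powR_ge0 _ _)); apply: eq_integral => x _.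
    rewrite /G -EFinM mulrCA; congr (_ * _)%:E.
    have [->|kn] := eqVneq (kj j x) 0; first by rewrite powR0 ?gt_eqF// mul0r.
    by rewrite -[X in _ = X * _](powRr1 (kj0 j x)) -powRD ?kn ?implybT// subrKC.
  have h1 : (\int[leb]_x ((kj j x)%:E * (G x)%:E) <= \int[leb]_x (k x * (G x)%:E))%E.
    apply: ge0_le_integral => //.
    - by move=> x _; rewrite -EFinM lee_fin mulr_ge0.
    - by apply: emeasurable_funM; exact/measurable_EFinP.
    - by apply: emeasurable_funM => //; exact/measurable_EFinP.
    - by move=> x _; rewrite lee_wpmul2r// lee_fin.
  move=> /(le_trans h1); rewrite -E2 lee_fin => h2.
  rewrite SE lee_fin -(powRr1 (ltW S0)) -(mulVf (_ : q != 0)) ?gt_eqF//.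
  by rewrite powRrM; apply: ge0_ler_powR; rewrite ?nnegrE ?powR_ge0 ?(ltW q0).
have mF j : measurable_fun setT (fun x => (kj j x `^ q)%:E).
  by apply/measurable_EFinP; exact: measurable_powR_comp.
apply: (@le_trans _ _ (\int[leb]_x limn_einf (fun j => (kj j x `^ q)%:E))%E).
  apply: ge0_le_integral => //.
  - by move=> x _; exact: poweR_ge0.
  - exact: (measurableT_comp (@measurable_poweR R q) mk).
  - apply: (emeasurable_fun_cvg (fun m x => einfs (fun j => (kj j x `^ q)%:E) m)).
      by move=> m; exact: measurable_fun_einfs.
    by move=> x _; rewrite limn_einf_lim; exact: is_cvg_einfs.
  move=> x _.
  suff hl : ((kj j x `^ q)%:E @[j --> \oo] --> k x `^ q)%E by rewrite (cvg_limn_einf_sup hl).1.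
  have := k0 x; case kx : (k x) => [r| |]//.
  - rewrite lee_fin => r0; apply: cvg_near_cst.
    near=> j; rewrite /kj kx indicE mem_set ?mulr1; last by near: j; exact: cball_near.
    rewrite poweR_EFin; congr (_ `^ _)%:E.
    rewrite (_ : mine r%:E j%:R%:E = r%:E)//; apply/min_idPl.
    rewrite lee_fin; apply: ltW; near: j; exact: nbhs_infty_gtr.
  - move=> _; rewrite poweRyr ?gt_eqF//; apply/cvgeyPge => A.
    near=> j; rewrite /kj kx indicE mem_set ?mulr1; last by near: j; exact: cball_near.
    rewrite (_ : mine +oo j%:R%:E = j%:R%:E)%E/=; last by apply/min_idPr; rewrite leey.
    rewrite lee_fin; have j1 : 1 <= j%:R :> R by near: j; exact: nbhs_infty_ger.
    apply: (le_trans _ (le1r_powR j1 (ltW q1))).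
    by apply: ltW; near: j; exact: nbhs_infty_gtr.
apply: (le_trans (fatou _ _ _ _)) => //.
  by move=> j x _; rewrite lee_fin powR_ge0.
rewrite limn_einf_lim; apply: lime_le; first exact: is_cvg_einfs.
apply: nearW => j; apply: ge_ereal_inf.
exists (\int[leb]_x (kj j x `^ q)%:E)%E => //.
by exists j => /=.
Unshelve. all: end_near.
Qed.

Implicit Types u : V * V -> \bar R.

Definition iint u : \bar R := (\int[leb]_x \int[leb]_y u (x, y))%E.

Lemma measurable_inner u : measurable_fun setT u -> (forall p, (0 <= u p)%E) ->
  measurable_fun setT (fun x => \int[leb]_y u (x, y))%E.
Proof. by move=> mu u0; exact: (@measurable_fun_fubini_tonelli_F _ _ V V R leb u mu u0). Qed.

Lemma measurable_slice u x : measurable_fun setT u -> measurable_fun setT (fun y => u (x, y)).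
Proof. by move=> mu; exact: (measurableT_comp mu (@measurable_pair1 _ _ V V x)). Qed.

Lemma iint_le u v : measurable_fun setT u -> measurable_fun setT v ->
  (forall p, (0 <= u p)%E) -> (forall p, (u p <= v p)%E) -> (iint u <= iint v)%E.
Proof.
move=> mu mv u0 uv; have v0 p : (0 <= v p)%E by exact: le_trans (uv p).
apply: ge0_le_integral => //.
- by move=> x _; exact: integral_ge0.
- exact: measurable_inner.
- exact: measurable_inner.
move=> x _; apply: ge0_le_integral => //; exact: measurable_slice.
Qed.

Lemma iintZ (k : R) u : 0 <= k -> measurable_fun setT u -> (forall p, (0 <= u p)%E) ->
  iint (fun p => k%:E * u p)%E = (k%:E * iint u)%E.
Proof.
move=> k0 mu u0; rewrite /iint -ge0_integralZl//; last 2 first.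
- exact: measurable_inner.
- by move=> x _; exact: integral_ge0.
apply: eq_integral => x _; rewrite ge0_integralZl//; exact: measurable_slice.
Qed.

Lemma iint_sum m (u : 'I_m -> V * V -> \bar R) : (forall i, measurable_fun setT (u i)) ->
  (forall i p, (0 <= u i p)%E) ->
  iint (fun p => \sum_(i < m) u i p)%E = (\sum_(i < m) iint (u i))%E.
Proof.
move=> mu u0; rewrite /iint -ge0_integral_sum//; last 2 first.
- by move=> i; exact: measurable_inner.
- by move=> i x _; exact: integral_ge0.
apply: eq_integral => x _; rewrite ge0_integral_sum// => i; exact: measurable_slice.
Qed.

(** Monotone convergence, twice. *)
Lemma iint_sup_le u (v : nat -> V * V -> \bar R) (C : \bar R) :
  (forall j, measurable_fun setT (v j)) -> (forall j p, (0 <= v j p)%E) ->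
  (forall p, {homo v ^~ p : a b / (a <= b)%N >-> (a <= b)%E}) ->
  (forall p, v j p @[j --> \oo] --> u p) ->
  (forall j, (iint (v j) <= C)%E) -> (iint u <= C)%E.
Proof.
move=> mv v0 hv hl hC.
have E1 x : (\int[leb]_y u (x, y) = limn (fun j => \int[leb]_y v j (x, y)))%E.
  have := @monotone_convergence _ _ _ leb setT measurableT (fun j y => v j (x, y))
    (fun j => measurable_slice x (mv j)) (fun j y _ => v0 j (x, y))
    (fun y _ a b ab => hv (x, y) a b ab).
  move=> <-; apply: eq_integral => y _.
  by apply/esym/cvg_lim => //; exact: hl.
have nd x : {homo (fun j => \int[leb]_y v j (x, y))%E : a b / (a <= b)%N >-> (a <= b)%E}.
  move=> a b ab; apply: ge0_le_integral => //; try exact: measurable_slice.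
  by move=> y _; exact: hv.
have i0 j x : setT x -> (0 <= \int[leb]_y v j (x, y))%E by move=> _; exact: integral_ge0.
rewrite /iint; under eq_integral do rewrite E1.
rewrite (@monotone_convergence _ _ _ leb setT measurableT
  (fun j x => \int[leb]_y v j (x, y))%E (fun j => measurable_inner (mv j) (v0 j))
  i0 (fun x _ a b ab => nd x a b ab)).
apply: lime_le; last by apply: nearW => j; exact: hC.
apply: ereal_nondecreasing_is_cvgn => a b ab; apply: ge0_le_integral => //.
- by move=> x _; exact: integral_ge0.
- exact: measurable_inner.
- exact: measurable_inner.
- by move=> x _; exact: nd.
Qed.

End duality.

(** * Positive operators dominated by the Riesz kernel *)

Section riesz_kernel.
Context {R : realType} {n : nat}.
Hypothesis n0 : (0 < n)%N.
Local Notation leb := (@lebesgue_rV R n).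
Local Notation V := ('rV[R]_n).
Implicit Types (x y z : V) (f g F G : V -> R).

Lemma coord_le_enorm x i : `|x ord0 i| <= enorm x.
Proof.
rewrite /enorm -sqrtr_sqr ler_wsqrtr// (bigD1 i)//= lerDl.
by apply: sumr_ge0 => j _; exact: sqr_ge0.
Qed.

Lemma measurable_enorm : measurable_fun setT (@enorm R n).
Proof.
rewrite (_ : @enorm R n = fun x => (\sum_(i < n) x ord0 i ^+ 2) `^ 2^-1).
  apply: measurable_powR_comp; apply: measurable_sum => i.
  apply: (@measurable_funX _ _ _ _ (fun x : V => x ord0 i)).
  exact: measurable_coord.
apply/funext => x; rewrite powR12_sqrt//.
by apply: sumr_ge0 => j _; exact: sqr_ge0.
Qed.

Lemma measurable_subV : measurable_fun setT (fun p : V * V => p.1 - p.2).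
Proof.
apply/measurable_fun_rVP => i.
rewrite (_ : (fun s => _) = fun p : V * V => p.1 ord0 i - p.2 ord0 i); last first.
  by apply/funext => p; rewrite !mxE.
apply: measurable_funB.
  by have /= := measurableT_comp (@measurable_coord _ R n i) (@measurable_fst _ _ V V).
by have /= := measurableT_comp (@measurable_coord _ R n i) (@measurable_snd _ _ V V).
Qed.

Definition riesz (alpha : R) (p : V * V) : R := enorm (p.1 - p.2) `^ (alpha - n%:R).

Lemma measurable_riesz alpha : measurable_fun setT (riesz alpha).
Proof.
apply: measurable_powR_comp.
exact: (measurableT_comp measurable_enorm measurable_subV).
Qed.

Lemma riesz_ge0 alpha p : 0 <= riesz alpha p. Proof. exact: powR_ge0. Qed.

Lemma not_near_enorm (l : R) (p : V * V) : 0 <= l -> ~ near_set l p -> l < enorm (p.1 - p.2).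
Proof.
move=> l0 /existsNP[i /negP]; rewrite -ltNge => h; apply: (lt_le_trans h).
by have := coord_le_enorm (p.1 - p.2) i; rewrite !mxE.
Qed.

(** Pairs at distance between 2^-M and 2^M. The sums over scales are finite on
    it, and it exhausts the complement of the diagonal. *)
Definition annulus (M : nat) : set (V * V) :=
  near_set (2 ^+ M) `\` near_set (2 ^- M).

Lemma measurable_annulus M : measurable (annulus M).
Proof. by apply: measurableD; exact: measurable_near_set. Qed.

Lemma near_set_le (l l' : R) : l <= l' -> @near_set R n l `<=` near_set l'.
Proof. by move=> ll p h i; exact: le_trans (h i) ll. Qed.

Lemma annulus_le M N : (M <= N)%N -> annulus M `<=` annulus N.
Proof.
move=> MN p [h1 h2]; split.
  by move: h1; apply: near_set_le; rewrite ler_eXn2l// ltr1n.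
move=> h; apply: h2; move: h; apply: near_set_le.
by rewrite lef_pV2 ?posrE ?exprn_gt0// ler_eXn2l// ltr1n.
Qed.

Lemma annulus_near (p : V * V) : p.1 <> p.2 -> \forall M \near \oo, annulus M p.
Proof.
move=> pn.
have [i hi] : exists i, p.1 ord0 i != p.2 ord0 i.
  apply: contrapT => h; apply: pn; apply/rowP => i; apply/eqP/negP => hi.
  by apply: h; exists i; exact/negP.
have d0 : 0 < `|p.1 ord0 i - p.2 ord0 i| by rewrite normr_gt0 subr_eq0.
pose N := (\sum_(j < n) (Num.truncn `|p.1 ord0 j - p.2 ord0 j|%R).+1
   + (Num.truncn `|p.1 ord0 i - p.2 ord0 i|^-1%R).+1)%N.
exists N => // M /= NM; have M2 : M%:R <= 2 ^+ M :> R by rewrite -natrX ler_nat ltnW// ltn_expl.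
split.
  move=> j; apply: le_trans M2; apply: (@le_trans _ _ (Num.truncn `|p.1 ord0 j - p.2 ord0 j|).+1%:R).
    by rewrite ltW// truncnS_gt.
  rewrite ler_nat; apply: leq_trans NM; apply: leq_trans (leq_addr _ _).
  by rewrite (bigD1 j)//= leq_addr.
move=> /(_ i); apply/negP; rewrite -ltNge invf_plt ?posrE ?exprn_gt0//.
apply: lt_le_trans M2; apply: (@lt_le_trans _ _ (Num.truncn `|p.1 ord0 i - p.2 ord0 i|^-1).+1%:R).
  exact: truncnS_gt.
by rewrite ler_nat; apply: leq_trans NM; rewrite leq_addl.
Qed.

(** Let i be the first scale whose side is at least the distance of the two
    points. The Euclidean norm then exceeds half of that side, and the i-th
    term alone dominates the kernel, with the constant 2^(n - alpha). *)
Lemma riesz_annulus_le (alpha : R) M (p : V * V) : 0 < alpha < n%:R ->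
  riesz alpha p * \1_(annulus M) p <=
  \sum_(i < M.*2.+1) (2 `^ (n%:R - alpha) * side (2 ^- M) i `^ (alpha - n%:R)) *
     \1_(near_set (side (2 ^- M) i)) p.
Proof.
move=> /andP[a0 an]; rewrite [X in riesz _ _ * X]indicE.
have s0 i : 0 < side (2 ^- M : R) i by apply: side_gt0; rewrite invr_gt0 exprn_gt0.
have tge0 (i : 'I_(M.*2.+1)) : 0 <= (2 `^ (n%:R - alpha) * side (2 ^- M) i `^ (alpha - n%:R)) *
     (\1_(near_set (side (2 ^- M : R) i)) p : R).
  by rewrite !mulr_ge0 ?powR_ge0.
have [/set_mem[pM pm]|_] := boolP (p \in annulus M); last first.
  by rewrite mulr0; apply: sumr_ge0 => i _.
rewrite mulr1.
have top : side (2 ^- M : R) M.*2 = 2 ^+ M.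
  by rewrite /side -addnn exprD mulfK// gt_eqF// exprn_gt0.
have ex : exists i, p \in near_set (side (2 ^- M : R) i).
  by exists M.*2; rewrite top; exact: mem_set.
(* The index is positive because the points are farther apart than 2^-M, so
   that scale i - 1 exists and fails to contain the pair. *)
have [i hi imin] := ex_minnP ex.
have iM : (i <= M.*2)%N by apply: imin; rewrite top; exact: mem_set.
have i0 : (0 < i)%N.
  rewrite lt0n; apply/eqP => i00; apply: pm; move/set_mem : hi.
  by rewrite i00 /side expr0 mul1r.
rewrite (bigD1 (Ordinal (iM : (i < M.*2.+1)%N)))//= indicE hi mulr1.
rewrite ler_wpDr//; first by apply: sumr_ge0 => j _; exact: tge0.
have pred_lt : side (2 ^- M : R) i.-1 < enorm (p.1 - p.2).
  apply: not_near_enorm; first exact: ltW.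
  move=> h; have := imin i.-1 (mem_set h).
  by rewrite leqNgt prednK// leqnn.
have half : side (2 ^- M : R) i = 2 * side (2 ^- M) i.-1.
  by rewrite /side -{1}(prednK i0) exprS mulrA.
have e0 : 0 < enorm (p.1 - p.2) by apply: lt_trans pred_lt.
rewrite half (powRM _ (ler0n _ 2) (ltW (s0 _))) mulrA -powRD; last first.
  by rewrite pnatr_eq0 implybT.
rewrite (_ : n%:R - alpha + (alpha - n%:R) = 0); last by ring.
rewrite powRr0 mul1r /riesz -(opprB n%:R) !powRN.
rewrite lef_pV2 ?posrE ?powR_gt0//.
by apply: ge0_ler_powR; rewrite ?nnegrE ?(ltW e0) ?(ltW (s0 _)) ?(ltW pred_lt)//; lra.
Qed.

Section operator.
Variables (alpha p q q' r s C0 : R) (H : V * V -> R) (om ka : V -> R).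
Hypotheses (alphan : 0 < alpha < n%:R) (p1 : 1 < p) (q1 : 1 < q)
  (qq : q^-1 + q'^-1 = 1) (pq : q^-1 = p^-1 - alpha / n%:R)
  (r0 : 0 < r) (rp : r < p) (s0 : 0 < s) (sq : s < q') (C00 : 0 <= C0)
  (mH : measurable_fun setT H) (H0 : forall p, 0 <= H p)
  (pom : posfun om) (pka : posfun ka).

Hypothesis local_bound : forall z l f g, 0 < l ->
  measurable_fun setT f -> measurable_fun setT g ->
  (forall x, 0 <= f x) -> (forall x, 0 <= g x) ->
  (\int[leb]_(x in hcube (z, l)) \int[leb]_(y in hcube (z, l)) (H (x, y) * f y * g x)%:E <=
   (C0 * (l ^+ n) ^+ 2)%:E * (pmean leb r (hcube (z, l)) (fun x => f x * om x)%R *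
    pmean leb s (hcube (z, l)) (fun x => g x * ka x)%R))%E.

Let n0' : 0 < n%:R :> R. Proof. by rewrite ltr0n. Qed.

Let mHfg f g : measurable_fun setT f -> measurable_fun setT g ->
  measurable_fun setT (fun p : V * V => (H p * f p.2 * g p.1)%:E).
Proof.
move=> mf mg; apply/measurable_EFinP; apply: measurable_funM.
  apply: measurable_funM => //.
  by have /= := measurableT_comp mf (@measurable_snd _ _ V V).
by have /= := measurableT_comp mg (@measurable_fst _ _ V V).
Qed.

(** Insert the dyadic bound for the kernel, average each scale over cubes, use
    the local bound on each cube and sum over the scales. The exponent of the
    volume which comes out is alpha / n = 1/p + 1/q' - 1, the one in
    [bilinear_scale_sum]. The constant does not depend on M. *)
Lemma truncated_form_bound : exists2 C : R, 0 < C & forall M f g,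
  measurable_fun setT f -> measurable_fun setT g ->
  (forall x, 0 <= f x) -> (forall x, 0 <= g x) ->
  (\int[leb]_x ((f x * om x) `^ p)%:E <= 1)%E ->
  (\int[leb]_x ((g x * ka x) `^ q')%:E <= 1)%E ->
  (iint (fun w : V * V => (H w * f w.2 * g w.1)%:E *
     (riesz alpha w * \1_(annulus M) w)%:E) <= C%:E)%E.
Proof.
have p0 : 0 < p := lt_trans ltr01 p1. have q0 : 0 < q := lt_trans ltr01 q1.
have qqE := qq. have pqE := pq.
have qi0 : 0 < q^-1 by rewrite invr_gt0.
have qi1 : q^-1 < 1 by rewrite invf_lt1.
have q'i0 : 0 < q'^-1 by lra.
have q'0 : 0 < q' by rewrite -invr_gt0.
have q'1 : 1 < q' by rewrite -(invrK q') invf_gt1//; lra.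
have [a0 an] := andP alphan.
have an0 : 0 < alpha / n%:R by rewrite divr_gt0.
have pq1 : 1 < p^-1 + q'^-1 by lra.
have ae : p^-1 + q'^-1 - 1 = alpha / n%:R by lra.
have [C1 C10 hC1] := @bilinear_scale_sum R n n0 _ _ _ _ p1 q'1 pq1 r0 rp s0 sq.
pose c := 2 `^ (n%:R - alpha).
pose D := c * C0 * (2 ^+ n) ^+ 2 * 2 `^ (- alpha).
have c0 : 0 <= c by exact: powR_ge0.
have D0 : 0 <= D by rewrite !mulr_ge0 ?powR_ge0 ?exprn_ge0.
exists (D * C1 + 1); first by rewrite ltr_wpDl// mulr_ge0// ltW.
move=> M f g mf mg f0 g0 hf hg.
pose u (w : V * V) := (H w * f w.2 * g w.1)%:E.
have mu : measurable_fun setT u by exact: mHfg.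
have u0 w : (0 <= u w)%E by rewrite lee_fin !mulr_ge0.
pose L i : R := side (2 ^- M) i.
have L0 i : 0 < L i by apply: side_gt0; rewrite invr_gt0 exprn_gt0.
pose k i := c * L i `^ (alpha - n%:R).
have k0 i : 0 <= k i by rewrite mulr_ge0 ?powR_ge0.
pose un (i : nat) (w : V * V) := (u w * (\1_(near_set (L i)) w)%:E)%E.
have mun i : measurable_fun setT (un i).
  apply: emeasurable_funM => //; apply/measurable_EFinP; apply: measurable_indic.
  exact: measurable_near_set.
have un0 i w : (0 <= un i w)%E by rewrite mule_ge0// lee_fin.
have mkun i : measurable_fun setT (fun w => (k i)%:E * un i w)%E.
  by apply: emeasurable_funM.
have kun0 i w : (0 <= (k i)%:E * un i w)%E by rewrite mule_ge0// lee_fin.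
apply: (@le_trans _ _ (iint (fun w => \sum_(i < M.*2.+1) ((k i)%:E * un i w))%E)).
  apply: iint_le.
  - apply: emeasurable_funM => //; apply/measurable_EFinP/measurable_funM; first exact: measurable_riesz.
    by apply: measurable_indic; exact: measurable_annulus.
  - exact: emeasurable_sum.
  - move=> w; apply: mule_ge0; first exact: u0.
    by rewrite lee_fin mulr_ge0 ?riesz_ge0// indicE.
  move=> w; apply: (@le_trans _ _ (u w * (\sum_(i < M.*2.+1) k i * \1_(near_set (L i)) w)%:E)%E).
    have h := riesz_annulus_le M w alphan.
    by apply: lee_wpmul2l => //; exact: u0.
  rewrite -sumEFin ge0_sume_distrr; last by move=> i _; rewrite lee_fin mulr_ge0.
  by apply: lee_sum => i _; rewrite /un EFinM muleCA.
rewrite (iint_sum (fun i : 'I_(M.*2.+1) => mkun i) (fun i : 'I_(M.*2.+1) => kun0 i)).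
pose A i := (\int[leb]_z (pmean leb r (hcube (z, 2 * L i)%R) (fun x => f x * om x)%R *
    pmean leb s (hcube (z, 2 * L i)%R) (fun x => g x * ka x)%R))%E.
have mfo : measurable_fun setT (fun x => f x * om x) by apply: measurable_funM => //; exact: pom.1.
have mgk : measurable_fun setT (fun x => g x * ka x) by apply: measurable_funM => //; exact: pka.1.
have fo0 x : 0 <= f x * om x by rewrite mulr_ge0// ltW// pom.2.
have gk0 x : 0 <= g x * ka x by rewrite mulr_ge0// ltW// pka.2.
have A0 i : (0 <= A i)%E by apply: integral_ge0 => z _; rewrite mule_ge0 ?pmean_ge0.
have term i : (iint (fun w => (k i)%:E * un i w)%E <=
   D%:E * ((vol (n := n) (2 * 2 ^- M) i `^ (alpha / n%:R))%:E * A i))%E.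
  have ln0 : 0 < L i ^+ n by rewrite exprn_gt0.
  have L20 : 0 < 2 * L i by rewrite mulr_gt0.
  rewrite iintZ//.
  have h1 := near_average (L0 i) mu u0.
  have mprod : measurable_fun setT (fun z => pmean leb r (hcube (z, 2 * L i)%R) (fun x => f x * om x)%R *
    pmean leb s (hcube (z, 2 * L i)%R) (fun x => g x * ka x)%R)%E.
    by apply: emeasurable_funM; exact: measurable_pmean.
  have h2 : (\int[leb]_z \int[leb]_(x in hcube (z, (2 * L i)%R))
      \int[leb]_(y in hcube (z, (2 * L i)%R)) u (x, y) <=
      (C0 * ((2 * L i) ^+ n) ^+ 2)%:E * A i)%E.
    have CL0 : (0 <= (C0 * ((2 * L i) ^+ n) ^+ 2)%:E)%E.
      by rewrite lee_fin mulr_ge0// !exprn_ge0// ltW.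
    rewrite -ge0_integralZl//; last by move=> z _; rewrite mule_ge0 ?pmean_ge0.
    apply: ge0_le_integral; first exact: measurableT.
    - by move=> z _; apply: integral_ge0 => x _; exact: integral_ge0.
    - exact: measurable_hcube_iint.
    - exact: emeasurable_funM.
    - by move=> z _; exact: (local_bound z L20 mf mg f0 g0).
  rewrite -(@lee_pmul2l _ (L i ^+ n)%:E)//.
  apply: (@le_trans _ _ ((k i)%:E * ((C0 * ((2 * L i) ^+ n) ^+ 2)%:E * A i))%E).
    by rewrite muleCA lee_wpmul2l ?lee_fin// (le_trans h1 h2).
  rewrite !muleA -!EFinM lee_wpmul2r// lee_fin le_eqVlt; apply/orP; left; apply/eqP.
  have -> : vol (n := n) (2 * 2 ^- M) i `^ (alpha / n%:R) = 2 `^ alpha * L i `^ alpha.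
    rewrite /vol (_ : side _ _ = 2 * L i); last by rewrite /side /L /side mulrCA.
    rewrite -powR_mulrn ?(ltW L20)// -powRrM (mulrCA n%:R) divff ?gt_eqF// mulr1.
    by rewrite powRM// ltW.
  have -> : k i = c * (L i `^ alpha / L i ^+ n).
    rewrite /k powRD; last by rewrite (gt_eqF (L0 i)) implybT.
    by rewrite powRN powR_mulrn// ltW.
  have La : L i `^ alpha != 0 by rewrite gt_eqF ?powR_gt0.
  have P2 : 2 `^ alpha != 0 :> R by rewrite gt_eqF ?powR_gt0.
  rewrite /D powRN (exprMn n 2 (L i)); move: (2 `^ alpha) P2 (L i `^ alpha) La (L i ^+ n) ln0 (2 ^+ n) => X X0 Y Y0 Z Z0 W.
  by field; rewrite X0 gt_eqF.
apply: (@le_trans _ _ (\sum_(i < M.*2.+1) D%:E * ((vol (n := n) (2 * 2 ^- M) i `^ (alpha / n%:R))%:E * A i))%E).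
  by apply: lee_sum => i _; exact: term.
rewrite -ge0_sume_distrr; last by move=> i _; rewrite mule_ge0// lee_fin powR_ge0.
have M0 : 0 < 2 * 2 ^- M :> R by rewrite mulr_gt0// invr_gt0 exprn_gt0.
apply: (@le_trans _ _ (D%:E * C1%:E)%E); last by rewrite -EFinM lee_fin lerDl.
rewrite lee_wpmul2l//.
have := hC1 M.*2.+1 (2 * 2 ^- M) _ _ M0 mfo fo0 mgk gk0 hf hg.
apply: le_trans; rewrite ae; apply: lee_sum => i _.
apply: lee_wpmul2l; first by rewrite lee_fin powR_ge0.
by rewrite /A (_ : side _ _ = 2 * L i)// /side /L /side mulrCA.
Qed.

Lemma riesz_diag (w : V * V) : w.1 = w.2 -> riesz alpha w = 0.
Proof.
move=> e; rewrite /riesz e subrr /enorm big1; last by move=> i _; rewrite mxE expr0n.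
by rewrite sqrtr0 powR0// lt_eqF// subr_lt0; have [] := andP alphan.
Qed.

(** Monotone convergence in the truncation. *)
Lemma form_bound : exists2 C : R, 0 < C & forall f g,
  measurable_fun setT f -> measurable_fun setT g ->
  (forall x, 0 <= f x) -> (forall x, 0 <= g x) ->
  (\int[leb]_x ((f x * om x) `^ p)%:E <= 1)%E ->
  (\int[leb]_x ((g x * ka x) `^ q')%:E <= 1)%E ->
  (iint (fun w : V * V => (H w * f w.2 * g w.1 * riesz alpha w)%:E) <= C%:E)%E.
Proof.
have [C C1 hC] := truncated_form_bound; exists C => // f g mf mg f0 g0 hf hg.
have u0 w : 0 <= H w * f w.2 * g w.1 by rewrite !mulr_ge0.
apply: (@iint_sup_le R n _ (fun M w => (H w * f w.2 * g w.1)%:E *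
     (riesz alpha w * \1_(annulus M) w)%:E)%E).
- move=> M; apply: emeasurable_funM; first exact: mHfg.
  apply/measurable_EFinP/measurable_funM; first exact: measurable_riesz.
  by apply: measurable_indic; exact: measurable_annulus.
- by move=> M w; rewrite mule_ge0// lee_fin ?mulr_ge0// riesz_ge0.
- move=> w M N MN; rewrite lee_wpmul2l ?lee_fin// ler_wpM2l ?riesz_ge0//.
  rewrite !indicE; have [/set_mem h|_] := boolP (w \in annulus M).
    by rewrite mem_set//; exact: annulus_le h.
  by case: (_ \in _).
- move=> w; apply: cvg_near_cst.
  have [e|ne] := pselect (w.1 = w.2).
    by apply: nearW => M; rewrite riesz_diag// mul0r mulr0 mule0.
  near=> M; rewrite indicE mem_set ?mulr1 -?EFinM//.
  by near: M; exact: annulus_near.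
- by move=> M; exact: hC.
Unshelve. all: end_near.
Qed.

(** Duality: test the operator against g = G / ka. The scale T of f is
    factored out because the form bound is for normalized functions; the value
    T = 0 is excluded, and recovered later by letting T tend to the norm. *)
Lemma riesz_operator_bound : exists2 C : R, 0 < C & forall f (T : R),
  measurable_fun setT f -> (forall x, 0 <= f x) -> 0 < T ->
  (\int[leb]_x ((f x * om x) `^ p)%:E <= (T `^ p)%:E)%E ->
  (\int[leb]_x (((ka x)^-1)%:E * \int[leb]_y (H (x, y) * f y * riesz alpha (x, y))%:E) `^ q <=
   ((C * T) `^ q)%:E)%E.
Proof.
have [C C1 hC] := form_bound; exists C => // f T mf f0 T0 hf.
have p0 : 0 < p := lt_trans ltr01 p1.
pose k x := (((ka x)^-1)%:E * \int[leb]_y (H (x, y) * f y * riesz alpha (x, y))%:E)%E.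
have kaV := posfun_inv pka.
have mHf h : measurable_fun setT h -> measurable_fun setT (fun w : V * V => (H w * h w.2 * riesz alpha w)%:E).
  move=> mh; apply/measurable_EFinP; apply: measurable_funM; last exact: measurable_riesz.
  apply: measurable_funM => //.
  by have /= := measurableT_comp mh (@measurable_snd _ _ V V).
have Hf0 w : (0 <= (H w * f w.2 * riesz alpha w)%:E)%E.
  by rewrite lee_fin !mulr_ge0// riesz_ge0.
have mk : measurable_fun setT k.
  apply: emeasurable_funM; first by apply/measurable_EFinP; exact: kaV.1.
  exact: (@measurable_inner _ _ (fun w => (H w * f w.2 * riesz alpha w)%:E) (mHf f mf) Hf0).
have k0 x : (0 <= k x)%E.
  rewrite mule_ge0//; first by rewrite lee_fin ltW// kaV.2.
  by apply: integral_ge0 => y _; exact: Hf0 (x, y).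
apply: (@dual_norm_le R n q q' (C * T) k q1 qq) => //; first by rewrite mulr_ge0// ltW.
move=> G mG G0 hG.
pose f1 y := T^-1 * f y.
pose g x := G x * (ka x)^-1.
have mf1 : measurable_fun setT f1 by exact: measurable_funM.
have f10 y : 0 <= f1 y by rewrite mulr_ge0// invr_ge0 ltW.
have mg : measurable_fun setT g by apply: measurable_funM => //; exact: kaV.1.
have g0 x : 0 <= g x by rewrite mulr_ge0// ltW// kaV.2.
have hf1 : (\int[leb]_x ((f1 x * om x) `^ p)%:E <= 1)%E.
  have fo0 x : 0 <= f x * om x by rewrite mulr_ge0// ltW// pom.2.
  have -> : (\int[leb]_x ((f1 x * om x) `^ p)%:E =
     \int[leb]_x ((T^-1 `^ p)%:E * ((f x * om x) `^ p)%:E))%E.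
    apply: eq_integral => x _; rewrite /f1 -mulrA; congr _%:E; apply: powRM => //.
    by rewrite invr_ge0 ltW.
  rewrite ge0_integralZl_EFin ?powR_ge0//; last 2 first.
  - by move=> x _; rewrite lee_fin powR_ge0.
  - by apply/measurable_EFinP; apply: measurable_powR_comp; apply: measurable_funM => //; exact: pom.1.
  apply: (@le_trans _ _ ((T^-1 `^ p)%:E * (T `^ p)%:E)%E).
    by rewrite lee_wpmul2l// lee_fin powR_ge0.
  by rewrite -EFinM -powRM ?invr_ge0 ?(ltW T0)// mulVf ?gt_eqF// powR1.
have hg1 : (\int[leb]_x ((g x * ka x) `^ q')%:E <= 1)%E.
  have -> // : (\int[leb]_x ((g x * ka x) `^ q')%:E = \int[leb]_x (G x `^ q')%:E)%E.
  by apply: eq_integral => x _; rewrite /g mulfVK// gt_eqF// pka.2.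
have := hC f1 g mf1 mg f10 g0 hf1 hg1.
have -> : (\int[leb]_x (k x * (G x)%:E) =
   T%:E * iint (fun w : V * V => (H w * f1 w.2 * g w.1 * riesz alpha w)%:E))%E.
  rewrite -iintZ ?(ltW T0)//; last 2 first.
  - rewrite (_ : (fun w => _) = fun w => ((H w * f1 w.2 * g w.1)%:E * (riesz alpha w)%:E)%E).
      by apply: emeasurable_funM; [exact: mHfg|apply/measurable_EFinP; exact: measurable_riesz].
    by apply/funext => w; rewrite -EFinM.
  - move=> w; rewrite lee_fin. apply: mulr_ge0; last exact: riesz_ge0.
    by apply: mulr_ge0 => //; apply: mulr_ge0.
  apply: eq_integral => x _.
  have e y : (T%:E * (H (x, y) * f1 y * g x * riesz alpha (x, y))%:E =
     (g x)%:E * (H (x, y) * f y * riesz alpha (x, y))%:E)%E.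
    by rewrite -!EFinM; congr _%:E; rewrite /f1; field; rewrite gt_eqF.
  under [RHS]eq_integral do rewrite /= e.
  have mS := measurable_slice x (mHf f mf).
  rewrite ge0_integralZl_EFin//.
  by rewrite /k /g EFinM muleAC (muleC ((ka x)^-1)%:E).
by move=> h; rewrite (mulrC C) EFinM lee_wpmul2l// lee_fin ltW.
Qed.

End operator.
End riesz_kernel.

(** * Oscillation under two weights *)

Section two_weights.
Context {R : realType} {n : nat}.
Local Notation leb := (@lebesgue_rV R n).
Local Notation V := ('rV[R]_n).
Implicit Types (x y z : V) (f g h u om la b : V -> R) (Q : V * R).
Local Notation pm a Q f := (pmean leb a (hcube Q) f).

Lemma le_muck a a' c c' K u : 0 < a <= a' -> 0 < c <= c' -> muck a' c' K u -> muck a c K u.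
Proof.
move=> aa cc [pu h]; split => // Q Q0; apply: le_trans (h Q Q0).
have pv := posfun_inv pu.
apply: lee_pmul; rewrite ?pmean_ge0//; apply: pmean_mono => //; try exact: fat_hcube;
  try exact: pu.1; try exact: pv.1; by move=> x; rewrite ltW ?pu.2 ?pv.2.
Qed.

Lemma muck_weaken a c K K' u : muck a c K u -> K <= K' -> muck a c K' u.
Proof. by move=> [pu h] KK; split => // Q Q0; apply: le_trans (h Q Q0) _; rewrite lee_fin. Qed.

(** Apply [muck_open] to u and to 1/u. *)
Lemma muck_open_both a c K u : 0 < a -> 0 < c -> muck a c K u ->
  exists a' c' K', [/\ a < a', c < c' & muck a' c' K' u].
Proof.
move=> a0 c0 hM; have [a' [C [aa C0 hC]]] := muck_open a0 c0 hM.
have [c' [D [cc D0 hD]]] := muck_open c0 a0 (muckV hM).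
exists a', c', (C * D * K); split => //; split; first exact: hM.1.
move=> Q Q0; apply: (@le_trans _ _ ((C%:E * pm a Q u) * (D%:E * pm c Q (fun x => (u x)^-1)%R))%E).
  by apply: lee_pmul; [exact: pmean_ge0|exact: pmean_ge0|exact: hC|exact: hD].
by rewrite muleACA -!EFinM [leRHS]EFinM lee_wpmul2l ?hM.2// lee_fin mulr_ge0// ltW.
Qed.

Lemma muck_open_common a c K1 K2 u (v : V -> R) : 0 < a -> 0 < c -> muck a c K1 u -> muck a c K2 v ->
  exists a' c' K, [/\ a < a', c < c', 0 <= K, muck a' c' K u & muck a' c' K v].
Proof.
move=> a0 c0 hu hv.
have [a1 [c1 [L1 [aa1 cc1 h1]]]] := muck_open_both a0 c0 hu.
have [a2 [c2 [L2 [aa2 cc2 h2]]]] := muck_open_both a0 c0 hv.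
exists (Num.min a1 a2), (Num.min c1 c2), (`|L1| + `|L2|).
have A0 : 0 < Num.min a1 a2 by rewrite lt_min; lra.
have B0 : 0 < Num.min c1 c2 by rewrite lt_min; lra.
split; rewrite ?lt_min ?aa1 ?cc1 ?aa2 ?cc2 ?addr_ge0//.
- apply: (@muck_weaken _ _ L1); last by have := ler_norm L1; have := normr_ge0 L2; lra.
  by apply: le_muck h1; rewrite ?A0 ?B0 ge_min lexx.
- apply: (@muck_weaken _ _ L2); last by have := ler_norm L2; have := normr_ge0 L1; lra.
  by apply: le_muck h2; rewrite ?A0 ?B0 ge_min lexx orbT.
Qed.

(** The integral of h f over Q is |Q| times the mean of the product of f om
    and h / om. *)
Lemma weighted_hoelder r c Q f h om : 0 < r -> 0 < c -> r^-1 + c^-1 = 1 -> 0 < Q.2 ->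
  posfun om -> measurable_fun setT f -> measurable_fun setT h ->
  (forall x, 0 <= f x) -> (forall x, 0 <= h x) ->
  (\int[leb]_(x in hcube Q) (h x * f x)%:E <=
   (Q.2 ^+ n)%:E * (pm r Q (fun x => f x * om x)%R * pm c Q (fun x => h x * (om x)^-1)%R))%E.
Proof.
move=> r0 c0 rc Q0 pom mf mh f0 h0.
have pv := posfun_inv pom.
have fQ : fat leb (hcube Q) by exact: fat_hcube.
have mF : measurable_fun setT (fun x => f x * om x) by apply: measurable_funM => //; exact: pom.1.
have mH : measurable_fun setT (fun x => h x * (om x)^-1) by apply: measurable_funM => //; exact: pv.1.
have F0 x : 0 <= f x * om x by rewrite mulr_ge0// ltW// pom.2.
have H0 x : 0 <= h x * (om x)^-1 by rewrite mulr_ge0// ltW// pv.2.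
have Qn : 0 < Q.2 ^+ n by rewrite exprn_gt0.
have rc1 : 1^-1 = r^-1 + c^-1 by rewrite rc invr1.
have := pmean_hoelder fQ mF mH F0 H0 r0 c0 rc1.
rewrite {1}/pmean invr1 poweRe1; last by rewrite mule_ge0 ?pint_ge0 ?fat_inv_ge0.
rewrite fine_leb_hcube// => hh.
rewrite -(@lee_pmul2l _ ((Q.2 ^+ n)^-1)%:E) ?lte_fin ?invr_gt0//.
rewrite muleA -EFinM mulVf ?gt_eqF// mul1e; apply: le_trans hh.
rewrite le_eqVlt; apply/orP; left; apply/eqP; congr (_ * _)%E; apply: eq_integral => x _.
have e : f x * om x * (h x * (om x)^-1) = h x * f x by field; rewrite gt_eqF// pom.2.
by rewrite e powRr1// mulr_ge0.
Qed.

(** Hoelder with the exponent s given by 1/s = 1/a + 1/c, followed by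
    monotonicity of the means, since s >= 1. *)
Lemma pmM_hoelder a c Q u (v : V -> R) : 0 < a -> 0 < c -> a^-1 + c^-1 <= 1 -> 0 < Q.2 ->
  posfun u -> posfun v ->
  (pm 1 Q (fun x => u x / v x)%R <= pm a Q u * pm c Q (fun x => (v x)^-1)%R)%E.
Proof.
move=> a0 c0 ac Q0 pu pv; have pvi := posfun_inv pv.
have fQ : fat leb (hcube Q) by exact: fat_hcube.
pose s := (a^-1 + c^-1)^-1.
have s0 : 0 < a^-1 + c^-1 by rewrite addr_gt0 ?invr_gt0.
have s1 : 0 < (1 : R) <= s.
  by apply/andP; split; [exact: ltr01|rewrite /s -[leLHS]invr1 lef_pV2 ?posrE].
apply: (@le_trans _ _ (pm s Q (fun x => u x / v x)%R)).
  apply: pmean_mono => //; first by apply: measurable_funM; [exact: pu.1|exact: pvi.1].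
  by move=> x; rewrite divr_ge0// ltW ?pu.2 ?pv.2.
apply: pmean_hoelder => //; try exact: pu.1; try exact: pvi.1; rewrite ?invrK//.
- by move=> x; rewrite ltW ?pu.2.
- by move=> x; rewrite ltW ?pvi.2.
Qed.

Lemma scaled_le (k : R) (X Y : \bar R) : 0 < k -> (k%:E * X <= k%:E * Y -> X <= Y)%E.
Proof. by move=> k0; rewrite lee_pmul2l. Qed.

(** John-Nirenberg with the weights la^a and om^a. The hypothesis to check is
    that the oscillation of b on Q, at most B (om/la)_{1,Q}, times (la)_{a,Q}
    is bounded by (om)_{a,Q}: by Hoelder (om/la)_{1,Q} <= (om)_{a,Q}
    (1/la)_{c,Q}, and the weight condition for la cancels the last factor.
    Applied to 1/la, 1/om and exchanged exponents it yields the dual estimate. *)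
Lemma two_weight_oscillation a c K B om la b : 0 < a -> 0 < c -> a^-1 + c^-1 <= 1 ->
  0 <= K -> 0 <= B -> muck a c K om -> muck a c K la ->
  measurable_fun setT b ->
  (forall Q, 0 < Q.2 -> leb.-integrable (hcube Q) (EFin \o b)) ->
  (forall Q, 0 < Q.2 -> ((avg (fun x => `|b x - avg b Q|) Q)%:E <=
     B%:E * pm 1 Q (fun x => om x / la x)%R)%E) ->
  exists2 A : R, 0 <= A & forall Q, 0 < Q.2 ->
    (pm a Q (fun x => `|b x - avg b Q| * la x)%R <= A%:E * pm a Q om)%E.
Proof.
move=> a0 c0 ac K0 B0 mom mla mb ib hB.
have pom := mom.1. have pla := mla.1.
have [kappa k01 hk] := muck_ainfty a0 c0 mom.
have pomla : posfun (fun x => om x / la x).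
  split; first by apply: measurable_funM; [exact: pom.1|exact: (posfun_inv pla).1].
  by move=> x; rewrite divr_gt0 ?pom.2 ?pla.2.
have powE (u : V -> R) Q : 0 < Q.2 ->
    (pm a Q u `^ a = ((Q.2 ^+ n)^-1)%:E * \int[leb]_(x in hcube Q) (u x `^ a)%:E)%E.
  by move=> Q0; rewrite pm_powR// fine_leb_hcube.
have vn Q : 0 < Q.2 -> 0 < Q.2 ^+ n by move=> Q0; rewrite exprn_gt0.
have hv Q : 0 < Q.2 -> (\int[leb]_(x in hcube Q) (om x `^ a)%:E < +oo)%E.
  exact: (muck_int_lty a0 c0 mom).
have cond Q : 0 < Q.2 -> exists D : R, [/\ 0 < D, avg (fun x => `|b x - avg b Q|) Q <= D &
    ((D `^ a)%:E * \int[leb]_(x in hcube Q) (la x `^ a)%:E <=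
     (((B + 1) * K) `^ a)%:E * \int[leb]_(x in hcube Q) (om x `^ a)%:E)%E].
  move=> Q0.
have h1 := pmM_hoelder a0 c0 ac Q0 pom pla.
  have p1 : (0 < pm 1 Q (fun x => om x / la x)%R)%E by exact: pm_gt0.
  have foo : (pm 1 Q (fun x => om x / la x)%R < +oo)%E.
    apply: le_lt_trans h1 _; apply: lte_mul_pinfty; rewrite ?pmean_ge0//.
      by rewrite ge0_fin_numE ?pmean_ge0//; exact: (muck_lty a0 c0 mom).
    exact: (muck_lty c0 a0 (muckV mla)).
  have [D0 DE] : exists D, (pm 1 Q (fun x => om x / la x)%R = D%:E)%E.
    exists (fine (pm 1 Q (fun x => om x / la x)%R)); rewrite fineK// ge0_fin_numE ?pmean_ge0//.
  move: (hB Q Q0) p1 h1; rewrite DE lte_fin => hBQ D00 h1.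
  exists ((B + 1) * D0); split; first by rewrite mulr_gt0// ltr_wpDl.
    move: hBQ; rewrite -EFinM lee_fin => /le_trans; apply.
    by rewrite ler_wpM2r ?(ltW D00)// lerDl.
  have key : (((B + 1) * D0)%:E * pm a Q la <= ((B + 1) * K)%:E * pm a Q om)%E.
    rewrite !EFinM -!muleA lee_wpmul2l ?lee_fin ?addr_ge0//.
    apply: le_trans (lee_wpmul2r (pmean_ge0 _ _ _ _) h1) _.
    rewrite -muleA muleC lee_wpmul2r ?pmean_ge0// muleC; exact: mla.2.
  have := le_poweR_mul (ltW a0) _ _ (pmean_ge0 _ _ _ _) (pmean_ge0 _ _ _ _) key.
  rewrite !powE// => h; apply: (scaled_le (k := (Q.2 ^+ n)^-1)); first by rewrite invr_gt0 vn.
  rewrite (muleCA _ (((B + 1) * D0) `^ a)%:E) (muleCA _ (((B + 1) * K) `^ a)%:E).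
  apply: h; first by rewrite mulr_ge0 ?addr_ge0// ltW.
  by rewrite mulr_ge0 ?addr_ge0.
have [A A0 hA] := weighted_john_nirenberg a0 k01 (powR_ge0 _ _) mb ib
    (measurable_powR_comp a pla.1) (fun x => powR_ge0 _ _)
    (measurable_powR_comp a pom.1) (fun x => powR_ge0 _ _) hv hk cond.
exists (A `^ a^-1); first exact: powR_ge0.
move=> Q Q0; rewrite /pmean -poweR_EFin -poweRM ?mule_ge0 ?pint_ge0 ?fat_inv_ge0 ?lee_fin//.
apply: gt0_ler_poweR; first by rewrite invr_ge0 ltW.
- by rewrite in_itv/= leey andbT mule_ge0 ?pint_ge0 ?fat_inv_ge0.
- by rewrite in_itv/= leey andbT mule_ge0 ?mule_ge0 ?pint_ge0 ?fat_inv_ge0 ?lee_fin.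
rewrite (muleCA A%:E) lee_wpmul2l ?fat_inv_ge0//; have := hA Q Q0; apply: le_trans.
rewrite le_eqVlt; apply/orP; left; apply/eqP; apply: eq_integral => x _.
by rewrite powRM// ltW// pla.2.
Qed.

End two_weights.

(** * Local bilinear estimates *)

Section majorants.
Context {R : realType} {n : nat}.
Local Notation leb := (@lebesgue_rV R n).
Local Notation V := ('rV[R]_n).
Implicit Types (x y z : V) (f g h u om la b : V -> R) (Q : V * R).
Local Notation pm a Q f := (pmean leb a (hcube Q) f).

Lemma double_integral_sum (S : set V) u f g : measurable S ->
  measurable_fun setT u -> measurable_fun setT f -> measurable_fun setT g ->
  (forall x, 0 <= u x) -> (forall x, 0 <= f x) -> (forall x, 0 <= g x) ->
  (\int[leb]_(x in S) \int[leb]_(y in S) ((u x + u y) * f y * g x)%:E =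
   (\int[leb]_(x in S) (u x * g x)%:E) * (\int[leb]_(y in S) (f y)%:E) +
   (\int[leb]_(x in S) (g x)%:E) * (\int[leb]_(y in S) (u y * f y)%:E))%E.
Proof.
move=> mS mu mf mg u0 f0 g0.
have m1 h : measurable_fun setT h -> measurable_fun S (EFin \o h).
  by move=> mh; apply/measurable_EFinP; exact: measurable_funS mh.
have muf := m1 _ (measurable_funM mu mf).
have mug := m1 _ (measurable_funM mu mg).
have mf' := m1 _ mf. have mg' := m1 _ mg.
have uf0 y : S y -> (0 <= (u y * f y)%:E)%E by move=> _; rewrite lee_fin mulr_ge0.
have ug0 y : S y -> (0 <= (u y * g y)%:E)%E by move=> _; rewrite lee_fin mulr_ge0.
have F0 : (0 <= \int[leb]_(y in S) (f y)%:E)%E by apply: integral_ge0 => y _; rewrite lee_fin.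
have G0 : (0 <= \int[leb]_(y in S) (u y * f y)%:E)%E by exact: integral_ge0.
transitivity (\int[leb]_(x in S) ((u x * g x)%:E * \int[leb]_(y in S) (f y)%:E +
   (g x)%:E * \int[leb]_(y in S) (u y * f y)%:E))%E.
  apply: eq_integral => x _.
  have c1 : (0 <= (u x * g x)%:E)%E by rewrite lee_fin mulr_ge0.
  have c2 : (0 <= (g x)%:E)%E by rewrite lee_fin.
  rewrite -(ge0_integralZl leb mS mf' _ c1); last by move=> y _; rewrite lee_fin.
  rewrite -(ge0_integralZl leb mS muf uf0 c2).
  rewrite -ge0_integralD//.
  - by apply: eq_integral => y _; rewrite /= -!EFinM -EFinD; congr _%:E; ring.
  - by move=> y _; rewrite mule_ge0// lee_fin.
  - by apply: emeasurable_funM.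
  - by move=> y Sy; rewrite mule_ge0// uf0.
  - by apply: emeasurable_funM.
rewrite ge0_integralD//.
- by rewrite !ge0_integralZr// => y _; rewrite lee_fin.
- by move=> y Sy; rewrite mule_ge0// ug0.
- by apply: emeasurable_funM.
- by move=> y Sy; rewrite mule_ge0// lee_fin.
- by apply: emeasurable_funM.
Qed.

Lemma le_double_integral (S : set V) (k k' : V * V -> \bar R) : measurable S ->
  measurable_fun setT k -> measurable_fun setT k' ->
  (forall p, (0 <= k p)%E) -> (forall p, (k p <= k' p)%E) ->
  (\int[leb]_(x in S) \int[leb]_(y in S) k (x, y) <=
   \int[leb]_(x in S) \int[leb]_(y in S) k' (x, y))%E.
Proof.
move=> mS mk mk' k0 kk; have k'0 p : (0 <= k' p)%E by exact: le_trans (kk p).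
have inner (u : V * V -> \bar R) : measurable_fun setT u -> (forall p, (0 <= u p)%E) ->
     measurable_fun S (fun x => \int[leb]_(y in S) u (x, y))%E.
  move=> mu u0.
  have mu' : measurable_fun setT (fun p : V * V => (u p * (\1_S p.2)%:E)%E).
    apply: emeasurable_funM => //; apply/measurable_EFinP.
    by have /= := measurableT_comp (@measurable_indic _ _ R _ S mS) (@measurable_snd _ _ V V).
  have u'0 (p : V * V) : (0 <= u p * (\1_S p.2)%:E)%E by rewrite mule_ge0// lee_fin.
  have := measurable_inner mu' u'0.
  rewrite (_ : (fun x => _) = fun x => \int[leb]_(y in S) u (x, y))%E; last first.
    apply/funext => x; rewrite [RHS]integral_mkcond; apply: eq_integral => y _.
    by rewrite patchE indicE; case: ifP => _; rewrite ?mule1 ?mule0.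
  by apply: measurable_funS.
apply: ge0_le_integral; first exact: mS.
- by move=> x _; apply: integral_ge0 => y _.
- exact: inner.
- exact: inner.
move=> x _; apply: ge0_le_integral; first exact: mS.
- by move=> y _.
- exact: measurable_funS (measurable_slice x mk).
- exact: measurable_funS (measurable_slice x mk').
- by move=> y _.
Qed.

(** Bookkeeping for the products of two Hoelder bounds: the factors Y and Y'
    contain the weights only. *)
Lemma product_of_means (L k : R) (X Y X' Y' : \bar R) : 0 <= L -> (0 <= X -> 0 <= X' ->
  Y * Y' <= k%:E ->
  (L%:E * (X * Y)) * (L%:E * (X' * Y')) <= (k * L ^+ 2)%:E * (X' * X))%E.
Proof.
move=> L0 X0 X'0 YY; rewrite muleACA -EFinM -expr2 (mulrC k) [in leRHS]EFinM -[leRHS]muleA.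
apply: lee_wpmul2l; first by rewrite lee_fin exprn_ge0.
by rewrite muleACA muleC (muleC X') lee_wpmul2r// mule_ge0.
Qed.

(** Insert b_Q: |b(x) - b(y)| <= |b(x) - b_Q| + |b(y) - b_Q|. Each half of the
    double integral is then a product of two integrals over the cube, and
    Hoelder separates f and g from the weights. The factors with b are bounded
    by [two_weight_oscillation], and then the weight conditions for om,
    respectively la, bound the product of the remaining means. *)
Lemma local_oscillation_bound a c r s K A om la b z l f g : 0 < a -> 0 < c -> 0 < r -> 0 < s ->
  r^-1 + c^-1 = 1 -> s^-1 + a^-1 = 1 -> 0 <= K -> 0 <= A ->
  muck a c K om -> muck a c K la -> measurable_fun setT b ->
  (forall Q, 0 < Q.2 -> (pm a Q (fun x => `|b x - avg b Q| * la x)%R <= A%:E * pm a Q om)%E) ->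
  (forall Q, 0 < Q.2 -> (pm c Q (fun x => `|b x - avg b Q| * (om x)^-1)%R <=
     A%:E * pm c Q (fun x => (la x)^-1)%R)%E) ->
  0 < l -> measurable_fun setT f -> measurable_fun setT g ->
  (forall x, 0 <= f x) -> (forall x, 0 <= g x) ->
  (\int[leb]_(x in hcube (z, l)) \int[leb]_(y in hcube (z, l))
     (`|b x - b y| * f y * g x)%:E <=
   ((A * K + A * K) * (l ^+ n) ^+ 2)%:E * (pm r (z, l) (fun x => f x * om x)%R *
    pm s (z, l) (fun x => g x * (la x)^-1)%R))%E.
Proof.
move=> a0 c0 r0 s0 rc sa K0 A0 mom mla mb hla hom l0 mf mg f0 g0.
pose Q := (z, l); have Q0 : 0 < Q.2 by [].
have mQ : measurable (hcube Q) by exact: measurable_hcube.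
pose u x := `|b x - avg b Q|.
have mu : measurable_fun setT u.
  by apply: measurableT_comp => //; apply: measurable_funB.
have u0 x : 0 <= u x by exact: normr_ge0.
have pom := mom.1. have pla := mla.1. have pli := posfun_inv pla.
have lliE (w : V -> R) : (fun x => w x * ((la x)^-1)^-1) = (fun x => w x * la x).
  by apply/funext => x; rewrite invrK.
apply: (@le_trans _ _ (\int[leb]_(x in hcube Q) \int[leb]_(y in hcube Q) ((u x + u y) * f y * g x)%:E)%E).
  have mH (k : V * V -> R) : measurable_fun setT k ->
    measurable_fun setT (fun p : V * V => (k p * f p.2 * g p.1)%:E).
    move=> mk; apply/measurable_EFinP; apply: measurable_funM.
      apply: measurable_funM => //.
      by have /= := measurableT_comp mf (@measurable_snd _ _ V V).
    by have /= := measurableT_comp mg (@measurable_fst _ _ V V).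
  have m1 (h : V -> R) : measurable_fun setT h -> measurable_fun setT (fun p : V * V => h p.1).
    by move=> mh; have /= := measurableT_comp mh (@measurable_fst _ _ V V).
  have m2 (h : V -> R) : measurable_fun setT h -> measurable_fun setT (fun p : V * V => h p.2).
    by move=> mh; have /= := measurableT_comp mh (@measurable_snd _ _ V V).
  have k1 : measurable_fun setT (fun p : V * V => (`|b p.1 - b p.2| * f p.2 * g p.1)%:E).
    apply: (mH (fun p => `|b p.1 - b p.2|)); apply: measurableT_comp => //.
    by apply: measurable_funB; [exact: m1|exact: m2].
  have k2 : measurable_fun setT (fun p : V * V => ((u p.1 + u p.2) * f p.2 * g p.1)%:E).
    by apply: (mH (fun p => u p.1 + u p.2)); apply: measurable_funD; [exact: m1|exact: m2].
  apply: (le_double_integral mQ k1 k2) => p; first by rewrite lee_fin !mulr_ge0.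
  rewrite lee_fin ler_wpM2r// ler_wpM2r//.
  rewrite (_ : b p.1 - b p.2 = (b p.1 - avg b Q) - (b p.2 - avg b Q)); last by ring.
  exact: ler_normB.
rewrite double_integral_sum//.
pose P := (pm r Q (fun x => f x * om x)%R * pm s Q (fun x => g x * (la x)^-1)%R)%E.
have L0 : 0 < l ^+ n by rewrite exprn_gt0.
have one0 (x : V) : 0 <= (cst 1 : V -> R) x by exact: ler01.
have mone : measurable_fun setT (cst 1 : V -> R) by exact: measurable_cst.
have bf := weighted_hoelder r0 c0 rc Q0 pom mf mone f0 one0.
have bg := weighted_hoelder s0 a0 sa Q0 pli mg mone g0 one0.
have buf := weighted_hoelder r0 c0 rc Q0 pom mf mu f0 u0.
have bug := weighted_hoelder s0 a0 sa Q0 pli mg mu g0 u0.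
have E1 (w : V -> R) : (fun x => cst 1 x * w x) = w by apply/funext => x; rewrite mul1r.
have I1 (w : V -> R) : (\int[leb]_(x in hcube Q) (cst 1 x * w x)%:E = \int[leb]_(x in hcube Q) (w x)%:E)%E.
  by apply: eq_integral => x _; rewrite mul1r.
move: bf bg buf bug; rewrite !E1 !I1.
rewrite (_ : (fun x => ((la x)^-1)^-1) = la); last by apply/funext => x; rewrite invrK.
rewrite lliE => bf bg buf bug.
have i0 (w : V -> R) : (forall x, 0 <= w x) -> (0 <= \int[leb]_(x in hcube Q) (w x)%:E)%E.
  by move=> w0; apply: integral_ge0 => x _; rewrite lee_fin.
have [_ hKo] := mom. have [_ hKl] := mla.
have l2 : 0 <= (l ^+ n) ^+ 2 by rewrite exprn_ge0// ltW.
have AK0 : 0 <= A * K * (l ^+ n) ^+ 2 by exact: (mulr_ge0 (mulr_ge0 A0 K0) l2).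
rewrite mulrDl EFinD [leRHS]ge0_muleDl ?lee_fin//.
apply: leeD.
  apply: (le_trans (lee_pmul (i0 _ (fun x => mulr_ge0 (u0 x) (g0 x))) (i0 _ f0) bug bf)).
  apply: product_of_means; rewrite ?pmean_ge0// ?(ltW L0)//.
  rewrite EFinM; apply: le_trans (lee_wpmul2r (pmean_ge0 _ _ _ _) (hla Q Q0)) _.
  by rewrite -muleA; apply: lee_wpmul2l; rewrite ?lee_fin// hKo.
have ufm : forall x, 0 <= u x * f x by move=> x; rewrite mulr_ge0.
apply: (le_trans (lee_pmul (i0 _ g0) (i0 _ ufm) bg buf)).
apply: product_of_means; rewrite ?pmean_ge0// ?(ltW L0)//.
rewrite EFinM; apply: le_trans (lee_wpmul2l (pmean_ge0 _ _ _ _) (hom Q Q0)) _.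
by rewrite muleCA; apply: lee_wpmul2l; rewrite ?lee_fin// hKl.
Qed.

(** The same estimate with 1 in place of |b(x) - b(y)| and a single weight; it
    gives the weighted bound for the fractional integral itself. *)
Lemma local_size_bound a c r s K om z l f g : 0 < a -> 0 < c -> 0 < r -> 0 < s ->
  r^-1 + c^-1 = 1 -> s^-1 + a^-1 = 1 -> 0 <= K ->
  muck a c K om ->
  0 < l -> measurable_fun setT f -> measurable_fun setT g ->
  (forall x, 0 <= f x) -> (forall x, 0 <= g x) ->
  (\int[leb]_(x in hcube (z, l)) \int[leb]_(y in hcube (z, l)) (1 * f y * g x)%:E <=
   (K * (l ^+ n) ^+ 2)%:E * (pm r (z, l) (fun x => f x * om x)%R *
    pm s (z, l) (fun x => g x * (om x)^-1)%R))%E.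
Proof.
move=> a0 c0 r0 s0 rc sa K0 mom l0 mf mg f0 g0.
pose Q := (z, l); have Q0 : 0 < Q.2 by [].
have mQ : measurable (hcube Q) by exact: measurable_hcube.
have pom := mom.1. have poi := posfun_inv pom.
have m1 (h : V -> R) : measurable_fun setT h -> measurable_fun (hcube Q) (EFin \o h).
  by move=> mh; apply/measurable_EFinP; exact: measurable_funS mh.
have i0 (w : V -> R) : (forall x, 0 <= w x) -> (0 <= \int[leb]_(x in hcube Q) (w x)%:E)%E.
  by move=> w0; apply: integral_ge0 => x _; rewrite lee_fin.
have -> : (\int[leb]_(x in hcube Q) \int[leb]_(y in hcube Q) (1 * f y * g x)%:E =
    (\int[leb]_(x in hcube Q) (g x)%:E) * (\int[leb]_(y in hcube Q) (f y)%:E))%E.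
  rewrite -(ge0_integralZr leb mQ (m1 _ mg) _ (i0 _ f0)); last by move=> x _; rewrite lee_fin.
  apply: eq_integral => x _.
  have gx0 : (0 <= (g x)%:E)%E by rewrite lee_fin.
  rewrite -(ge0_integralZl leb mQ (m1 _ mf) _ gx0); last by move=> y _; rewrite lee_fin.
  by apply: eq_integral => y _; rewrite -EFinM mul1r mulrC.
have one0 (x : V) : 0 <= (cst 1 : V -> R) x by exact: ler01.
have mone : measurable_fun setT (cst 1 : V -> R) by exact: measurable_cst.
have bf := weighted_hoelder r0 c0 rc Q0 pom mf mone f0 one0.
have bg := weighted_hoelder s0 a0 sa Q0 poi mg mone g0 one0.
have E1 (w : V -> R) : (fun x => cst 1 x * w x) = w by apply/funext => x; rewrite mul1r.
have I1 (w : V -> R) : (\int[leb]_(x in hcube Q) (cst 1 x * w x)%:E = \int[leb]_(x in hcube Q) (w x)%:E)%E.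
  by apply: eq_integral => x _; rewrite mul1r.
move: bf bg; rewrite !E1 !I1.
rewrite (_ : (fun x => ((om x)^-1)^-1) = om); last by apply/funext => x; rewrite invrK.
move=> bf bg; apply: (le_trans (lee_pmul (i0 _ g0) (i0 _ f0) bg bf)).
have L0 : 0 <= l ^+ n by rewrite exprn_ge0// ltW.
apply: product_of_means; rewrite ?pmean_ge0//.
exact: mom.2.
Qed.

End majorants.

(** * Bounds for the positive majorants *)

Section forward.
Context {R : realType} {n : nat}.
Hypothesis n0 : (0 < n)%N.
Local Notation leb := (@lebesgue_rV R n).
Local Notation V := ('rV[R]_n).
Implicit Types (x y z : V) (f g h u om la b : V -> R) (Q : V * R).
Local Notation pm a Q f := (pmean leb a (hcube Q) f).

(** The opened exponents a > q and c > p' have conjugates s < q' and r < p, as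
    [riesz_operator_bound] requires. Hoelder in [two_weight_oscillation] needs
    1/a + 1/c <= 1, and indeed 1/q + 1/p' = 1 - alpha/n is below 1. *)
Lemma majorant_bounds alpha p q p' q' K1 K2 B om la b :
  0 < alpha < n%:R -> 1 < p -> 1 < q -> p^-1 + p'^-1 = 1 -> q^-1 + q'^-1 = 1 ->
  q^-1 = p^-1 - alpha / n%:R -> 0 <= B ->
  muck q p' K1 om -> muck q p' K2 la -> measurable_fun setT b ->
  (forall Q, 0 < Q.2 -> leb.-integrable (hcube Q) (EFin \o b)) ->
  (forall Q, 0 < Q.2 -> ((avg (fun x => `|b x - avg b Q|) Q)%:E <=
     B%:E * pm 1 Q (fun x => om x / la x)%R)%E) ->
  exists2 C : R, 0 < C & forall f T, measurable_fun setT f -> (forall x, 0 <= f x) -> 0 < T ->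
    (\int[leb]_x ((f x * om x) `^ p)%:E <= (T `^ p)%:E)%E ->
    (\int[leb]_x ((la x)%:E * \int[leb]_y (`|b x - b y| * f y * riesz alpha (x, y))%:E) `^ q <=
      ((C * T) `^ q)%:E)%E /\
    (\int[leb]_x ((om x)%:E * \int[leb]_y (1 * f y * riesz alpha (x, y))%:E) `^ q <=
      ((C * T) `^ q)%:E)%E.
Proof.
move=> alphan p1 q1 pp qq pq B0 hom hla mb ib hB.
have [a0 an] := andP alphan.
have n0' : 0 < n%:R :> R by rewrite ltr0n.
have an0 : 0 < alpha / n%:R by rewrite divr_gt0.
have p0 : 0 < p := lt_trans ltr01 p1. have q0 : 0 < q := lt_trans ltr01 q1.
have pi1 : p^-1 < 1 by rewrite invf_lt1.
have qi1 : q^-1 < 1 by rewrite invf_lt1.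
have pi0 : 0 < p^-1 by rewrite invr_gt0.
have qi0 : 0 < q^-1 by rewrite invr_gt0.
have p'0 : 0 < p' by rewrite -invr_gt0; lra.
have q'0 : 0 < q' by rewrite -invr_gt0; lra.
have [a [c [K [qa pc K0 moma mlaa]]]] := muck_open_common q0 p'0 hom hla.
have a00 : 0 < a := lt_trans q0 qa. have c0 : 0 < c := lt_trans p'0 pc.
have ai : a^-1 < q^-1 by rewrite ltf_pV2.
have ci : c^-1 < p'^-1 by rewrite ltf_pV2.
have ai0 : 0 < a^-1 by rewrite invr_gt0.
have ci0 : 0 < c^-1 by rewrite invr_gt0.
have ac : a^-1 + c^-1 <= 1 by lra.
pose r := (1 - c^-1)^-1; pose s := (1 - a^-1)^-1.
have r0 : 0 < r by rewrite invr_gt0; lra.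
have s0 : 0 < s by rewrite invr_gt0; lra.
have rc : r^-1 + c^-1 = 1 by rewrite invrK; lra.
have sa : s^-1 + a^-1 = 1 by rewrite invrK; lra.
have rp : r < p by rewrite -(invrK p) ltf_pV2 ?posrE ?invr_gt0//; lra.
have sq : s < q' by rewrite -(invrK q') ltf_pV2 ?posrE ?invr_gt0//; lra.
have pom := moma.1. have pla := mlaa.1.
have poi := posfun_inv pom. have pli := posfun_inv pla.
have [A1 A10 h1] := two_weight_oscillation a00 c0 ac K0 B0 moma mlaa mb ib hB.
have ca : c^-1 + a^-1 <= 1 by lra.
have hB' Q : 0 < Q.2 -> ((avg (fun x => `|b x - avg b Q|) Q)%:E <=
     B%:E * pm 1 Q (fun x => (la x)^-1 / (om x)^-1)%R)%E.
  move=> Q0; rewrite (_ : (fun x => (la x)^-1 / (om x)^-1) = (fun x => om x / la x)); first exact: hB.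
  by apply/funext => x; rewrite invrK mulrC.
have [A2 A20 h2] := two_weight_oscillation c0 a00 ca K0 B0 (muckV mlaa) (muckV moma) mb ib hB'.
pose A := A1 + A2.
have A0 : 0 <= A by rewrite addr_ge0.
have h1' Q : 0 < Q.2 -> (pm a Q (fun x => `|b x - avg b Q| * la x)%R <= A%:E * pm a Q om)%E.
  by move=> Q0; apply: le_trans (h1 Q Q0) _; rewrite lee_wpmul2r ?pmean_ge0// lee_fin lerDl.
have h2' Q : 0 < Q.2 -> (pm c Q (fun x => `|b x - avg b Q| * (om x)^-1)%R <=
     A%:E * pm c Q (fun x => (la x)^-1)%R)%E.
  by move=> Q0; apply: le_trans (h2 Q Q0) _; rewrite lee_wpmul2r ?pmean_ge0// lee_fin lerDr.
have mH1 : measurable_fun setT (fun w : V * V => `|b w.1 - b w.2|).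
  apply: measurableT_comp => //; apply: measurable_funB.
    by have /= := measurableT_comp mb (@measurable_fst _ _ V V).
  by have /= := measurableT_comp mb (@measurable_snd _ _ V V).
have AK0 : 0 <= A * K + A * K by rewrite addr_ge0 ?mulr_ge0.
have [C1 C10 hC1] := @riesz_operator_bound R n n0 alpha p q q' r s (A * K + A * K)
  (fun w : V * V => `|b w.1 - b w.2|) om (fun x => (la x)^-1) alphan p1 q1 qq pq r0 rp s0 sq
  AK0 mH1 (fun w => normr_ge0 _) pom pli
  (fun z l f g hl mf mg hf hg => local_oscillation_bound z a00 c0 r0 s0 rc sa K0 A0
     moma mlaa mb h1' h2' hl mf mg hf hg).
have mH2 : measurable_fun setT ((fun=> 1) : V * V -> R) by exact: measurable_cst.
have one0 (w : V * V) : 0 <= ((fun=> 1) : V * V -> R) w by exact: ler01.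
have [C2 C20 hC2] := @riesz_operator_bound R n n0 alpha p q q' r s K
  (fun w : V * V => 1) om (fun x => (om x)^-1) alphan p1 q1 qq pq r0 rp s0 sq
  K0 mH2 one0 pom poi
  (fun z l f g hl mf mg hf hg => local_size_bound z a00 c0 r0 s0 rc sa K0 moma hl mf mg hf hg).
exists (C1 + C2); first exact: addr_gt0.
move=> f T mf f0 T0 hf; split.
  apply: (le_trans (y := ((C1 * T) `^ q)%:E)); last first.
    rewrite lee_fin ge0_ler_powR ?nnegrE ?(ltW q0)// ?mulr_ge0 ?addr_ge0 ?(ltW T0) ?(ltW C10) ?(ltW C20)//.
    by rewrite ler_wpM2r ?(ltW T0)// lerDl ltW.
  apply: le_trans (hC1 f T mf f0 T0 hf).
  rewrite le_eqVlt; apply/orP; left; apply/eqP; apply: eq_integral => x _.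
  by rewrite invrK.
apply: (le_trans (y := ((C2 * T) `^ q)%:E)); last first.
  rewrite lee_fin ge0_ler_powR ?nnegrE ?(ltW q0)// ?mulr_ge0 ?addr_ge0 ?(ltW T0) ?(ltW C10) ?(ltW C20)//.
  by rewrite ler_wpM2r ?(ltW T0)// lerDr ltW.
apply: le_trans (hC2 f T mf f0 T0 hf).
rewrite le_eqVlt; apply/orP; left; apply/eqP; apply: eq_integral => x _.
by rewrite invrK.
Qed.

End forward.

(** * Homogeneous functions of degree zero *)

Section angular.
Context {R : realType} {n : nat}.
Local Notation leb := (@lebesgue_rV R n).
Local Notation V := ('rV[R]_n).
Implicit Types (x y z : V) (Omega : V -> R).

Lemma enorm_ge0 x : 0 <= enorm x. Proof. exact: sqrtr_ge0. Qed.

Lemma enormZ (t : R) x : enorm (t *: x) = `|t| * enorm x.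
Proof.
rewrite /enorm -sqrtr_sqr -sqrtrM ?sqr_ge0//; congr Num.sqrt.
by rewrite mulr_sumr; apply: eq_bigr => i _; rewrite mxE exprMn.
Qed.

Lemma enorm_gt0 x : x != 0 -> 0 < enorm x.
Proof.
move=> x0; have [i xi] : exists i, x ord0 i != 0.
  apply: contrapT => h; move/eqP: x0; apply; apply/rowP => i; rewrite mxE.
  by apply/eqP/negP => hi; apply: h; exists i; exact/negP.
by apply: lt_le_trans (coord_le_enorm x i); rewrite normr_gt0.
Qed.

Lemma enorm_continuous : continuous (@enorm R n).
Proof.
have c1 i : continuous (fun x : V => x ord0 i ^+ 2).
  move=> x; apply: (@continuous_comp _ _ _ (fun x : V => x ord0 i) (fun t : R => t ^+ 2)).
    exact: coord_continuous.
  exact: exprn_continuous.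
have cont_sum (s : seq 'I_n) : continuous (fun x : V => \sum_(i <- s) x ord0 i ^+ 2).
  elim: s => [|i s ih].
    by under eq_fun do rewrite big_nil; exact: cst_continuous.
  under eq_fun do rewrite big_cons.
  by move=> x; exact: cvgD (c1 i x) (ih x).
move=> x; apply: (@continuous_comp _ _ _ (fun x : V => \sum_(i < n) x ord0 i ^+ 2) Num.sqrt).
  exact: cont_sum.
exact: sqrt_continuous.
Qed.

Lemma unit_sphere_compact : compact (@unit_sphere R n).
Proof.
apply: bounded_closed_compact.
  exists 1; split => // M M1 x /= x1.
  rewrite [leLHS]/Num.norm /= mx_normrE; apply: bigmax_le; first by rewrite (le_trans ler01)// ltW.
  move=> i _; rewrite (ord1 i.1) (le_trans (coord_le_enorm _ _))// x1 ltW//.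
rewrite (_ : unit_sphere = @enorm R n @^-1` [set 1])//.
apply: closed_comp => [x _|]; first exact: enorm_continuous.
exact/accessible_closed_set1/hausdorff_accessible/Rhausdorff.
Qed.

Definition direction z := (enorm z)^-1 *: z.

Lemma direction_sphere z : z != 0 -> unit_sphere (direction z).
Proof.
move=> z0; rewrite /unit_sphere /= /direction enormZ ger0_norm ?invr_ge0 ?enorm_ge0//.
by rewrite mulVf// gt_eqF// enorm_gt0.
Qed.

Lemma direction_cvg z : z != 0 -> direction y @[y --> z] --> direction z.
Proof.
move=> z0; have e0 : enorm z != 0 by rewrite gt_eqF// enorm_gt0.
exact: (cvgZ (cvgV e0 (@enorm_continuous z)) cvg_id).
Qed.

Lemma homogeneous_direction Omega z : homogeneous0 Omega -> z != 0 ->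
  Omega (direction z) = Omega z.
Proof. by move=> h z0; apply: h => //; rewrite invr_gt0 enorm_gt0. Qed.

Lemma open_nonzero : open (~` [set (0 : V)]).
Proof.
apply: closed_openC; apply: accessible_closed_set1; apply: hausdorff_accessible.
exact: norm_hausdorff.
Qed.

(** Omega is the composite of its restriction to the sphere with the
    continuous map that sends z to z / |z|. *)
Lemma homogeneous_continuous Omega z : {within unit_sphere, continuous Omega} ->
  homogeneous0 Omega -> z != 0 -> Omega y @[y --> z] --> Omega z.
Proof.
move=> /subspace_continuousP cO hO z0 U.
rewrite -(homogeneous_direction hO z0) => /(cO _ (direction_sphere z0)) => h.
have h' : \forall y \near z, unit_sphere (direction y) -> U (Omega (direction y)) := direction_cvg z0 h.
have zn : \forall y \near z, y != 0.
  have : nbhs z (~` [set (0 : V)]).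
    by apply: open_nbhs_nbhs; split; [exact: open_nonzero|exact/eqP].
  by apply: filterS => y /eqP.
change (\forall y \near z, U (Omega y)).
near=> y; rewrite -(homogeneous_direction hO); last by near: y.
have hy : y != 0 by near: y.
by have := near h' y; apply => //; exact: direction_sphere.
Unshelve. all: end_near.
Qed.

Lemma homogeneous_bounded Omega : {within unit_sphere, continuous Omega} ->
  homogeneous0 Omega -> exists2 M : R, 0 <= M & forall z, z != 0 -> `|Omega z| <= M.
Proof.
move=> cO hO.
have /compact_bounded [M [Mr hM]] := continuous_compact cO unit_sphere_compact.
exists (`|M| + 1); first by rewrite addr_ge0.
move=> z z0; rewrite -(homogeneous_direction hO z0).
apply: (hM (`|M| + 1)); first by rewrite (le_lt_trans (ler_norm M))// ltrDl.
by exists (direction z) => //; exact: direction_sphere.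
Qed.

(** An open set is the union of the countably many rational boxes that it
    contains. This is what connects the topology of row vectors with their
    product sigma-algebra. *)
Lemma open_measurable_rV (U : set V) : open U -> measurable U.
Proof.
move=> oU.
pose box (q : 'rV[rat]_n * nat) : set V := [set x | forall i,
   `]ratr (q.1 ord0 i) - q.2.+1%:R^-1, ratr (q.1 ord0 i) + q.2.+1%:R^-1[%classic (x ord0 i)].
pose F q := if pselect (box q `<=` U) then box q else set0.
rewrite (_ : U = \bigcup_q F q).
  apply: countable_bigcupT_measurable => [|q]; first exact: (@countableP ('rV[rat]_n * nat)%type).
  rewrite /F; case: pselect => [?|?]; last exact: measurable0.
  by apply: (@measurable_box _ _ (fun i => `]_, _[%classic)) => i; exact: measurable_itv.
apply/seteqP; split; last first.
  by move=> x [q _]; rewrite /F; case: pselect => // h; exact: h.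
move=> x Ux; have /nbhs_ballP [e /= e0 he] : nbhs x U by exact: open_nbhs_nbhs.
have [k hk] : exists k : nat, k.+1%:R^-1 + k.+1%:R^-1 < e.
  exists (Num.truncn (2 / e)).
  have h := truncnS_gt (2 / e).
  have k0 : 0 < (Num.truncn (2 / e)).+1%:R :> R by [].
  rewrite (_ : _ + _ = 2 / (Num.truncn (2 / e)).+1%:R); last by ring.
  by rewrite ltr_pdivrMr// mulrC -ltr_pdivrMr.
pose d : R := k.+1%:R^-1; have d0 : 0 < d by rewrite invr_gt0.
have hq i : exists r : rat, x ord0 i - d < ratr r < x ord0 i + d.
  have h : x ord0 i - d < x ord0 i + d by rewrite ltrD2l; lra.
  by have [r] := rat_in_itvoo h; rewrite in_itv/=; exists r.
have [r hr] := choice hq.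
have Fx : box (\row_i r i, k) x.
  move=> i; rewrite /= mxE in_itv/=; have /andP[? ?] := hr i.
  by rewrite -/d; apply/andP; split; lra.
exists (\row_i r i, k) => //; rewrite /F; case: pselect => // nU; exfalso; apply: nU.
move=> y hy; apply: he; split => // i j; rewrite (ord1 i) /ball /= ltr_norml.
have := hy j; have := Fx j; rewrite /= mxE !in_itv/= -/d => /andP[? ?] /andP[? ?].
by move: hk; rewrite -/d => hk; apply/andP; split; lra.
Qed.

Lemma homogeneous_measurable Omega : {within unit_sphere, continuous Omega} ->
  homogeneous0 Omega -> measurable_fun (~` [set (0 : V)]) Omega.
Proof.
move=> cO hO; have mD := open_measurable_rV open_nonzero; apply: (measurability _ (RGenOpens.measurableE R)) => //.
move=> _ [_ [a [b ->] <-]]; apply: open_measurable_rV.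
rewrite openE => z [/eqP z0 hz]; rewrite /interior.
have h1 : nbhs z (~` [set (0 : V)]).
  by apply: open_nbhs_nbhs; split; [exact: open_nonzero|exact/eqP].
have h2 : nbhs z (Omega @^-1` `]a, b[%classic).
  apply: (homogeneous_continuous cO hO z0).
  by apply: open_nbhs_nbhs; split => //; exact: interval_open.
by apply: filterS2 h1 h2.
Qed.

End angular.

(** * From closed cubes and a.e. weights to half-open cubes and positive weights *)

Section transfer.
Context {R : realType} {n : nat}.
Local Notation leb := (@lebesgue_rV R n).
Local Notation V := ('rV[R]_n).
Implicit Types (x y z a : V) (f g u v b : V -> R) (Q : V * R).
Local Notation pm a Q f := (pmean leb a (hcube Q) f).

(** Weights are only positive almost everywhere; this version is positive
    everywhere, so that division and real powers need no side conditions. *)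
Definition positive_version v x : R := if 0 < v x then v x else 1.

Lemma posfun_positive_version v : measurable_fun setT v -> posfun (positive_version v).
Proof.
move=> mv; split; last by move=> x; rewrite /positive_version; case: ifPn.
apply: measurable_fun_ifT => //; exact: measurable_fun_ltr.
Qed.

Lemma positive_versionE v : {ae leb, forall x, 0 < v x} ->
  {ae leb, forall x, v x = positive_version v x}.
Proof. by apply: filterS => x h; rewrite /positive_version h. Qed.

Lemma ae_eq_integral_comp (D : set V) (F G : V -> \bar R) : measurable D ->
  measurable_fun setT F -> measurable_fun setT G -> {ae leb, forall x, F x = G x} ->
  (\int[leb]_(x in D) F x = \int[leb]_(x in D) G x)%E.
Proof.
move=> mD mF mG h; apply: ae_eq_integral => //.
- exact: measurable_funS mF.
- exact: measurable_funS mG.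
- by apply: filterS h => x.
Qed.

Lemma sub_hcube_cube a (l : R) : hcube (a, l) `<=` cube a l.
Proof. by move=> x h i; have /andP[/= -> /ltW ->] := h i. Qed.

(** The faces of a cube are null sets. *)
Lemma integral_cube a (l : R) (F : V -> \bar R) : 0 < l -> measurable_fun setT F ->
  (\int[leb]_(x in cube a l) F x = \int[leb]_(x in hcube (a, l)) F x)%E.
Proof.
move=> l0 mF; have mC := measurable_cube a l. have mH := measurable_hcube (a, l).
rewrite [LHS]integral_mkcond [RHS]integral_mkcond.
have mr (D : set V) : measurable D -> measurable_fun setT (F \_ D).
  by move=> mD; apply: (measurable_restrictT F mD).1; exact: measurable_funS mF.
apply: ae_eq_integral_comp => //; [exact: mr|exact: mr|].
exists (cube a l `\` hcube (a, l)); split; first exact: measurableD.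
- change (leb (cube a l `\` hcube (a, l)) = 0)%E.
  rewrite measureD//; last by have := leb_cube a l0 => /= ->; rewrite ltry.
  rewrite (setIidr (@sub_hcube_cube a l)).
  have := leb_cube a l0 => /= ->; have := @leb_hcube R n (a, l) l0 => /= ->.
  by rewrite subee.
- move=> x /= hx; split.
    apply: contrapT => nc; apply: hx.
    rewrite !patchE !memNset// => hh; apply: nc; exact: sub_hcube_cube hh.
  by move=> hh; apply: hx; rewrite !patchE !mem_set//; exact: sub_hcube_cube.
Qed.

Lemma fine_leb_cube a (l : R) : 0 < l ->
  fine ((leb : {measure set _ -> \bar R}) (cube a l)) = l ^+ n.
Proof. by move=> l0; have := leb_cube a l0 => /= ->. Qed.

Lemma mean_cube a (l : R) f : 0 < l -> measurable_fun setT f ->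
  mean f (cube a l) = avg f (a, l).
Proof.
move=> l0 mf; rewrite /avg /mean fine_leb_cube// fine_leb_hcube//.
by rewrite /Rintegral integral_cube//; exact/measurable_EFinP.
Qed.

Lemma cube_compact a (l : R) : compact (cube a l).
Proof.
rewrite cubeE; apply: (@rV_compact _ n (fun i => `[a ord0 i, a ord0 i + l]%classic)) => i.
exact: segment_compact.
Qed.

Lemma L1loc_integrable b Q : L1loc b -> leb.-integrable (hcube Q) (EFin \o b).
Proof.
move=> [mb hb]; apply/integrableP; split.
  by apply/measurable_EFinP; exact: measurable_funS mb.
apply: (@le_lt_trans _ _ (\int[leb]_(x in cube Q.1 Q.2) `|b x|%:E)%E); last exact: (hb _ (@cube_compact Q.1 Q.2)).
have mnb : measurable_fun setT (fun x => `|b x|%:E).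
  by apply/measurable_EFinP; exact: measurableT_comp.
apply: (@ge0_subset_integral _ _ _ leb (hcube Q) (cube Q.1 Q.2)) => //.
- exact: measurable_hcube.
- exact: measurable_cube.
- exact: measurable_funS mnb.
- by case: Q => q l; exact: sub_hcube_cube.
Qed.

Lemma pmean_hcubeE (t : R) Q u : 0 < Q.2 ->
  (pm t Q u = (((Q.2 ^+ n)^-1)%:E * \int[leb]_(x in hcube Q) (u x `^ t)%:E) `^ t^-1)%E.
Proof. by move=> Q0; rewrite /pmean fine_leb_hcube. Qed.

Lemma inve_leb_cube a (l : R) : 0 < l -> ((leb (cube a l))^-1 = ((l ^+ n)^-1)%:E)%E.
Proof.
by move=> l0; have := leb_cube a l0 => /= ->; rewrite inver gt_eqF// exprn_gt0.
Qed.

Lemma integral_cube_positive (s t : R) v u a (l : R) : 0 < l ->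
  measurable_fun setT v -> measurable_fun setT u -> {ae leb, forall x, 0 < v x} ->
  (forall x, u x `^ s = positive_version v x `^ t) ->
  (\int[leb]_(x in hcube (a, l)) (u x `^ s)%:E = \int[leb]_(x in cube a l) (v x `^ t)%:E)%E.
Proof.
move=> l0 mv mu v0 uw.
have mvt : measurable_fun setT (fun x => (v x `^ t)%:E).
  by apply/measurable_EFinP; exact: measurable_powR_comp.
rewrite (integral_cube a l0 mvt); apply: (ae_eq_integral_comp (measurable_hcube (a, l)) _ mvt).
  by apply/measurable_EFinP; exact: measurable_powR_comp.
by apply: filterS (positive_versionE v0) => x vx; rewrite uw -vx.
Qed.

Lemma Apq_constE p q v a (l : R) : 0 < l -> measurable_fun setT v ->
  {ae leb, forall x, 0 < v x} ->
  (Apq_const p q v (cube a l) = pm q (a, l) (positive_version v) *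
     pm (conj_exponent p) (a, l) (fun x => (positive_version v x)^-1)%R)%E.
Proof.
move=> l0 mv v0; have pw : posfun (positive_version v) := posfun_positive_version mv.
have E1 := integral_cube_positive (s := q) (t := q) a l0 mv pw.1 v0 (fun x => erefl).
have E2 := integral_cube_positive (s := conj_exponent p) (t := - conj_exponent p)
  a l0 mv (posfun_inv pw).1 v0.
have E3 x : (positive_version v x)^-1 `^ conj_exponent p = positive_version v x `^ (- conj_exponent p).
  by rewrite -powR_inv1; [rewrite -powRrM mulN1r|exact: ltW (pw.2 x)].
rewrite (@pmean_hcubeE q (a, l) _ l0) (@pmean_hcubeE (conj_exponent p) (a, l) _ l0).
by rewrite E1 (E2 E3) -(inve_leb_cube a l0).
Qed.

Lemma Apq_muck p q v : Apq p q v ->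
  exists K, muck q (conj_exponent p) K (positive_version v).
Proof.
move=> [[[mv _] v0] hs].
have le1 a (l : R) : 0 < l ->
    (Apq_const p q v (cube a l) <= ereal_sup [set Apq_const p q v Q | Q in cubes])%E.
  by move=> l0; apply: ereal_sup_ubound; exists (cube a l) => //; exists a, l.
move: hs le1; set S := ereal_sup _ => hs le1; clearbody S.
exists (fine S); split => [|[a l] /= l0]; first exact: posfun_positive_version.
rewrite -Apq_constE//; have := le1 a l l0 => h.
have S0 : (0 <= S)%E by apply: le_trans h; rewrite mule_ge0// poweR_ge0.
by rewrite fineK// ge0_fin_numE.
Qed.

(** The inverse in the definition of the oscillation is an extended real. The
    integral of the positive function m is positive; when it is infinite, its
    inverse is 0 on one side and the bound is trivial on the other, as B > 0. *)
Lemma BMO_le (mu m : V -> R) b : measurable_fun setT mu -> posfun m ->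
  {ae leb, forall x, mu x = m x} -> measurable_fun setT b ->
  (BMO mu b <-> exists2 B : R, 0 < B & forall a (l : R), 0 < l ->
    (\int[leb]_(x in hcube (a, l)) `|b x - avg b (a, l)|%:E <=
     B%:E * \int[leb]_(x in hcube (a, l)) (m x)%:E)%E).
Proof.
move=> mmu pmm aem mb.
have oscE a (l : R) : 0 < l -> weighted_oscillation mu b (cube a l) =
   ((\int[leb]_(x in hcube (a, l)) (m x)%:E)^-1 *
     \int[leb]_(x in hcube (a, l)) `|b x - avg b (a, l)|%:E)%E.
  move=> l0; rewrite /weighted_oscillation mean_cube//.
  rewrite integral_cube//; last exact/measurable_EFinP.
  rewrite integral_cube//; last first.
    by apply/measurable_EFinP; apply: measurableT_comp => //; exact: measurable_funB.
  congr (_^-1 * _)%E; apply: ae_eq_integral_comp; first exact: measurable_hcube.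
  - exact/measurable_EFinP.
  - by apply/measurable_EFinP; exact: pmm.1.
  - by apply: filterS aem => x ->.
have I0 a (l : R) : 0 < l -> (0 < \int[leb]_(x in hcube (a, l)) (m x)%:E)%E.
  move=> l0; have h := @pm_gt0 R n 1 (a, l) m ltr01 l0 pmm.
  rewrite lt_neqAle integral_ge0 ?andbT; last by move=> x _; rewrite lee_fin ltW// pmm.2.
  apply/eqP => e; move: h; rewrite /pmean.
  under eq_integral do rewrite powRr1 ?(ltW (pmm.2 _))//.
  by rewrite -e mule0 poweR0r ?invr1 ?oner_eq0// ltxx.
have J0 a (l : R) : (0 <= \int[leb]_(x in hcube (a, l)) `|b x - avg b (a, l)|%:E)%E.
  by apply: integral_ge0 => x _; rewrite lee_fin.
split=> [h|[B B0 h]].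
  pose S := ereal_sup [set weighted_oscillation mu b Q | Q in cubes].
  have leS a (l : R) : 0 < l -> (weighted_oscillation mu b (cube a l) <= S)%E.
    by move=> l0; apply: ereal_sup_ubound; exists (cube a l) => //; exists a, l.
  exists (`|fine S| + 1); first by rewrite ltr_wpDl.
  move=> a l l0; have := leS a l l0; rewrite oscE//.
  have := I0 a l l0; have := J0 a l.
  set I := (\int[leb]_(x in _) (m x)%:E)%E; set J := (\int[leb]_(x in _) _)%E.
  case: I => [i| |]//; last first.
    by move=> _ _ _; rewrite gt0_muley ?leey// lte_fin ltr_wpDl.
  rewrite lte_fin => J00 i0; rewrite inver gt_eqF// => hJ.
  have Sf : S \is a fin_num.
    by rewrite ge0_fin_numE//; apply: le_trans hJ; rewrite mule_ge0// lee_fin invr_ge0 ltW.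
  rewrite -(fineK Sf) in hJ.
  have := lee_wpmul2l (_ : (0 <= i%:E)%E) hJ; rewrite lee_fin (ltW i0) => /(_ isT).
  rewrite muleA -EFinM mulfV ?gt_eqF// mul1e => /le_trans; apply.
  rewrite muleC lee_wpmul2r ?lee_fin ?(ltW i0)//.
  by apply: le_trans (ler_norm _) _; rewrite lerDl.
apply: (@le_lt_trans _ _ B%:E); last exact: ltry.
apply: ge_ereal_sup => _ [_ [a [l [l0 ->]]] <-]; rewrite oscE//.
have := h a l l0; have := I0 a l l0; have := J0 a l.
set I := (\int[leb]_(x in _) (m x)%:E)%E; set J := (\int[leb]_(x in _) _)%E.
case: I => [i| |]//; last by move=> _ _ _; rewrite invey mul0e lee_fin ltW.
rewrite lte_fin => J00 i0 hJ; rewrite inver gt_eqF//.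
have := lee_wpmul2l (_ : (0 <= i^-1%:E)%E) hJ; rewrite lee_fin invr_ge0 (ltW i0) => /(_ isT).
by rewrite muleCA -(EFinM i^-1 i) mulVf ?gt_eqF// mule1.
Qed.

Lemma avg_le_pm m b (B : R) Q : 0 < Q.2 -> posfun m -> L1loc b ->
  (\int[leb]_(x in hcube Q) `|b x - avg b Q|%:E <= B%:E * \int[leb]_(x in hcube Q) (m x)%:E)%E ->
  ((avg (fun x => `|b x - avg b Q|) Q)%:E <= B%:E * pm 1 Q m)%E.
Proof.
move=> Q0 pmm Lb h.
have ib : leb.-integrable (hcube Q) (EFin \o (fun x => `|b x - avg b Q|)).
  have := integrable_abse (integrableB (measurable_hcube Q) (L1loc_integrable Q Lb) (integrable_cst_hcube (avg b Q) Q0)).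
  by apply: eq_integrable => //; exact: measurable_hcube.
have V0 : 0 < Q.2 ^+ n by rewrite exprn_gt0.
rewrite /pmean invr1 poweRe1; last by rewrite mule_ge0 ?pint_ge0 ?fat_inv_ge0.
under eq_integral do rewrite powRr1 ?(ltW (pmm.2 _))//.
rewrite fine_leb_hcube// muleCA.
have := lee_wpmul2l (_ : (0 <= ((Q.2 ^+ n)^-1)%:E)%E) h; rewrite lee_fin invr_ge0 (ltW V0) => /(_ isT).
apply: le_trans; rewrite -avgM// leb_hcube//.
by rewrite muleCA -(EFinM (Q.2 ^+ n)^-1 (Q.2 ^+ n)) mulVf ?gt_eqF// mule1.
Qed.

End transfer.

(** * The kernel and the pointwise majorant of the commutator *)

Section kernel.
Context {R : realType} {n : nat}.
Local Notation leb := (@lebesgue_rV R n).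
Local Notation V := ('rV[R]_n).
Implicit Types (x y z a : V) (f g u v b Omega : V -> R) (Q : V * R).

Lemma fractional_kernel_riesz Omega alpha x y :
  fractional_kernel Omega alpha x y = Omega (x - y) * riesz alpha (x, y).
Proof. by rewrite /fractional_kernel /riesz /= -(opprB n%:R) powRN. Qed.

(** Omega may be arbitrary at 0. Measurability holds all the same, because the
    kernel vanishes on the diagonal: there the power of the norm is 0, and so
    is its inverse. *)
Lemma measurable_kernel Omega alpha : alpha < n%:R ->
  {within unit_sphere, continuous Omega} -> homogeneous0 Omega ->
  measurable_fun setT (fun p : V * V => fractional_kernel Omega alpha p.1 p.2).
Proof.
move=> an cO hO.
have mz : measurable (~` [set (0 : V)]) := open_measurable_rV open_nonzero.
have mG : measurable_fun setT (Omega \_ (~` [set (0 : V)])).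
  by apply: (measurable_restrictT _ mz).1; exact: homogeneous_measurable.
rewrite (_ : (fun p => _) = fun p : V * V =>
   (Omega \_ (~` [set (0 : V)])) (p.1 - p.2) * riesz alpha p).
  apply: measurable_funM; last exact: measurable_riesz.
  exact: (measurableT_comp mG measurable_subV).
apply/funext => -[x y] /=; rewrite fractional_kernel_riesz patchE.
case: ifPn => // /negP h.
have xy : x - y = 0 by apply: contrapT => ne; apply: h; exact: mem_set.
have e0 : enorm (0 : V) = 0.
  by rewrite /enorm big1 ?sqrtr0// => i _; rewrite mxE expr0n.
by rewrite /riesz /= xy e0 powR0 ?mulr0// lt_eqF// subr_lt0.
Qed.

Lemma kernel_le Omega alpha (M : R) x y : alpha < n%:R ->
  (forall z, z != 0 -> `|Omega z| <= M) ->
  `|fractional_kernel Omega alpha x y| <= M * riesz alpha (x, y).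
Proof.
move=> an hM; rewrite fractional_kernel_riesz normrM (ger0_norm (riesz_ge0 _ _)).
have [xy|xy] := eqVneq x y; last by rewrite ler_wpM2r ?riesz_ge0// hM// subr_eq0.
have e0 : enorm (0 : V) = 0.
  by rewrite /enorm big1 ?sqrtr0// => i _; rewrite mxE expr0n.
by rewrite /riesz /= xy subrr e0 powR0 ?mulr0// lt_eqF// subr_lt0.
Qed.

Lemma measurable_Rinner (h : V * V -> R) : measurable_fun setT h ->
  measurable_fun setT (fun x => \int[leb]_y h (x, y)).
Proof.
move=> mh; rewrite /Rintegral; apply: measurableT_comp => //.
have mE : measurable_fun setT (EFin \o h) by exact/measurable_EFinP.
rewrite (_ : (fun x => _) = fun x =>
  (\int[leb]_y (EFin \o h)^\+ (x, y) - \int[leb]_y (EFin \o h)^\- (x, y))%E).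
  apply: emeasurable_funB.
    by apply: measurable_inner => //; exact: measurable_funepos.
  by apply: measurable_inner => //; exact: measurable_funeneg.
by apply/funext => x; rewrite [LHS]integralE; congr (_ - _)%E; apply: eq_integral => y _;
  rewrite ?funeposE ?funenegE.
Qed.

Lemma measurable_commutator Omega alpha b f : alpha < n%:R ->
  {within unit_sphere, continuous Omega} -> homogeneous0 Omega ->
  measurable_fun setT b -> measurable_fun setT f ->
  measurable_fun setT (commutator Omega alpha b f).
Proof.
move=> an cO hO mb mf.
have mT g : measurable_fun setT g -> measurable_fun setT (fractional_integral Omega alpha g).
  move=> mg; apply: (@measurable_Rinner (fun p => fractional_kernel Omega alpha p.1 p.2 * g p.2)).
  apply: measurable_funM; first exact: measurable_kernel.
  by have /= := measurableT_comp mg (@measurable_snd _ _ V V).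
apply: measurable_funB; last by apply: mT; exact: measurable_funM.
by apply: measurable_funM => //; exact: mT.
Qed.

Lemma commutator_integralE Omega alpha b f x :
  fractional_integral_defined Omega alpha f x ->
  fractional_integral_defined Omega alpha (b \* f) x ->
  leb.-integrable setT (EFin \o (fun y => (b x - b y) * (fractional_kernel Omega alpha x y * f y))) /\
  commutator Omega alpha b f x =
    \int[leb]_y ((b x - b y) * (fractional_kernel Omega alpha x y * f y)).
Proof.
move=> d1 d2; have d1' := integrableZl measurableT (b x) d1.
split; last first.
  rewrite /commutator /fractional_integral -RintegralZl// -RintegralB//.
  by apply: eq_Rintegral => y _ /=; ring.
have := integrableB measurableT d1' d2; apply: eq_integrable => // y _ /=.
by rewrite -EFinM -EFinB; congr _%:E; ring.
Qed.

(** The triangle inequality |b(y)| <= |b(x) - b(y)| + |b(x)| gives the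
    absolute convergence of the integral with b f, and then both integrals
    combine into one with the factor b(x) - b(y). *)
Lemma commutator_pointwise Omega alpha (M : R) b f x : alpha < n%:R ->
  {within unit_sphere, continuous Omega} -> homogeneous0 Omega ->
  0 <= M -> (forall z, z != 0 -> `|Omega z| <= M) ->
  measurable_fun setT b -> measurable_fun setT f ->
  (\int[leb]_y (`|b x - b y| * `|f y| * riesz alpha (x, y))%:E < +oo)%E ->
  (\int[leb]_y (1 * `|f y| * riesz alpha (x, y))%:E < +oo)%E ->
  [/\ fractional_integral_defined Omega alpha f x,
      fractional_integral_defined Omega alpha (b \* f) x &
      (`|commutator Omega alpha b f x|%:E <=
        M%:E * \int[leb]_y (`|b x - b y| * `|f y| * riesz alpha (x, y))%:E)%E].
Proof.
move=> an cO hO M0 hM mb mf h1 h2.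
have mk : measurable_fun setT (fun y => fractional_kernel Omega alpha x y).
  exact: (measurableT_comp (measurable_kernel an cO hO) (@measurable_pair1 _ _ V V x)).
have mr : measurable_fun setT (fun y => riesz alpha (x, y)).
  exact: (measurableT_comp (measurable_riesz alpha) (@measurable_pair1 _ _ V V x)).
have mnf : measurable_fun setT (fun y => `|f y|) by exact: measurableT_comp.
have mbb : measurable_fun setT (fun y => `|b x - b y|).
  by apply: measurableT_comp => //; exact: measurable_funB.
have r0 y : 0 <= riesz alpha (x, y) by exact: riesz_ge0.
have mB : measurable_fun setT (fun y => (`|b x - b y| * `|f y| * riesz alpha (x, y))%:E).
  by apply/measurable_EFinP; apply: measurable_funM => //; exact: measurable_funM.
have m1 : measurable_fun setT (fun y => (1 * `|f y| * riesz alpha (x, y))%:E).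
  by apply/measurable_EFinP; apply: measurable_funM => //; exact: measurable_funM.
have B0 y : (0 <= (`|b x - b y| * `|f y| * riesz alpha (x, y))%:E)%E.
  by rewrite lee_fin !mulr_ge0.
have O0 y : (0 <= (1 * `|f y| * riesz alpha (x, y))%:E)%E by rewrite lee_fin !mulr_ge0.
have iB : leb.-integrable setT (fun y => (`|b x - b y| * `|f y| * riesz alpha (x, y))%:E).
  apply/integrableP; split => //; move: h1; apply: le_lt_trans.
  by rewrite le_eqVlt; apply/orP; left; apply/eqP; apply: eq_integral => y _; rewrite gee0_abs.
have i1 : leb.-integrable setT (fun y => (1 * `|f y| * riesz alpha (x, y))%:E).
  apply/integrableP; split => //; move: h2; apply: le_lt_trans.
  by rewrite le_eqVlt; apply/orP; left; apply/eqP; apply: eq_integral => y _; rewrite gee0_abs.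
have dom (F : V -> R) (c d : R) : 0 <= c -> 0 <= d -> measurable_fun setT F ->
    (forall y, `|F y| <= c * (`|b x - b y| * `|f y| * riesz alpha (x, y)) +
       d * (1 * `|f y| * riesz alpha (x, y))) ->
    leb.-integrable setT (EFin \o F).
  move=> c0 d0 mF hF.
  have iS := integrableD measurableT (integrableZl measurableT c iB) (integrableZl measurableT d i1).
  apply: (le_integrable measurableT _ _ iS); first exact/measurable_EFinP.
  move=> y _ /=; rewrite lee_fin [leRHS]ger0_norm; first exact: hF.
  by rewrite addr_ge0// mulr_ge0// -lee_fin.
have kM y : `|fractional_kernel Omega alpha x y| <= M * riesz alpha (x, y) by exact: kernel_le.
have d1 : fractional_integral_defined Omega alpha f x.
  apply: (dom _ 0 M) => //; first exact: measurable_funM.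
  move=> y; rewrite mul0r add0r mul1r normrM mulrCA mulrC.
  by rewrite ler_wpM2l// mulrC.
have kf y : `|fractional_kernel Omega alpha x y * f y| <= M * (`|f y| * riesz alpha (x, y)).
  by rewrite normrM mulrCA mulrC ler_wpM2l.
have d2 : fractional_integral_defined Omega alpha (b \* f) x.
  apply: (dom _ M (M * `|b x|)) => //.
  - by rewrite mulr_ge0.
  - by apply: measurable_funM => //; exact: measurable_funM.
  move=> y; rewrite /= mulrCA normrM.
  have hb : `|b y| <= `|b x - b y| + `|b x|.
    rewrite distrC -{1}(subrK (b x) (b y)); exact: ler_normD.
  apply: le_trans (ler_wpM2r (normr_ge0 _) hb) _.
  apply: le_trans (ler_wpM2l _ (kf y)) _; first by rewrite addr_ge0.
  by rewrite le_eqVlt; apply/orP; left; apply/eqP; ring.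
split => //.
have [ic e] := commutator_integralE d1 d2.
rewrite e EFin_normr_Rintegral//.
have mic := measurable_int _ ic.
apply: le_trans (le_abse_integral leb measurableT mic) _.
rewrite -ge0_integralZl//.
apply: ge0_le_integral => //.
- exact: measurableT_comp mic.
- by apply: emeasurable_funM.
move=> y _ /=; rewrite -EFinM lee_fin normrM.
apply: le_trans (ler_wpM2l (normr_ge0 _) (kf y)) _.
by rewrite le_eqVlt; apply/orP; left; apply/eqP; ring.
Qed.

Lemma ae_lty_of_powR (q : R) u (J : V -> \bar R) : 0 < q -> posfun u ->
  measurable_fun setT J -> (forall x, (0 <= J x)%E) ->
  (\int[leb]_x ((u x)%:E * J x) `^ q < +oo)%E -> {ae leb, forall x, (J x < +oo)%E}.
Proof.
move=> q0 pu mJ J0 h.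
have mk : measurable_fun setT (fun x => ((u x)%:E * J x) `^ q)%E.
  apply: (measurableT_comp (@measurable_poweR R q)); apply: emeasurable_funM => //.
  by apply/measurable_EFinP; exact: pu.1.
have ik : leb.-integrable setT (fun x => ((u x)%:E * J x) `^ q)%E.
  apply/integrableP; split => //; move: h; apply: le_lt_trans.
  rewrite le_eqVlt; apply/orP; left; apply/eqP; apply: eq_integral => x _.
  by rewrite gee0_abs// poweR_ge0.
apply: filterS (integrable_ae measurableT ik) => x /(_ I).
have := J0 x; case: (J x) => [r| |]//; first by rewrite ltry.
by move=> _; rewrite gt0_muley ?lte_fin ?pu.2// poweRyr ?gt_eqF.
Qed.

End kernel.

(** * Boundedness of the commutator *)

Section sufficiency.
Context {R : realType} {n : nat}.
Local Notation leb := (@lebesgue_rV R n).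
Local Notation V := ('rV[R]_n).
Implicit Types (x y z a : V) (f g u v b Omega : V -> R) (Q : V * R).

Lemma exponents (alpha p q : R) : 0 < alpha < n%:R -> 1 < p < n%:R / alpha ->
  q^-1 = p^-1 - alpha / n%:R ->
  [/\ 1 < q, p^-1 + (conj_exponent p)^-1 = 1 & q^-1 + (conj_exponent q)^-1 = 1].
Proof.
move=> /andP[a0 an] /andP[p1 pn] qE.
have n0 : 0 < n%:R :> R by exact: lt_trans an.
have p0 : 0 < p := lt_trans ltr01 p1.
have an0 : 0 < alpha / n%:R by rewrite divr_gt0.
have anp : alpha / n%:R < p^-1.
  by rewrite -[alpha / n%:R]invrK ltf_pV2 ?posrE ?invr_gt0// invf_div.
have pi1 : p^-1 < 1 by rewrite invf_lt1.
split; rewrite ?invrK; last 2 first.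
- by rewrite addrC subrK.
- by rewrite addrC subrK.
rewrite -(invrK q) invf_gt1; lra.
Qed.

(** The weight of the norm enters as the p-th power of a function, so that it
    merges with f. *)
Lemma Lp_normE (p : R) v f : measurable_fun setT v -> {ae leb, forall x, 0 < v x} ->
  measurable_fun setT f ->
  Lp_norm p (fun x => v x `^ p) f =
    ((\int[leb]_x ((`|f x| * positive_version v x) `^ p)%:E) `^ p^-1)%E.
Proof.
move=> mv v0 mf; rewrite /Lp_norm; congr (_ `^ _)%E.
have pv := posfun_positive_version mv.
have mnf : measurable_fun setT (fun x => `|f x|) by exact: measurableT_comp.
apply: ae_eq_integral_comp => //.
- by apply/measurable_EFinP; apply: measurable_funM; exact: measurable_powR_comp.
- apply/measurable_EFinP; apply: measurable_powR_comp.
  by apply: measurable_funM => //; exact: pv.1.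
apply: filterS (positive_versionE v0) => x ->.
by rewrite powRM// ltW// pv.2.
Qed.

(** Converts between bounds for norms and bounds for integrals of powers. *)
Lemma poweR_root (p : R) (X : \bar R) (T : R) : 0 < p -> 0 <= T -> (0 <= X)%E ->
  ((X `^ p^-1 <= T%:E)%E <-> (X <= (T `^ p)%:E)%E).
Proof.
move=> p0 T0 X0; have pi0 : 0 <= p^-1 by rewrite invr_ge0 ltW.
have e : ((T `^ p)%:E `^ p^-1 = T%:E)%E by rewrite poweR_EFin -powRrM mulfV ?gt_eqF// powRr1.
have e' : ((X `^ p^-1) `^ p = X)%E by rewrite -poweRrM mulVf ?gt_eqF// poweRe1.
split=> h.
  rewrite -e' -poweR_EFin; apply: gt0_ler_poweR; rewrite ?(ltW p0)// in_itv/= leey andbT ?poweR_ge0//.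
rewrite -e; apply: gt0_ler_poweR => //; rewrite in_itv/= leey andbT//.
by rewrite lee_fin powR_ge0.
Qed.

(** Replaces the scale parameter T > 0 by the norm nu, which may be 0. *)
Lemma le_of_scaled (X : \bar R) (D nu : R) : 0 < D ->
  (forall T : R, 0 < T -> nu <= T -> (X <= (D * T)%:E)%E) -> 0 <= nu -> (X <= D%:E * nu%:E)%E.
Proof.
move=> D0 h nu0; apply/lee_addgt0Pr => e e0.
rewrite -EFinM -EFinD (_ : D * nu + e = D * (nu + e / D)); last by field; rewrite gt_eqF.
by apply: h; rewrite ?ltr_wpDl ?lerDl ?divr_gt0// ltW// divr_gt0.
Qed.

(** Apply [majorant_bounds] to |f|, with T any positive number not below the
    norm of f. Finiteness of the two integrals for one T gives convergence
    almost everywhere, and there [commutator_pointwise] bounds the commutator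
    by the first majorant. *)
Theorem BMO_commutator_bounded (alpha p q : R) (omega lambda b Omega : V -> R) :
  0 < alpha < n%:R -> 1 < p < n%:R / alpha -> q^-1 = p^-1 - alpha / n%:R ->
  Apq p q omega -> Apq p q lambda -> L1loc b ->
  {within unit_sphere, continuous Omega} -> homogeneous0 Omega ->
  BMO (fun x => omega x / lambda x) b ->
  commutator_bounded Omega alpha b p (fun x => omega x `^ p) q (fun x => lambda x `^ q).
Proof.
move=> alphan pn qE Ao Al Lb cO hO hB.
have [a0 an] := andP alphan; have [p1 _] := andP pn.
have n0 : (0 < n)%N by rewrite -(ltr0n R); exact: lt_trans an.
have [q1 pp qq] := exponents alphan pn qE.
have p0 : 0 < p := lt_trans ltr01 p1. have q0 : 0 < q := lt_trans ltr01 q1.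
have [mb _] := Lb.
have [K1 mo] := Apq_muck Ao. have [K2 ml] := Apq_muck Al.
have [[[mom _] o0] _] := Ao. have [[[mla _] l0] _] := Al.
set om := positive_version omega in mo. set la := positive_version lambda in ml.
have po : posfun om := posfun_positive_version mom.
have pl : posfun la := posfun_positive_version mla.
have mnb : measurable_fun setT (fun x => om x / la x).
  by apply: measurable_funM; [exact: po.1|exact: (posfun_inv pl).1].
have pm : posfun (fun x => om x / la x).
  by split => // x; rewrite divr_gt0 ?po.2 ?pl.2.
have mli : measurable_fun setT (fun x => (lambda x)^-1).
  exact: measurable_funV.
have aem : {ae leb, forall x, omega x / lambda x = om x / la x}.
  apply: filterS2 (positive_versionE o0) (positive_versionE l0) => x h1 h2.
  by rewrite {1}h1 {1}h2.
have [B B0 hBMO] := (BMO_le (measurable_funM mom mli) pm aem mb).1 hB.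
have hav Q : 0 < Q.2 -> ((avg (fun x => `|b x - avg b Q|) Q)%:E <=
     B%:E * pmean leb 1 (hcube Q) (fun x => om x / la x)%R)%E.
  by move=> Q0; apply: avg_le_pm => //; case: Q Q0 => z l /= ?; exact: hBMO.
have [C C0 hC] := majorant_bounds n0 alphan p1 q1 pp qq qE (ltW B0) mo ml mb
   (fun Q _ => L1loc_integrable Q Lb) hav.
have [M M0 hM] := homogeneous_bounded cO hO.
pose D := M * C + 1; have D0 : 0 < D by rewrite ltr_wpDl// mulr_ge0// ltW.
exists D => f [mf hf].
have mnf : measurable_fun setT (fun x => `|f x|) by exact: measurableT_comp.
have mcomm := measurable_commutator an cO hO mb mf.
have hf0 : (0 <= Lp_norm p (fun x => omega x `^ p)%R f)%E by exact: poweR_ge0.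
have nuE : exists2 nu, 0 <= nu & Lp_norm p (fun x => omega x `^ p)%R f = nu%:E.
  exists (fine (Lp_norm p (fun x => omega x `^ p)%R f)); first exact: fine_ge0.
  by rewrite fineK// ge0_fin_numE.
have [nu nu0 nuN] := nuE; rewrite nuN.
pose I1 x : \bar R := (\int[leb]_y (`|b x - b y| * `|f y| * riesz alpha (x, y))%:E)%E.
pose I2 x : \bar R := (\int[leb]_y (1 * `|f y| * riesz alpha (x, y))%:E)%E.
have bounds T : 0 < T -> nu <= T ->
   (\int[leb]_x ((la x)%:E * I1 x) `^ q <= ((C * T) `^ q)%:E)%E /\
   (\int[leb]_x ((om x)%:E * I2 x) `^ q <= ((C * T) `^ q)%:E)%E.
  move=> T0 nT; apply: (hC (fun x => `|f x|) T mnf (fun x => normr_ge0 _) T0).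
  apply/(poweR_root p0 (ltW T0)); first by apply: integral_ge0 => x _; rewrite lee_fin powR_ge0.
  by rewrite -/om -Lp_normE// nuN lee_fin.
have mH (h : V * V -> R) : measurable_fun setT h ->
  measurable_fun setT (fun w : V * V => (h w * `|f w.2| * riesz alpha w)%:E).
  move=> mh; apply/measurable_EFinP; apply: measurable_funM; last exact: measurable_riesz.
  apply: measurable_funM => //.
  by have /= := measurableT_comp mnf (@measurable_snd _ _ V V).
have mb2 : measurable_fun setT (fun w : V * V => `|b w.1 - b w.2|).
  apply: measurableT_comp => //; apply: measurable_funB.
    by have /= := measurableT_comp mb (@measurable_fst _ _ V V).
  by have /= := measurableT_comp mb (@measurable_snd _ _ V V).
have mone : measurable_fun setT ((fun=> 1) : V * V -> R) by exact: measurable_cst.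
have H10 (w : V * V) : (0 <= (`|b w.1 - b w.2| * `|f w.2| * riesz alpha w)%:E)%E.
  by rewrite lee_fin !mulr_ge0 ?riesz_ge0.
have H20 (w : V * V) : (0 <= (1 * `|f w.2| * riesz alpha w)%:E)%E.
  by rewrite lee_fin !mulr_ge0 ?riesz_ge0.
have mI1 : measurable_fun setT I1 := measurable_inner (mH _ mb2) H10.
have mI2 : measurable_fun setT I2 := measurable_inner (mH _ mone) H20.
have I10 x : (0 <= I1 x)%E by apply: integral_ge0 => y _; exact: (H10 (x, y)).
have I20 x : (0 <= I2 x)%E by apply: integral_ge0 => y _; exact: (H20 (x, y)).
have nu1 : 0 < nu + 1 by rewrite ltr_wpDl.
have nule : nu <= nu + 1 by rewrite lerDl.
(* Any scale not below the norm shows finiteness; nu + 1 is positive even when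
   the norm is 0. *)
have [b1 b2] := bounds (nu + 1) nu1 nule.
have fin1 := ae_lty_of_powR q0 pl mI1 I10 (le_lt_trans b1 (ltry _)).
have fin2 := ae_lty_of_powR q0 po mI2 I20 (le_lt_trans b2 (ltry _)).
have ptw : {ae leb, forall x, [/\ fractional_integral_defined Omega alpha f x,
      fractional_integral_defined Omega alpha (b \* f) x &
      (`|commutator Omega alpha b f x|%:E <= M%:E * I1 x)%E]}.
  apply: filterS2 fin1 fin2 => x h1 h2; exact: commutator_pointwise.
have mnc : measurable_fun setT (fun x => `|commutator Omega alpha b f x|) by exact: measurableT_comp.
have mcl : measurable_fun setT (fun x => ((`|commutator Omega alpha b f x| * la x) `^ q)%:E).
  apply/measurable_EFinP; apply: measurable_powR_comp; apply: measurable_funM => //; exact: pl.1.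
have mlI : measurable_fun setT (fun x => ((la x)%:E * I1 x) `^ q)%E.
  apply: (measurableT_comp (@measurable_poweR R q)); apply: emeasurable_funM => //.
  by apply/measurable_EFinP; exact: pl.1.
have key T : 0 < T -> nu <= T ->
    (Lp_norm q (fun x => lambda x `^ q)%R (commutator Omega alpha b f) <= (D * T)%:E)%E.
  move=> T0 nT; have [h1 _] := bounds T T0 nT.
  have DT0 : 0 <= D * T by rewrite mulr_ge0// ltW.
  have MC0 : 0 <= M * (C * T) by rewrite !mulr_ge0// ltW.
  apply: (@le_trans _ _ (M * (C * T))%:E); last first.
    by rewrite lee_fin mulrA ler_wpM2r ?(ltW T0)// lerDl.
  rewrite Lp_normE//; apply/(poweR_root q0 MC0).
    by apply: integral_ge0 => x _; rewrite lee_fin powR_ge0.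
  apply: (@le_trans _ _ (\int[leb]_x ((M `^ q)%:E * ((la x)%:E * I1 x) `^ q))%E).
    apply: ae_ge0_le_integral => //.
    - by move=> x _; rewrite lee_fin powR_ge0.
    - by move=> x _; rewrite mule_ge0 ?poweR_ge0// lee_fin powR_ge0.
    - exact: emeasurable_funM.
    apply: filterS ptw => x [_ _ hx] _.
    have lx : (0 <= (la x)%:E)%E by rewrite lee_fin ltW// pl.2.
    rewrite -!poweR_EFin -poweRM ?lee_fin ?mule_ge0//.
    apply: gt0_ler_poweR; first exact: ltW.
    - by rewrite in_itv/= leey andbT lee_fin mulr_ge0.
    - by rewrite in_itv/= leey andbT !mule_ge0.
    by rewrite mulrC EFinM muleCA lee_wpmul2l.
  rewrite ge0_integralZl//; last 2 first.
  - by move=> x _; exact: poweR_ge0.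
  - by rewrite lee_fin powR_ge0.
  rewrite powRM ?mulr_ge0 ?(ltW C0) ?(ltW T0)// EFinM lee_wpmul2l ?lee_fin ?powR_ge0//.
split.
- by apply: filterS ptw => x [].
- split => //; apply: le_lt_trans (key (nu + 1) nu1 nule) (ltry _).
- exact: le_of_scaled.
Qed.

End sufficiency.

(** * Sign of the kernel and medians *)

Section lower_bound.
Context {R : realType} {n : nat}.
Local Notation leb := (@lebesgue_rV R n).
Local Notation V := ('rV[R]_n).
Implicit Types (x y z a : V) (f g u v b Omega : V -> R) (Q : V * R).

(** Near x0 the values of Omega stay closer to Omega(x0) than half of its
    size. *)
Lemma homogeneous_sign_near Omega x0 : {within unit_sphere, continuous Omega} ->
  homogeneous0 Omega -> unit_sphere x0 -> Omega x0 != 0 ->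
  exists2 d : R, 0 < d & forall z, ball x0 d z ->
    [/\ z != 0, `|Omega x0| / 2 <= Num.sg (Omega x0) * Omega z & enorm z <= 2].
Proof.
move=> cO hO x01 Ox0.
have x0n : x0 != 0.
  apply/eqP => x00; have e0 : enorm (0 : V) = 0.
    by rewrite /enorm big1 ?sqrtr0// => i _; rewrite mxE expr0n.
  by move: x01; rewrite /unit_sphere /= x00 e0 => /esym/eqP; rewrite oner_eq0.
have O0 : 0 < `|Omega x0| / 2 by rewrite divr_gt0// normr_gt0.
have n1 : \forall z \near x0, z != 0.
  have h : nbhs x0 (~` [set (0 : V)]).
    by apply: open_nbhs_nbhs; split; [exact: open_nonzero|exact/eqP].
  by apply: filterS h => y /eqP.
have n2 : \forall z \near x0, `|Omega x0 - Omega z| < `|Omega x0| / 2.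
  by have /cvgrPdist_lt := homogeneous_continuous cO hO x0n; apply.
have n3 : \forall z \near x0, `|enorm x0 - enorm z| < 1.
  by have /cvgrPdist_lt := @enorm_continuous R n x0; apply.
have /nbhs_ballP[d /= d0 hd] : \forall z \near x0,
    [/\ z != 0, `|Omega x0 - Omega z| < `|Omega x0| / 2 & `|enorm x0 - enorm z| < 1].
  by apply: filterS3 n1 n2 n3 => z.
exists d => // z /hd[z0 h2 h3]; split => //.
- have -> : Num.sg (Omega x0) * Omega z = `|Omega x0| - Num.sg (Omega x0) * (Omega x0 - Omega z).
    by rewrite normrEsg; ring.
  have : Num.sg (Omega x0) * (Omega x0 - Omega z) <= `|Omega x0 - Omega z|.
    by rewrite (le_trans (ler_norm _))// normrM normr_sg Ox0 mul1r.
  by move=> h; lra.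
- by move: h3; rewrite x01 ltr_norml => /andP[h3 h4]; lra.
Qed.

(** Translate by w = x0 / d times the side l. For x in Q and y in the
    translated cube, (x - y) d / l lies in the ball of radius d around x0,
    where Omega keeps its sign and the norm is at most 2. By homogeneity the
    estimate is the same for all cubes. *)
Lemma kernel_sign alpha Omega x0 : alpha < n%:R ->
  {within unit_sphere, continuous Omega} ->
  homogeneous0 Omega -> unit_sphere x0 -> Omega x0 != 0 ->
  exists (c : R) (w : V), 0 < c /\ forall a (l : R) x y, 0 < l ->
    hcube (a, l) x -> hcube (a - l *: w, l) y ->
    c * l `^ (alpha - n%:R) <= Num.sg (Omega x0) * fractional_kernel Omega alpha x y.
Proof.
move=> an cO hO x01 Ox0; have [d d0 hd] := homogeneous_sign_near cO hO x01 Ox0.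
(* With A = 1/d the rescaled difference of two points of cubes of side l stays
   within d of x0. *)
pose A := d^-1; have A0 : 0 < A by rewrite invr_gt0.
exists (`|Omega x0| / 2 * (2 * A) `^ (alpha - n%:R)), (A *: x0); split.
  by rewrite mulr_gt0 ?divr_gt0 ?normr_gt0// powR_gt0// mulr_gt0.
move=> a l x y l0 hx hy.
have Al0 : 0 < A * l by rewrite mulr_gt0.
pose z := (A * l)^-1 *: (x - y).
have zb : ball x0 d z.
  split => // i j; rewrite (ord1 i) /ball /= !mxE.
  have /andP[x1 x2] := hx j; have /andP[y1 y2] := hy j.
  move: y1 y2; rewrite /= !mxE => y1 y2.
  rewrite (_ : x0 ord0 j - _ = d * ((A * l * x0 ord0 j - (x ord0 j - y ord0 j)) / l)); last first.
    by rewrite /A; field; rewrite !gt_eqF.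
  rewrite normrM (gtr0_norm d0) -[ltRHS]mulr1 ltr_pM2l// normrM (gtr0_norm (_ : 0 < l^-1)) ?invr_gt0//.
  rewrite ltr_pdivrMr// mul1r ltr_norml.
  have e : l * (A * x0 ord0 j) = A * l * x0 ord0 j by ring.
  by move: x1 x2 => /= x1 x2; rewrite e in y1 y2; apply/andP; split; lra.
have [z0 hz1 hz2] := hd z zb.
have xyE : x - y = (A * l) *: z by rewrite scalerA mulfV ?scale1r// gt_eqF.
rewrite fractional_kernel_riesz xyE hO// mulrA.
have rE : (2 * A) `^ (alpha - n%:R) * l `^ (alpha - n%:R) <= riesz alpha (x, y).
  rewrite -powRM ?mulr_ge0 ?(ltW A0) ?(ltW l0)// /riesz /= xyE enormZ (gtr0_norm Al0).
  have e0 : 0 < A * l * enorm z by rewrite mulr_gt0// enorm_gt0.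
  rewrite -(opprB n%:R) !powRN lef_pV2 ?posrE ?powR_gt0 ?e0 ?mulr_gt0//.
  apply: ge0_ler_powR; rewrite ?nnegrE ?(ltW e0) ?mulr_ge0 ?(ltW A0) ?(ltW l0)//.
    by rewrite subr_ge0 ltW.
  rewrite (_ : 2 * A * l = A * l * 2); last by ring.
  exact: ler_wpM2l (ltW Al0) _ _ hz2.
rewrite -(mulrA (`|Omega x0| / 2)); apply: ler_pM => //.
by rewrite mulr_ge0 ?powR_ge0.
Qed.

Lemma leb_exhaust_le (F : nat -> set V) (c : \bar R) : (forall k, measurable (F k)) ->
  (forall j k, (j <= k)%N -> F j `<=` F k) -> (forall k, (leb (F k) <= c)%E) ->
  (leb (\bigcup_k F k) <= c)%E.
Proof.
move=> mF ndF hF.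
have h := @nondecreasing_cvg_mu _ _ _ leb F mF (bigcupT_measurable F mF)
  (fun j k jk => introT (subsetPset _ _) (ndF j k jk)).
rewrite -(cvg_lim _ h)//; apply: lime_le; first by apply/cvg_ex; eexists; exact: h.
by apply: nearW => k; exact: hF.
Qed.

(** The infimum of the levels t such that b <= t on at least half of Q. It is
    finite because the sets b <= t exhaust Q as t increases and b > t exhaust
    it as t decreases; continuity of the measure from below, from the right
    and from the left, yields the two inequalities. *)
Lemma median_exists b Q : 0 < Q.2 -> measurable_fun setT b ->
  exists m : R, ((leb (hcube Q) <= 2%:E * leb (hcube Q `&` [set x | b x <= m]%R))%E /\
    (leb (hcube Q) <= 2%:E * leb (hcube Q `&` [set x | m <= b x]%R))%E).
Proof.
move=> Q0 mb.
have mQ : measurable (hcube Q) by exact: measurable_hcube.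
have [_ [W W0 WE]] := @fat_hcube R n Q Q0.
have ms (P : set R) : measurable P -> measurable (hcube Q `&` b @^-1` P).
  by move=> mP; have := mb measurableT _ mP; rewrite setTI => h; exact: measurableI.
pose lo t := hcube Q `&` b @^-1` `]-oo, t]%classic.
pose hi t := hcube Q `&` b @^-1` `]t, +oo[%classic.
have mlo t : measurable (lo t) by apply: ms; exact: measurable_itv.
have mhi t : measurable (hi t) by apply: ms; exact: measurable_itv.
have split2 (A B : set V) : measurable A -> measurable B -> A `|` B = hcube Q ->
    A `&` B = set0 -> exists r s : R, [/\ 0 <= r, 0 <= s, leb A = r%:E, leb B = s%:E & r + s = W].
  move=> mA mB AB AB0; have := @measureU _ _ _ leb A B mA mB AB0.
  rewrite AB => h; have A0 := measure_ge0 leb A. have B0 := measure_ge0 leb B.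
  move: WE; rewrite h; move: A0 B0 => /=.
  case: (lebesgue_rV n A) => [r| |]// r0; case: (lebesgue_rV n B) => [t| |]// t0.
  by rewrite -EFinD => -[<-]; exists r, t; split; rewrite -?lee_fin.
have lohi t : exists r s : R, [/\ 0 <= r, 0 <= s, leb (lo t) = r%:E, leb (hi t) = s%:E & r + s = W].
  apply: split2 => //.
    rewrite /lo /hi -setIUr -preimage_setU; apply/setIidPl => x _ /=.
    by rewrite !in_itv/= andbT; case: leP => _; [left|right].
  rewrite /lo /hi; apply/seteqP; split => // x [[_ /=]]; rewrite in_itv/= => h1 [_ /=].
  by rewrite in_itv/= andbT ltNge h1.
pose S : set R := [set t | exists2 r : R, leb (lo t) = r%:E & W <= 2 * r].
have W2 : W / 2 < W by lra.
have S_ne : S !=set0.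
  apply: contrapT => /forallNP nS.
  have := @leb_exhaust_le (fun k => lo k%:R) (W / 2)%:E (fun k => mlo _).
  have -> : \bigcup_k lo k%:R = hcube Q.
    apply/seteqP; split => [x [k _ []]//|x xQ].
    exists (Num.truncn (b x)).+1 => //; split => //=.
    by rewrite in_itv/= ltW// truncnS_gt.
  move=> h; have : (leb (hcube Q) <= (W / 2)%:E)%E.
    apply: h => [j k jk x [xQ /=]|k].
      rewrite in_itv/= => h; split => //=; rewrite in_itv/= (le_trans h)// ler_nat//.
    have [r [s [r0 s0 rE _ rs]]] := lohi k%:R.
    rewrite rE lee_fin leNgt; apply/negP => rW; apply: (nS k%:R); exists r => //; lra.
  by rewrite WE lee_fin => /le_lt_trans /(_ W2); rewrite ltxx.
have S_lb : has_lbound S.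
  apply: contrapT => nS.
  have := @leb_exhaust_le (fun k => hi (- k%:R)) (W / 2)%:E (fun k => mhi _).
  have -> : \bigcup_k hi (- k%:R) = hcube Q.
    apply/seteqP; split => [x [k _ []]//|x xQ].
    exists (Num.truncn (- b x)).+1 => //; split => //=.
    by rewrite in_itv/= andbT ltrNl truncnS_gt.
  move=> h; have : (leb (hcube Q) <= (W / 2)%:E)%E.
    apply: h => [j k jk x [xQ /=]|k].
      rewrite in_itv/= andbT => h; split => //=; rewrite in_itv/= andbT (le_lt_trans _ h)//.
      by rewrite lerN2 ler_nat.
    have [r [s [r0 s0 rE sE rs]]] := lohi (- k%:R).
    rewrite sE lee_fin leNgt; apply/negP => sW; apply: nS.
    exists (- k%:R) => t [r' r'E r'W]; rewrite leNgt; apply/negP => tk.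
    have : (leb (lo t) <= leb (lo (- k%:R)%R))%E.
      apply: le_leb => // x [xQ /=]; rewrite in_itv/= => h1; split => //=.
      by rewrite in_itv/= (le_trans h1)// ltW.
    rewrite r'E rE lee_fin => ?; lra.
  by rewrite WE lee_fin => /le_lt_trans /(_ W2); rewrite ltxx.
pose m := inf S.
have inv_pos k : 0 < k.+1%:R^-1 :> R by rewrite invr_gt0.
have inv_dec (j k : nat) : (j <= k)%N -> k.+1%:R^-1 <= j.+1%:R^-1 :> R.
  by move=> jk; rewrite lef_pV2 ?posrE// ler_nat.
have small (e : R) : 0 < e -> exists k : nat, k.+1%:R^-1 < e.
  move=> e0; exists (Num.truncn e^-1); rewrite invf_plt ?posrE//; exact: truncnS_gt.
exists m; split.
  have h : (leb (hi m) <= (W / 2)%:E)%E.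
    have -> : hi m = \bigcup_k hi (m + k.+1%:R^-1).
      apply/seteqP; split => [x [xQ /=]|x [k _ [xQ /=]]]; rewrite !in_itv/= !andbT => h.
        have bm0 : 0 < b x - m by rewrite subr_gt0.
        have [k hk] := small _ bm0.
        by exists k => //; split => //=; rewrite in_itv/= andbT -ltrBrDl.
      split => //=; rewrite in_itv/= andbT; apply: lt_trans h; rewrite ltrDl; exact: inv_pos.
    apply: leb_exhaust_le => [k|j k jk x [xQ /=]|k]; first exact: mhi.
      rewrite !in_itv/= !andbT => h; split => //=; rewrite in_itv/= andbT.
      by apply: le_lt_trans h; rewrite lerD2l inv_dec.
    have [t [r rE rW] tm] := inf_adherent (inv_pos k) (conj S_ne S_lb).
    have [r' [s [r'0 s0 r'E sE rs]]] := lohi t.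
    have e : r = r' by move: r'E; rewrite rE => -[].
    apply: (@le_trans _ _ (leb (hi t))).
      apply: le_leb => // x [xQ /=]; rewrite in_itv/= andbT => h; split => //=.
      by rewrite in_itv/= andbT (lt_trans tm).
    by rewrite sE lee_fin; lra.
  have [r [s [r0 s0 rE sE rs]]] := lohi m.
  rewrite (_ : hcube Q `&` _ = lo m); last first.
    by rewrite /lo; congr (_ `&` _); apply/seteqP; split => x /=; rewrite in_itv.
  by move: h; rewrite sE WE rE -EFinM !lee_fin => h; lra.
pose lt' := hcube Q `&` b @^-1` `]-oo, m[%classic.
pose ge' := hcube Q `&` b @^-1` `[m, +oo[%classic.
have h : (leb lt' <= (W / 2)%:E)%E.
  have -> : lt' = \bigcup_k lo (m - k.+1%:R^-1).
    apply/seteqP; split => [x [xQ /=]|x [k _ [xQ /=]]]; rewrite !in_itv/= => h.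
      have bm0 : 0 < m - b x by rewrite subr_gt0.
      have [k hk] := small _ bm0.
      by exists k => //; split => //=; rewrite in_itv/= lerBrDr -lerBrDl ltW.
    split => //=; rewrite in_itv/=; apply: le_lt_trans h _; rewrite ltrBlDr ltrDl; exact: inv_pos.
  apply: leb_exhaust_le => [k|j k jk x [xQ /=]|k]; first exact: mlo.
    rewrite !in_itv/= => h; split => //=; rewrite in_itv/=.
    by apply: le_trans h _; rewrite lerD2l lerN2 inv_dec.
  have [r [s [r0 s0 rE sE rs]]] := lohi (m - k.+1%:R^-1).
  rewrite rE lee_fin leNgt; apply/negP => rW.
  have /(ge_inf S_lb) : S (m - k.+1%:R^-1) by exists r => //; lra.
  by rewrite -/m leNgt ltrBlDr ltrDl inv_pos.
have [r [s [r0 s0 rE sE rs]]] : exists r s : R,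
   [/\ 0 <= r, 0 <= s, leb lt' = r%:E, leb ge' = s%:E & r + s = W].
  apply: split2.
  - by apply: ms; exact: measurable_itv.
  - by apply: ms; exact: measurable_itv.
  - rewrite /lt' /ge' -setIUr -preimage_setU; apply/setIidPl => x _ /=.
    by rewrite !in_itv/= andbT; case: ltP => _; [left|right].
  rewrite /lt' /ge'; apply/seteqP; split => // x [[_ /=]]; rewrite in_itv/= => h1 [_ /=].
  by rewrite in_itv/= andbT leNgt h1.
rewrite (_ : hcube Q `&` _ = ge'); last first.
  by rewrite /ge'; congr (_ `&` _); apply/seteqP; split => x /=; rewrite in_itv/= andbT.
by move: h; rewrite rE WE sE -EFinM !lee_fin => h; lra.
Qed.

End lower_bound.

(** * Lower bound for the commutator on indicators *)

Section weights.
Context {R : realType} {n : nat}.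
Local Notation leb := (@lebesgue_rV R n).
Local Notation V := ('rV[R]_n).
Implicit Types (x y z a w : V) (f g u v b Omega om la : V -> R) (Q : V * R).
Local Notation pm a Q f := (pmean leb a (hcube Q) f).

(** The arithmetic of the next lemma. Multiplying by 1 <= mu (Y1 Y2) makes
    both weight conditions applicable, and avoids dividing by means that could
    be infinite. *)
Lemma weights_chain_calc (k1 k2 K1 K2 : R) (X1 X2 A1 A2 A3 A4 Y1 Y2 mu : \bar R) :
  0 <= k1 -> 0 <= k2 -> (0 <= X1 -> 0 <= X2 -> 0 <= A1 -> 0 <= A2 -> 0 <= A3 -> 0 <= A4 ->
  0 <= Y1 -> 0 <= Y2 -> 0 <= mu ->
  X1 <= k1%:E * A1 -> X2 <= k2%:E * A4 -> Y1 <= k2%:E * A2 -> Y2 <= k1%:E * A3 ->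
  1 <= mu * (Y1 * Y2) -> A1 * A2 <= K1%:E -> A3 * A4 <= K2%:E ->
  X1 * X2 <= ((k1 * k2) ^+ 2 * (K1 * K2))%:E * mu)%E.
Proof.
move=> k10 k20 X10 X20 A10 A20 A30 A40 Y10 Y20 mu0 h1 h2 h3 h4 one hK1 hK2.
have X0 : (0 <= X1 * X2)%E by exact: mule_ge0.
rewrite -[leLHS]mule1; apply: le_trans (lee_wpmul2l X0 one) _.
apply: (@le_trans _ _ ((k1%:E * A1) * (k2%:E * A4) * (mu * ((k2%:E * A2) * (k1%:E * A3))))%E).
  apply: lee_pmul; rewrite ?mule_ge0//; first exact: lee_pmul.
  by rewrite lee_wpmul2l// lee_pmul.
(* Collects the constants, the two products of means of om and of la, and mu. *)
rewrite (AC ((2*2)*(1*(2*2))) (((1*3)*(6*8))*((2*7)*(9*4))*5))/=.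
rewrite -!EFinM (mulrC k2 k1) -expr2 [in leRHS]EFinM lee_wpmul2r// lee_wpmul2l//.
  by rewrite lee_fin sqr_ge0.
by rewrite EFinM lee_pmul ?mule_ge0.
Qed.

(** Both cubes lie in a cube P of side (2 W + 1) l, and means over them are at
    most a constant times means over P. On P the weight conditions bound
    (om)_q (1/om)_{p'} and (la)_q (1/la)_{p'}. The missing factors 1/om and la
    come from 1 <= (om/la)_1 (1/om)_{p'} (la)_q, which is Hoelder for a
    product that equals 1; its total exponent is below 1. *)
Lemma weights_chain (p q p' q' K1 K2 W k : R) om la a w (l : R) :
  0 < p -> 0 < q -> 0 < p' -> 0 < q' -> q^-1 <= p^-1 -> p'^-1 <= q'^-1 -> 0 < l ->
  0 <= W -> (forall i, `|w ord0 i| <= W) -> k = (2 * W + 1) ^+ n ->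
  muck q p' K1 om -> muck q p' K2 la ->
  (pm p (a - l *: w, l)%R om * pm q' (a, l) (fun x => (la x)^-1)%R <=
   ((k `^ q^-1 * k `^ p'^-1) ^+ 2 * (K1 * K2))%:E * pm 1 (a, l) (fun x => om x / la x)%R)%E.
Proof.
move=> p0 q0 p'0 q'0 pq pq' l0 W0 hw kE mo ml.
pose P : V * R := (a - const_mx (l * W), (2 * W + 1) * l).
have W1 : 0 < 2 * W + 1 by rewrite ltr_wpDl// mulr_ge0.
have P0 : 0 < P.2 by rewrite mulr_gt0.
have subP (c : V) : (forall i, `|c ord0 i| <= l * W) -> hcube (a + c, l) `<=` hcube P.
  move=> hc x hx i; have /andP[/= x1 x2] := hx i; have := hc i; rewrite ler_norml => /andP[c1 c2].
  by move: x1 x2; rewrite !mxE => x1 x2; apply/andP; split; nra.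
have fQ (c : V) : fat leb (hcube (c, l)) by exact: fat_hcube.
have fP : fat leb (hcube P) by exact: fat_hcube.
have s0 : hcube (a, l) `<=` hcube P.
  by have := subP 0; rewrite addr0; apply => i; rewrite mxE normr0 mulr_ge0// ltW.
have s1 : hcube (a - l *: w, l) `<=` hcube P.
  by apply: subP => i; rewrite !mxE normrN normrM (gtr0_norm l0) ler_wpM2l// ltW.
have vol (c : V) : fine ((leb : {measure set _ -> \bar R}) (hcube P)) <=
    k * fine ((leb : {measure set _ -> \bar R}) (hcube (c, l))).
  by rewrite !fine_leb_hcube//= exprMn kE.
have po := mo.1. have pl := ml.1. have poi := posfun_inv po. have pli := posfun_inv pl.
have grow (t t' : R) u (c : V) : posfun u -> 0 < t <= t' -> hcube (c, l) `<=` hcube P ->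
    (pm t (c, l) u <= (k `^ t'^-1)%:E * pm t' P u)%E.
  move=> [mu u0] /andP[t0 tt] sP.
  apply: (@le_trans _ _ (pm t' (c, l) u)).
    by apply: pmean_mono => //; [move=> x; rewrite ltW|rewrite t0].
  by apply: pmean_subset => //; exact: lt_le_trans tt.
have pq1 : 0 < p <= q by rewrite p0 -[q]invrK -[p]invrK lef_pV2 ?posrE ?invr_gt0.
have pq2 : 0 < q' <= p' by rewrite q'0 -[p']invrK -[q']invrK lef_pV2 ?posrE ?invr_gt0.
have pq3 : 0 < p' <= p' by rewrite p'0 lexx.
have pq4 : 0 < q <= q by rewrite q0 lexx.
have g1 := grow _ _ _ _ po pq1 s1.
have g2 := grow _ _ _ _ pli pq2 s0.
have g3 := grow _ _ _ _ poi pq3 s0.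
have g4 := grow _ _ _ _ pl pq4 s0.
have hK1 := mo.2 P P0. have hK2 := ml.2 P P0.
have one : (1 <= pm 1 (a, l) (fun x => om x / la x)%R *
    (pm p' (a, l) (fun x => (om x)^-1)%R * pm q (a, l) la))%E.
  pose s := (p'^-1 + q^-1)^-1.
  have sg0 : 0 < p'^-1 + q^-1 by rewrite addr_gt0 ?invr_gt0.
  have s0' : 0 < s by rewrite invr_gt0.
  (* Two applications of Hoelder: first om/la against the product of the other
     two, with 1/t = 1 + 1/s, then that product with 1/s = 1/p' + 1/q. *)
  pose t := (1^-1 + s^-1)^-1.
  have t0 : 0 < t by rewrite invr_gt0 addr_gt0 ?invr_gt0.
  have m1 : measurable_fun setT (fun x => om x / la x) by apply: measurable_funM; [exact: po.1|exact: pli.1].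
  have m2 : measurable_fun setT (fun x => (om x)^-1 * la x) by apply: measurable_funM; [exact: poi.1|exact: pl.1].
  have h1 : (pm t (a, l) (fun x => (om x / la x) * ((om x)^-1 * la x))%R <=
     pm 1 (a, l) (fun x => om x / la x)%R * pm s (a, l) (fun x => (om x)^-1 * la x)%R)%E.
    apply: pmean_hoelder => //.
    - by move=> x; rewrite divr_ge0// ltW ?po.2 ?pl.2.
    - by move=> x; rewrite mulr_ge0// ltW ?poi.2 ?pl.2.
    - by rewrite invrK.
  have h2 : (pm s (a, l) (fun x => (om x)^-1 * la x)%R <=
     pm p' (a, l) (fun x => (om x)^-1)%R * pm q (a, l) la)%E.
    apply: pmean_hoelder => //; rewrite ?invrK//; try exact: poi.1; try exact: pl.1.
    - by move=> x; rewrite ltW ?poi.2.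
    - by move=> x; rewrite ltW ?pl.2.
  have e : (fun x => (om x / la x) * ((om x)^-1 * la x)) = (fun=> 1).
    by apply/funext => x; field; rewrite !gt_eqF ?po.2 ?pl.2.
  rewrite e pmean_cst// in h1.
  by apply: le_trans h1 _; rewrite lee_wpmul2l ?pmean_ge0.
have k0 t : 0 <= k `^ t by exact: powR_ge0.
by apply: (weights_chain_calc (k0 _) (k0 _) _ _ _ _ _ _ _ _ _ g1 g2 g3 g4 one hK1 hK2);
  exact: pmean_ge0.
Qed.

End weights.

Section half_oscillation.
Context {R : realType} {n : nat}.
Local Notation leb := (@lebesgue_rV R n).
Local Notation V := ('rV[R]_n).
Implicit Types (x y z a w : V) (f g u v b Omega om la : V -> R) (Q : V * R).
Local Notation pm a Q f := (pmean leb a (hcube Q) f).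

(** The commutator on the indicator of F is the integral over F of (b(x) -
    b(y)) K(x, y). Up to the fixed signs s and sg both factors are nonnegative
    there, and at least s (b(x) - m) and c. *)
Lemma commutator_lower Omega alpha b x (F : set V) (m s sg c : R) :
  measurable F -> (leb F < +oo)%E -> `|s| = 1 -> `|sg| = 1 -> 0 <= c ->
  (forall y, F y -> c <= sg * fractional_kernel Omega alpha x y) ->
  (forall y, F y -> s * b y <= s * m) -> 0 <= s * (b x - m) ->
  fractional_integral_defined Omega alpha (\1_F) x ->
  fractional_integral_defined Omega alpha (b \* \1_F) x ->
  s * (b x - m) * c * fine (leb F) <= `|commutator Omega alpha b (\1_F) x|.
Proof.
move=> mF Foo s1 sg1 c0 hk hb hx d1 d2.
have [ic e] := commutator_integralE d1 d2.
have -> : `|commutator Omega alpha b (\1_F) x| = `|s * sg * commutator Omega alpha b (\1_F) x|.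
  by rewrite !normrM s1 sg1 !mul1r.
apply: le_trans (ler_norm _); rewrite e -RintegralZl//.
pose k := s * (b x - m) * c.
have iF : leb.-integrable setT (EFin \o (\1_F : V -> R)).
  apply/integrableP; split; first by apply/measurable_EFinP; exact: measurable_indic.
  under eq_integral do rewrite gee0_abs ?lee_fin//.
  by rewrite integral_indic// setIT.
have -> : k * fine (leb F) = \int[leb]_y (k * (\1_F : V -> R) y).
  rewrite RintegralZl//; congr (_ * _); rewrite /Rintegral.
  by rewrite integral_indic// setIT.
apply: le_Rintegral => //.
- exact: (integrableZl measurableT k iF).
- exact: (integrableZl measurableT (s * sg) ic).
move=> y _ /=; rewrite indicE; have [/set_mem yF|_] := boolP (y \in F); last by rewrite !mulr0.
rewrite !mulr1.
rewrite (_ : s * sg * _ = s * (b x - b y) * (sg * fractional_kernel Omega alpha x y)); last by ring.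
apply: ler_pM => //; last exact: hk.
have := hb y yF; move: hx; rewrite !mulrBr => h1 h2; lra.
Qed.

Lemma pm_le_norm (t : R) Q u : 0 < t -> 0 < Q.2 -> measurable_fun setT u ->
  (pm t Q u <= ((Q.2 ^+ n) `^ (- t^-1))%:E * (\int[leb]_x (u x `^ t)%:E) `^ t^-1)%E.
Proof.
move=> t0 Q0 mu; have V0 : 0 < Q.2 ^+ n by rewrite exprn_gt0.
have mut : measurable_fun setT (fun x => (u x `^ t)%:E).
  by apply/measurable_EFinP; exact: measurable_powR_comp.
have i0 (D : set V) : (0 <= \int[leb]_(x in D) (u x `^ t)%:E)%E.
  by apply: integral_ge0 => x _; rewrite lee_fin powR_ge0.
rewrite pmean_hcubeE// poweRM ?lee_fin ?invr_ge0 ?(ltW V0)//.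
rewrite poweR_EFin -powR_inv1 ?(ltW V0)// -powRrM mulN1r.
apply: lee_wpmul2l; first by rewrite lee_fin powR_ge0.
apply: gt0_ler_poweR; rewrite ?invr_ge0 ?(ltW t0)// ?in_itv/= ?leey ?andbT//.
apply: ge0_subset_integral => //; first exact: measurable_hcube.
by move=> x _; rewrite lee_fin powR_ge0.
Qed.

(** The reverse of [pm_le_norm] for functions supported in Q. *)
Lemma indic_norm_le (t : R) Q (F : set V) u : 0 < t -> 0 < Q.2 -> measurable F ->
  F `<=` hcube Q -> posfun u ->
  ((\int[leb]_x ((`|\1_F x : R| * u x) `^ t)%:E) `^ t^-1 <= ((Q.2 ^+ n) `^ t^-1)%:E * pm t Q u)%E.
Proof.
move=> t0 Q0 mF FQ [mu u0]; have V0 : 0 < Q.2 ^+ n by rewrite exprn_gt0.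
have mQ : measurable (hcube Q) by exact: measurable_hcube.
rewrite pmean_hcubeE// -poweR_EFin -poweRM ?lee_fin ?(ltW V0)//; last first.
  by rewrite mule_ge0 ?pint_ge0// lee_fin invr_ge0 ltW.
rewrite muleA -EFinM mulfV ?gt_eqF// mul1e.
apply: gt0_ler_poweR; rewrite ?invr_ge0 ?(ltW t0)// ?in_itv/= ?leey ?andbT//.
- by apply: integral_ge0 => x _; rewrite lee_fin powR_ge0.
- exact: pint_ge0.
rewrite [leRHS]integral_mkcond; apply: ge0_le_integral => //.
- by move=> x _; rewrite lee_fin powR_ge0.
- apply/measurable_EFinP; apply: measurable_powR_comp; apply: measurable_funM => //.
  by apply: measurableT_comp => //; exact: measurable_indic.
- apply: (measurable_restrictT _ mQ).1; apply: (@measurable_funS _ _ _ _ setT) => //.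
  by apply/measurable_EFinP; exact: measurable_powR_comp.
move=> x _; rewrite patchE indicE; have [/set_mem xF|_] := boolP (x \in F).
  by rewrite mem_set ?normr1 ?mul1r//; exact: FQ.
rewrite normr0 mul0r powR0 ?gt_eqF//; case: ifP => // _.
by rewrite lee_fin powR_ge0.
Qed.

(** The sign s = 1 treats the set where b >= m, and s = -1 the set where b <=
    m. Integrate the pointwise lower bound over Q, apply Hoelder with the
    weight lambda and the norm inequality for the indicator of F. The powers
    of l cancel: |F| l^(alpha - n) is comparable with l^alpha, and the
    normalizations of the two norms contribute l^(n/p - n/q) = l^alpha. *)
Lemma half_oscillation (alpha p q C : R) om' la' b Omega a a' (l m s sg c : R) (F : set V) :
  0 < alpha < n%:R -> 0 < p -> 1 < q -> q^-1 = p^-1 - alpha / n%:R ->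
  measurable_fun setT om' -> {ae leb, forall x, 0 < om' x} ->
  measurable_fun setT la' -> {ae leb, forall x, 0 < la' x} ->
  measurable_fun setT b ->
  (forall f, in_Lp p (fun x => om' x `^ p) f ->
    [/\ {ae leb, forall x,
          fractional_integral_defined Omega alpha f x /\
          fractional_integral_defined Omega alpha (b \* f) x},
        in_Lp q (fun x => la' x `^ q) (commutator Omega alpha b f) &
        (Lp_norm q (fun x => (la' x `^ q)%R) (commutator Omega alpha b f) <=
         C%:E * Lp_norm p (fun x => (om' x `^ p)%R) f)%E]) ->
  0 < l -> `|s| = 1 -> `|sg| = 1 -> 0 < c ->
  (forall x y, hcube (a, l) x -> hcube (a', l) y ->
    c * l `^ (alpha - n%:R) <= sg * fractional_kernel Omega alpha x y) ->
  (pm p (a', l) (positive_version om') < +oo)%E ->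
  measurable F -> F `<=` hcube (a', l) -> (leb (hcube (a', l)) <= 2%:E * leb F)%E ->
  (forall y, F y -> s * b y <= s * m) ->
  (\int[leb]_(x in hcube (a, l)) (Num.max 0 (s * (b x - m)))%:E <=
   (l ^+ n * (2 / c * `|C|))%:E * (pm p (a', l) (positive_version om') *
      pm (conj_exponent q) (a, l) (fun x => (positive_version la' x)^-1)%R))%E.
Proof.
move=> alphan p0 q1 qE mom o0 mla l0' mb hC l0 s1 sg1 c0 hk poo mF FQ' Fhalf hb.
have q0 : 0 < q := lt_trans ltr01 q1.
have q'i : q^-1 + (conj_exponent q)^-1 = 1 by rewrite invrK addrC subrK.
have qi1 : q^-1 < 1 by rewrite invf_lt1.
have q'0 : 0 < conj_exponent q by rewrite invr_gt0; lra.
have [a0 an] := andP alphan. have n0 : 0 < n%:R :> R by exact: lt_trans an.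
set om := positive_version om' in poo *; set la := positive_version la'.
have po : posfun om := posfun_positive_version mom.
have pl : posfun la := posfun_positive_version mla.
have pli := posfun_inv pl.
have V0 : 0 < l ^+ n by rewrite exprn_gt0.
have mQ : measurable (hcube (a, l)) by exact: measurable_hcube.
have Foo : (leb F < +oo)%E.
  apply: le_lt_trans (le_leb mF (measurable_hcube _) FQ') _.
  by rewrite leb_hcube ?ltry.
have Ffin : leb F \is a fin_num by rewrite ge0_fin_numE// measure_ge0.
pose r := fine (leb F); have FEr : leb F = r%:E by rewrite fineK.
have fF : l ^+ n <= 2 * r.
  by move: Fhalf; rewrite leb_hcube// FEr -EFinM lee_fin.
pose f := \1_F : V -> R.
have mf : measurable_fun setT f by exact: measurable_indic.
have hnorm : (Lp_norm p (fun x => (om' x `^ p)%R) f <= ((l ^+ n) `^ p^-1)%:E * pm p (a', l) om)%E.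
  by rewrite Lp_normE//; exact: indic_norm_le.
have fL : in_Lp p (fun x => om' x `^ p) f.
  split => //; apply: le_lt_trans hnorm _; apply: lte_mul_pinfty => //.
  by rewrite lee_fin powR_ge0.
have [dae [mcomm _] hcomm] := hC f fL.
set h := commutator Omega alpha b f in dae mcomm hcomm.
have mnh : measurable_fun setT (fun x => `|h x|) by exact: measurableT_comp.
pose H x := Num.max 0 (s * (b x - m)).
have mH : measurable_fun setT H.
  apply: measurable_maxr => //; apply: measurable_funM => //; exact: measurable_funB.
have H0 x : 0 <= H x by rewrite le_max lexx.
(* F fills at least half of its cube. *)
pose kap := c * l `^ (alpha - n%:R) * (l ^+ n / 2).
have kap0 : 0 < kap by rewrite !mulr_gt0 ?powR_gt0 ?divr_gt0.
have step1 : (\int[leb]_(x in hcube (a, l)) (kap * H x)%:E <= \int[leb]_(x in hcube (a, l)) `|h x|%:E)%E.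
  apply: ae_ge0_le_integral => //.
  - by move=> x _; rewrite lee_fin mulr_ge0// ltW.
  - by apply/measurable_EFinP; apply: measurable_funS (measurable_funM (measurable_cst kap) mH).
  - by apply/measurable_EFinP; apply: measurable_funS mnh.
  apply: filterS dae => x [d1 d2] xQ; rewrite lee_fin /H.
  have [hx|hx] := leP 0 (s * (b x - m)); last by rewrite mulr0.
  have cl0 : 0 <= c * l `^ (alpha - n%:R) by rewrite mulr_ge0 ?powR_ge0// ltW.
  have := commutator_lower mF Foo s1 sg1 cl0 (fun y yF => hk x y xQ (FQ' y yF)) hb hx d1 d2.
  apply: le_trans; rewrite -/r.
  rewrite [leLHS](_ : _ = s * (b x - m) * (c * l `^ (alpha - n%:R)) * (l ^+ n / 2)); last first.
    by rewrite /kap; ring.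
  by apply: ler_wpM2l; [exact: mulr_ge0|lra].
have mone : measurable_fun setT (cst 1 : V -> R) by exact: measurable_cst.
have one0 x : 0 <= (cst 1 : V -> R) x by exact: ler01.
have step2 := @weighted_hoelder R n q (conj_exponent q) (a, l) _ _ _ q0 q'0 q'i l0 pl mnh mone
   (fun x => normr_ge0 _) one0.
have E1 : (fun x => cst 1 x * (la x)^-1) = (fun x => (la x)^-1) by apply/funext => x; rewrite mul1r.
have E2 : (\int[leb]_(x in hcube (a, l)) (cst 1 x * `|h x|)%:E = \int[leb]_(x in hcube (a, l)) `|h x|%:E)%E.
  by apply: eq_integral => x _; rewrite mul1r.
rewrite E1 E2 /= in step2.
set L := pm (conj_exponent q) _ _ in step2 *; have L0 : (0 <= L)%E by exact: pmean_ge0.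
set Wp := pm p _ _ in hnorm *; have Wp0 : (0 <= Wp)%E by exact: pmean_ge0.
have mhl : measurable_fun setT (fun x => `|h x| * la x) by apply: measurable_funM => //; exact: pl.1.
have step3 : (pm q (a, l) (fun x => `|h x| * la x)%R <= (`|C| * l `^ alpha)%:E * Wp)%E.
  apply: le_trans (pm_le_norm q0 _ mhl) _ => //=.
  rewrite -Lp_normE//.
  apply: (@le_trans _ _ (((l ^+ n) `^ (- q^-1))%:E * (`|C|%:E * (((l ^+ n) `^ p^-1)%:E * Wp)))%E).
    apply: lee_wpmul2l; first by rewrite lee_fin powR_ge0.
    apply: le_trans hcomm _; apply: (@le_trans _ _ (`|C|%:E * Lp_norm p (fun x => (om' x `^ p)%R) f)%E).
      by apply: lee_wpmul2r; [exact: poweR_ge0|rewrite lee_fin ler_norm].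
    by apply: lee_wpmul2l; rewrite ?lee_fin.
  rewrite muleCA !muleA -!EFinM -mulrA -powRD; last by rewrite (gt_eqF V0) implybT.
  rewrite (_ : - q^-1 + p^-1 = alpha / n%:R); last by rewrite qE; ring.
  rewrite -powR_mulrn ?(ltW l0)// -powRrM (mulrC n%:R) divfK ?gt_eqF//.
apply: (@scaled_le R _ _ _ kap0).
have -> : (kap%:E * \int[leb]_(x in hcube (a, l)) (H x)%:E = \int[leb]_(x in hcube (a, l)) (kap * H x)%:E)%E.
  under [RHS]eq_integral do rewrite EFinM.
  have mHQ : measurable_fun (hcube (a, l)) (fun x => (H x)%:E).
    by apply/measurable_EFinP; exact: measurable_funS mH.
  have HQ0 x : hcube (a, l) x -> (0 <= (H x)%:E)%E by rewrite lee_fin.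
  by rewrite (ge0_integralZl_EFin leb mQ HQ0 mHQ (ltW kap0)).
apply: le_trans step1 _; apply: le_trans step2 _.
apply: (@le_trans _ _ ((l ^+ n)%:E * (((`|C| * l `^ alpha)%:E * Wp) * L))%E).
  by apply: lee_wpmul2l; [rewrite lee_fin ltW|rewrite lee_wpmul2r].
rewrite !muleA -!EFinM le_eqVlt; apply/orP; left; apply/eqP; congr (_%:E * _ * _)%E.
rewrite /kap powRD; last by rewrite (gt_eqF l0) implybT.
rewrite powRN powR_mulrn ?(ltW l0)//.
by field; rewrite !gt_eqF.
Qed.

End half_oscillation.

(** * Necessity of the BMO condition *)

Section necessity.
Context {R : realType} {n : nat}.
Local Notation leb := (@lebesgue_rV R n).
Local Notation V := ('rV[R]_n).
Implicit Types (x y z a w : V) (f g u v b Omega om la : V -> R) (Q : V * R).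
Local Notation pm a Q f := (pmean leb a (hcube Q) f).

Lemma norm_le_max (t : R) : `|t| <= Num.max 0 t + Num.max 0 (- t).
Proof.
have h1 : t <= Num.max 0 t by rewrite le_max lexx orbT.
have h2 : 0 <= Num.max 0 t by rewrite le_max lexx.
have h3 : - t <= Num.max 0 (- t) by rewrite le_max lexx orbT.
have h4 : 0 <= Num.max 0 (- t) by rewrite le_max lexx.
by rewrite ler_norml; apply/andP; split; lra.
Qed.

(** The mean of b differs from m by at most the mean of |b - m|. *)
Lemma oscillation_le_any b Q (m : R) : 0 < Q.2 -> L1loc b ->
  (\int[leb]_(x in hcube Q) `|b x - avg b Q|%:E <=
   2%:E * \int[leb]_(x in hcube Q) `|b x - m|%:E)%E.
Proof.
move=> Q0 Lb; have [mb _] := Lb; have ib := L1loc_integrable Q Lb.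
have mQ : measurable (hcube Q) by exact: measurable_hcube.
have icst := integrable_cst_hcube m Q0.
have ibm : leb.-integrable (hcube Q) (EFin \o (fun x => b x - m)).
  by have := integrableB mQ ib icst; apply: eq_integrable.
have mbm : measurable_fun setT (fun x => `|b x - m|).
  by apply: measurableT_comp => //; exact: measurable_funB.
have mm (g : V -> R) : measurable_fun setT g -> measurable_fun (hcube Q) (fun x => (g x)%:E).
  by move=> mg; apply/measurable_EFinP; exact: measurable_funS mg.
have h1 := norm_avg_le Q0 ibm.
have e1 : avg (fun x => b x - m) Q = avg b Q - m.
  by rewrite (avgB ib icst) avg_cst.
rewrite e1 in h1.
apply: (@le_trans _ _ (\int[leb]_(x in hcube Q) (`|b x - m|%:E + `|avg b Q - m|%:E))%E).
  apply: ge0_le_integral => //.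
  - apply: mm; apply: measurableT_comp => //; exact: measurable_funB.
  - by apply: emeasurable_funD => //; exact: mm.
  move=> x _; rewrite -EFinD lee_fin (_ : b x - avg b Q = (b x - m) - (avg b Q - m)); last by ring.
  exact: ler_normB.
rewrite ge0_integralD//; last by exact: mm.
rewrite integral_cst//.
have -> : (2%:E * \int[leb]_(x in hcube Q) `|b x - m|%:E =
   \int[leb]_(x in hcube Q) `|b x - m|%:E + \int[leb]_(x in hcube Q) `|b x - m|%:E)%E.
  by rewrite -mule2n muleC mule_natr.
by rewrite leeD2l.
Qed.

(** Add the two halves of [half_oscillation] for a median m of b on the
    translated cube, and compare weights by [weights_chain]. *)
Theorem commutator_bounded_BMO (alpha p q : R) (omega lambda b Omega : V -> R) :
  0 < alpha < n%:R -> 1 < p < n%:R / alpha -> q^-1 = p^-1 - alpha / n%:R ->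
  Apq p q omega -> Apq p q lambda -> L1loc b ->
  {within unit_sphere, continuous Omega} ->
  (exists2 x, unit_sphere x & Omega x != 0) -> homogeneous0 Omega ->
  commutator_bounded Omega alpha b p (fun x => omega x `^ p) q (fun x => lambda x `^ q) ->
  BMO (fun x => omega x / lambda x) b.
Proof.
move=> alphan pn qE Ao Al Lb cO [x0 x01 Ox0] hO [C hC].
have [a0 an] := andP alphan; have [p1 _] := andP pn.
have n0 : (0 < n)%N by rewrite -(ltr0n R); exact: lt_trans an.
have n0' : 0 < n%:R :> R by rewrite ltr0n.
have [q1 pp qq] := exponents alphan pn qE.
have p0 : 0 < p := lt_trans ltr01 p1. have q0 : 0 < q := lt_trans ltr01 q1.
have pi1 : p^-1 < 1 by rewrite invf_lt1.
have qi1 : q^-1 < 1 by rewrite invf_lt1.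
have an0 : 0 < alpha / n%:R by rewrite divr_gt0.
have p'0 : 0 < conj_exponent p by rewrite invr_gt0; lra.
have q'0 : 0 < conj_exponent q by rewrite invr_gt0; lra.
have [mb _] := Lb.
have [K1 mo] := Apq_muck Ao. have [K2 ml] := Apq_muck Al.
have [[[mom _] o0] _] := Ao. have [[[mla _] l0] _] := Al.
set om := positive_version omega in mo. set la := positive_version lambda in ml.
have po : posfun om := posfun_positive_version mom.
have pl : posfun la := posfun_positive_version mla.
have pmu : posfun (fun x => om x / la x).
  split; last by move=> x; rewrite divr_gt0 ?po.2 ?pl.2.
  by apply: measurable_funM; [exact: po.1|exact: (posfun_inv pl).1].
have aem : {ae leb, forall x, omega x / lambda x = om x / la x}.
  apply: filterS2 (positive_versionE o0) (positive_versionE l0) => x h1 h2.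
  by rewrite {1}h1 {1}h2.
apply: (BMO_le (measurable_funM mom (measurable_funV mla)) pmu aem mb).2.
have [c [w [c0 hk]]] := kernel_sign an cO hO x01 Ox0.
(* Any bound for the coordinates of w serves; the sum avoids a maximum over an
   index set that depends on n. *)
pose W := \sum_(i < n) `|w ord0 i|.
have W0 : 0 <= W by exact: sumr_ge0.
have hw i : `|w ord0 i| <= W by rewrite /W (bigD1 i)//= lerDl sumr_ge0.
pose k : R := (2 * W + 1) ^+ n.
pose E := (k `^ q^-1 * k `^ (conj_exponent p)^-1) ^+ 2 * (`|K1| * `|K2|).
have E0 : 0 <= E by rewrite mulr_ge0 ?sqr_ge0// mulr_ge0.
pose D := 2 / c * `|C|; have D0 : 0 <= D by rewrite mulr_ge0// divr_ge0// ltW.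
have DD0 : 0 <= D + D by exact: addr_ge0.
exists (2 * (D + D) * E + 1); first by rewrite ltr_wpDl// mulr_ge0// mulr_ge0.
move=> a l l0'; pose a' := a - l *: w.
have V0 : 0 < l ^+ n by rewrite exprn_gt0.
have mQ : measurable (hcube (a, l)) by exact: measurable_hcube.
have [m [hm1 hm2]] := @median_exists R n b (a', l) l0' mb.
have mset (P : set R) : measurable P -> measurable (hcube (a', l) `&` b @^-1` P).
  move=> mP; apply: measurableI; first exact: measurable_hcube.
  by have := mb measurableT _ mP; rewrite setTI.
have mF1 : measurable (hcube (a', l) `&` [set x | b x <= m]).
  rewrite (_ : [set x | b x <= m] = b @^-1` `]-oo, m]%classic); first exact: mset.
  by apply/seteqP; split => x /=; rewrite in_itv.
have mF2 : measurable (hcube (a', l) `&` [set x | m <= b x]).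
  rewrite (_ : [set x | m <= b x] = b @^-1` `[m, +oo[%classic); first exact: mset.
  by apply/seteqP; split => x /=; rewrite in_itv/= andbT.
have sg1 : `|Num.sg (Omega x0)| = 1 by rewrite normr_sg Ox0.
have pq : 0 < p <= q.
  by rewrite p0 -[q]invrK -[p]invrK lef_pV2 ?posrE ?invr_gt0//; lra.
have poo : (pm p (a', l) om < +oo)%E.
  apply: le_lt_trans (muck_lty q0 p'0 mo _ : (pm q (a', l) om < +oo)%E) => //.
  by apply: pmean_mono => //; [exact: fat_hcube|exact: po.1|move=> x; rewrite ltW ?po.2].
have half := fun s F => @half_oscillation R n alpha p q C omega lambda b Omega a a' l m s
  (Num.sg (Omega x0)) c F alphan p0 q1 qE mom o0 mla l0 mb hC l0'.
have h1 := half 1 _ (normr1 _) sg1 c0 (fun x y => hk a l x y l0') poo mF1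
  (@subIsetl _ _ _) hm1 _.
have h2 := half (-1) _ (normrN1 _) sg1 c0 (fun x y => hk a l x y l0') poo mF2
  (@subIsetl _ _ _) hm2 _.
set Z := (pm p (a', l) om * _)%E in h1 h2.
have Z0 : (0 <= Z)%E by rewrite mule_ge0 ?pmean_ge0.
have hZ : (Z <= E%:E * pm 1 (a, l) (fun x => om x / la x)%R)%E.
  apply: (@weights_chain R n p q (conj_exponent p) (conj_exponent q) `|K1| `|K2| W k) => //.
  - lra.
  - lra.
  - exact: muck_weaken mo (ler_norm _).
  - exact: muck_weaken ml (ler_norm _).
apply: le_trans (oscillation_le_any m (l0' : 0 < (a, l).2) Lb) _.
have mmax (s : R) : measurable_fun (hcube (a, l)) (fun x => (Num.max 0 (s * (b x - m)))%:E).
  apply/measurable_EFinP; apply: (@measurable_funS _ _ _ _ setT) => //.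
  apply: measurable_maxr => //; apply: measurable_funM => //; exact: measurable_funB.
have max0 (s : R) x : (0 <= (Num.max 0 (s * (b x - m)))%:E)%E by rewrite lee_fin le_max lexx.
have hsum : (\int[leb]_(x in hcube (a, l)) `|b x - m|%:E <= (l ^+ n * (D + D))%:E * Z)%E.
  apply: (@le_trans _ _ (\int[leb]_(x in hcube (a, l)) ((Num.max 0 (1 * (b x - m)))%:E +
      (Num.max 0 (-1 * (b x - m)))%:E))%E).
    apply: ge0_le_integral => //.
    - apply/measurable_EFinP; apply: (@measurable_funS _ _ _ _ setT) => //.
      by apply: measurableT_comp => //; exact: measurable_funB.
    - by apply: emeasurable_funD.
    move=> x _; rewrite -EFinD lee_fin mul1r mulN1r.
    exact: norm_le_max.
  rewrite ge0_integralD//.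
  have LD0 : 0 <= l ^+ n * D := mulr_ge0 (ltW V0) D0.
  rewrite mulrDr EFinD ge0_muleDl ?lee_fin//.
  apply: leeD.
    by apply: h1 => y [_ /=]; rewrite !mul1r.
  by apply: h2 => y [_ /=]; rewrite !mulN1r lerN2.
have Imu : (\int[leb]_(x in hcube (a, l)) (om x / la x)%:E = (l ^+ n)%:E * pm 1 (a, l) (fun x => om x / la x)%R)%E.
  rewrite pmean_hcubeE// invr1 poweRe1; last first.
    by rewrite mule_ge0 ?pint_ge0// lee_fin invr_ge0 ltW.
  rewrite muleA -EFinM mulfV ?gt_eqF// mul1e; apply: eq_integral => x _.
  by rewrite powRr1// ltW// pmu.2.
rewrite Imu.
apply: le_trans (lee_wpmul2l _ hsum) _; first by rewrite lee_fin.
have P0 : (0 <= pm 1 (a, l) (fun x => om x / la x)%R)%E by exact: pmean_ge0.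
apply: (@le_trans _ _ (2%:E * ((l ^+ n * (D + D))%:E * (E%:E * pm 1 (a, l) (fun x => om x / la x)%R)))%E).
  apply: lee_wpmul2l; first by rewrite lee_fin.
  by apply: lee_wpmul2l => //; rewrite lee_fin; exact: (mulr_ge0 (ltW V0) DD0).
rewrite !muleA -!EFinM; apply: lee_wpmul2r => //.
rewrite lee_fin (_ : 2 * (l ^+ n * (D + D)) * E = 2 * (D + D) * E * l ^+ n); last by ring.
by rewrite ler_wpM2r ?(ltW V0)// lerDl.
Qed.

End necessity.

Theorem corollary4p10 (R : realType) (n : nat) (alpha p q : R)
    (omega lambda b Omega : 'rV[R]_n -> R) :
  0 < alpha < n%:R ->
  1 < p < n%:R / alpha ->
  q^-1 = p^-1 - alpha / n%:R ->
  Apq p q omega ->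
  Apq p q lambda ->
  L1loc b ->
  {within unit_sphere, continuous Omega} ->
  (exists2 x, unit_sphere x & Omega x != 0) ->
  homogeneous0 Omega ->
  BMO (fun x => omega x / lambda x) b <->
  commutator_bounded Omega alpha b
    p (fun x => omega x `^ p) q (fun x => lambda x `^ q).
Proof.
move=> alphan pn qE Ao Al Lb cO Ox0 hO; split.
  exact: BMO_commutator_bounded.
exact: commutator_bounded_BMO.
Qed.
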